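(* Let $F$ be a differential field of characteristic zero with algebraically closed field of constants $C$. Let $E$ be a Picard-Vessiot extension of $F$ for a monic operator $\mathcal L\in F[\partial]$ of order $n$, and suppose that $F$ contains an element $x$ with $x'=1$. (i) The following statements are equivalent. (a) The differential Galois group of $E$ over $F$ is a unipotent linear algebraic group. (b) The Picard-Vessiot ring $T(E|F)$ of $E$ is the set of all generalized iterated integrals in $E$ of $F$. (c) The field $E$ is generated as a differential field over $F$ by a generalized iterated integral of $F$. In particular, there exist a positive integer $l$ and $\mathbf g\in (F^* )^{l}$ such that $E$ is a Picard-Vessiot extension of $F$ for the differential operator $\mathcal L_{\mathbf g}$. (d) The operator $\mathcal L$ can be factored as $\mathcal L=\mathcal L_{\mathbf f}f_{n+1}$ for some $f_{n+1}\in F^*$ and $\mathbf f=(f_1,f_2,\dots,f_n)\in (F^* )^n$, in which case there is a $C$-basis $v_1,v_2,\dots,v_n\in E$ of the solution space of $\mathcal L(y)=0$ such that $$v_1=\frac{1}{f_{n+1}},\quad v_2=\frac{1}{f_{n+1}}\int\frac{1}{f_n},\quad v_3=\frac{1}{f_{n+1}}\left(\int\frac{1}{f_n}\left(\int\frac{1}{f_{n-1}}\right)\right),\ \dots,$$ $$v_n=\frac{1}{f_{n+1}}\left(\int\frac{1}{f_n}\left(\int\frac{1}{f_{n-1}}\cdots\frac{1}{f_3}\left(\int\frac{1}{f_2}\right)\cdots\right)\right).$$ (ii) The following statements are equivalent. (a) The field $E$ is generated as a differential field over $F$ by an iterated integral of $F$. (b) The differential Galois group of $E$ over $F$ is isomorphic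 to a commutative unipotent algebraic group.
   Context: $F^*$ denotes the set of nonzero elements of $F$. $F[\partial]$ is the ring of linear differential operators over $F$, with $\partial f=f\partial+f'$. For $\mathbf f=(f_1,\dots,f_l)\in(F^* )^l$ put $\mathcal L_{\mathbf f}:=f_1\partial f_2\partial\cdots f_{l-1}\partial f_l\partial\in F[\partial]$; the product $\mathcal L_{\mathbf f}f_{n+1}$ is taken in $F[\partial]$, so $(\mathcal L_{\mathbf f}f_{n+1})(y)=\mathcal L_{\mathbf f}(f_{n+1}y)$. Let $E$ be a differential field extension of $F$ with field of constants $C$. For an element $f$ of $E$, $\int f$ denotes an element of $E$ whose derivative is $f$ (an integral of $f$); formulas involving $\int$ mean that they hold for suitable choices of integrals in $E$. An element $\eta\in E$ is a generalized iterated integral of $F$ if there are a positive integer $l$ and $\mathbf f=(f_1,\dots,f_l)\in(F^* )^l$ with $\mathcal L_{\mathbf f}(\eta)=0$. It is an iterated integral of $F$ if there are a positive integer $l$ and $\mathbf f=(1,f_2,1,\dots,1)\in(F^* )^l$ with $\mathcal L_{\mathbf f}(\eta)=0$ (equivalently, $\eta^{(l)}\in F$ for some positive integer $l$). A Picard-Vessiot extension has no new constants. The differential Galois group $\mathscr G(E|F)$ is the group of $F$-automorphisms of $E$ commuting with the derivation, a linear algebraic group over $C$ when $E$ is a Picard-Vessiot extension. The Picard-Vessiot ring of a Picard-Vessiot extension $E$ is $T(E|F):=\{y\in E\mid \mathcal M(y)=0 \text{ for some nonzero } \mathcal M\in F[\partial]\}$. $E$ is generated as a differential field over $F$ by $\eta$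 if $E=F\langle\eta\rangle=F(\eta,\eta',\eta'',\dots)$. *)

(* Defs.v *)
From HB Require Import structures.
From mathcomp Require Import all_boot all_order all_algebra.
From mathcomp Require Import mpoly.
Set Implicit Arguments.
Unset Strict Implicit.
Unset Printing Implicit Defensive.
Import GRing.Theory.
Local Open Scope ring_scope.

HB.mixin Record Field_isDiff F of GRing.Field F := {
  der : F -> F;
  derD : forall x y, der (x + y) = der x + der y;
  derM : forall x y, der (x * y) = der x * y + x * der y
}.

#[short(type="diffFieldType")]
HB.structure Definition DiffField := {F of GRing.Field F & Field_isDiff F}.

Section Derivation.
Variable F : diffFieldType.
Implicit Types x y : F.

Lemma der0 : der 0 = 0 :> F.
Proof. by apply: (addrI (der 0)); rewrite -derD !addr0. Qed.

Lemma derN x : der (- x) = - der x.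
Proof. by apply: (addrI (der x)); rewrite -derD !subrr der0. Qed.

Lemma derB x y : der (x - y) = der x - der y.
Proof. by rewrite derD derN. Qed.

HB.instance Definition _ := GRing.isZmodMorphism.Build F F (@der F) derB.

Lemma der1 : der 1 = 0 :> F.
Proof.
by apply: (addrI (der 1)); rewrite addr0 -{3}[1]mulr1 derM mulr1 mul1r.
Qed.

Lemma derV x : der x^-1 = - (der x / x ^+ 2).
Proof.
have [->|x0] := eqVneq x 0; first by rewrite invr0 der0 mul0r oppr0.
apply: (mulfI x0); apply: (addrI (der x * x^-1)).
rewrite -derM mulfV // der1 mulrN mulrCA expr2 invfM (mulrA x) mulfV // mul1r.
by rewrite subrr.
Qed.

End Derivation.

Definition diff_morphism (F E : diffFieldType) (f : F -> E) : Prop :=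
  forall x, f (der x) = der (f x).

Section Constants.
Variable F : diffFieldType.

Definition is_const : {pred F} := fun x => der x == 0.

Lemma is_const_divring : divring_closed is_const.
Proof.
split=> [|x y|x y]; rewrite !unfold_in ?der1 //.
  by move=> /eqP dx /eqP dy; rewrite derB dx dy subr0.
by move=> /eqP dx /eqP dy; rewrite derM derV dx dy !(mul0r, mulr0) oppr0
  mulr0 addr0.
Qed.

HB.instance Definition _ :=
  GRing.isDivringClosed.Build F is_const is_const_divring.

Record constants := Const {const_val : F; const_valP : const_val \in is_const}.

HB.instance Definition _ := [isSub for const_val].
HB.instance Definition _ := [Choice of constants by <:].
HB.instance Definition _ := [SubChoice_isSubIntegralDomain of constants by <:].
HB.instance Definition _ := [SubIntegralDomain_isSubField of constants by <:].

End Constants.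

(* The operator \sum_i a_i ∂^i is encoded by the polynomial \sum_i a_i 'X^i;
   the product of the ring {diffop F} is not that of {poly F}. *)
Definition diffop (F : diffFieldType) : Type := {poly F}.
Notation "{ 'diffop' F }" := (diffop F) (at level 0, format "{ 'diffop'  F }").

Section Diffop.
Variable F : diffFieldType.
Implicit Types (p q r : {poly F}) (a b : F).

(* left multiplication by ∂: ∂ (b ∂^i) = b ∂^(i+1) + b' ∂^i *)
Definition dmul q : {poly F} := q * 'X + map_poly der q.

Definition diffop_mul p q : {poly F} :=
  \sum_(i < size p) p`_i *: iter i dmul q.

Lemma dmulD q r : dmul (q + r) = dmul q + dmul r.
Proof. by rewrite /dmul mulrDl raddfD addrACA. Qed.

Lemma dmul0 : dmul 0 = 0.
Proof. by rewrite /dmul mul0r raddf0 addr0. Qed.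

Lemma dmulZ a q : dmul (a *: q) = a *: dmul q + der a *: q.
Proof.
apply/polyP=> i; rewrite /dmul !(coefD, coefZ, coefMX, coef_map) /= derM.
rewrite mulrDr -addrA (addrC (a * der _)); congr (_ + _).
by case: ifP; rewrite ?mulr0 ?coefZ.
Qed.

Lemma iter_dmulD i q r : iter i dmul (q + r) = iter i dmul q + iter i dmul r.
Proof. by elim: i => //= i ->; rewrite dmulD. Qed.

Lemma iter_dmul0 i : iter i dmul 0 = 0.
Proof. by elim: i => //= i ->; rewrite dmul0. Qed.

Lemma diffop_mulE n p q : (size p <= n)%N ->
  diffop_mul p q = \sum_(i < n) p`_i *: iter i dmul q.
Proof.
move=> le_p_n; rewrite /diffop_mul (big_ord_widen n (fun i => p`_i *: iter i dmul q)) //.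
rewrite big_mkcond; apply: eq_bigr => i _; case: ltnP => // le_p_i.
by rewrite nth_default // scale0r.
Qed.

Lemma diffop_mulDl : left_distributive diffop_mul +%R.
Proof.
move=> p q r; pose n := maxn (size p) (size q).
rewrite (@diffop_mulE n (p + q)) ?size_polyD //.
rewrite (@diffop_mulE n p) ?leq_maxl // (@diffop_mulE n q) ?leq_maxr //.
by rewrite -big_split; apply: eq_bigr => i _ /=; rewrite coefD scalerDl.
Qed.

Lemma diffop_mulDr : right_distributive diffop_mul +%R.
Proof.
move=> p q r; rewrite /diffop_mul -big_split; apply: eq_bigr => i _ /=.
by rewrite iter_dmulD scalerDr.
Qed.

Lemma diffop_mulZl a p q : diffop_mul (a *: p) q = a *: diffop_mul p q.
Proof.
rewrite (@diffop_mulE (size p) (a *: p)) ?size_scale_leq // scaler_sumr.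
by apply: eq_bigr => i _; rewrite coefZ scalerA.
Qed.

Lemma diffop_mul0l q : diffop_mul 0 q = 0.
Proof. by rewrite /diffop_mul size_poly0 big_ord0. Qed.

Lemma diffop_mulC a q : diffop_mul a%:P q = a *: q.
Proof.
by rewrite (@diffop_mulE 1) ?size_polyC ?leq_b1 // big_ord1 coefC.
Qed.

Lemma diffop_mulX q : diffop_mul 'X q = dmul q.
Proof.
rewrite (@diffop_mulE 2) ?size_polyX // big_ord_recl big_ord1 !coefX /=.
by rewrite scale0r scale1r add0r.
Qed.

Lemma dmul_diffop_mul p q : dmul (diffop_mul p q) = diffop_mul (dmul p) q.
Proof.
rewrite [dmul p in RHS]/dmul diffop_mulDl.
rewrite (@diffop_mulE (size p) (map_poly der p)) ?size_poly //.
rewrite (@diffop_mulE (size p).+1 (p * 'X)); last first.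
  by rewrite (leq_trans (size_polyMleq _ _)) // size_polyX addn2.
rewrite big_ord_recl coefMX /= scale0r add0r -big_split /diffop_mul /=.
rewrite (big_morph dmul dmulD dmul0); apply: eq_bigr => i _.
by rewrite dmulZ coefMX /= coef_map.
Qed.

Lemma diffop_mulA : associative diffop_mul.
Proof.
move=> p q r.
have pE s : diffop_mul p s = \sum_(i < size p) p`_i *: iter i dmul s by [].
rewrite (pE (diffop_mul q r)) (pE q).
rewrite (big_morph (diffop_mul^~ r) (fun p q => diffop_mulDl p q r)
  (diffop_mul0l r)).
apply: eq_bigr => i _; rewrite diffop_mulZl; congr (_ *: _).
by elim: (nat_of_ord i) => //= k ->; rewrite dmul_diffop_mul.
Qed.

Lemma diffop_mul1l : left_id 1%:P diffop_mul.
Proof. by move=> q; rewrite diffop_mulC scale1r. Qed.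

Lemma diffop_mul1r : right_id 1%:P diffop_mul.
Proof.
move=> p; rewrite /diffop_mul -[RHS]coefK poly_def; apply: eq_bigr => i _.
congr (_ *: _); elim: (nat_of_ord i) => [|k /= ->]; first by rewrite expr0.
rewrite /dmul -exprSr -[RHS]addr0; congr (_ + _); apply/polyP=> j.
by rewrite coef_map coefXn coef0; case: eqP => _ /=; rewrite ?der1 ?der0.
Qed.

HB.instance Definition _ := GRing.Zmodule.copy {diffop F} {poly F}.
HB.instance Definition _ := GRing.Zmodule_isNzRing.Build {diffop F}
  diffop_mulA diffop_mul1l diffop_mul1r diffop_mulDl diffop_mulDr
  (oner_neq0 {poly F}).

Definition dopC a : {diffop F} := a%:P.
Definition dop_der : {diffop F} := 'X.

Lemma dop_derC a : dop_der * dopC a = dopC a * dop_der + dopC (der a).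
Proof.
rewrite [LHS]diffop_mulX [X in X + _]diffop_mulC /dmul.
by rewrite map_polyC mul_polyC.
Qed.

Definition dop_order (L : {diffop F}) : nat := (size (L : {poly F})).-1.
Definition monic_op (L : {diffop F}) : bool := (L : {poly F}) \is monic.

(* f_1 ∂ f_2 ∂ ... f_l ∂ *)
Definition Lop (f : seq F) : {diffop F} := \prod_(g <- f) (dopC g * dop_der).

End Diffop.

Section Extension.
Variables (F E : diffFieldType) (iota : {rmorphism F -> E}).
Local Notation C := (constants F).

Definition dop_app (L : {diffop F}) (y : E) : E :=
  \sum_(i < size (L : {poly F})) iota (L : {poly F})`_i * iter i der y.

Lemma dop_appE n (L : {diffop F}) y : (size (L : {poly F}) <= n)%N ->
  dop_app L y = \sum_(i < n) iota (L : {poly F})`_i * iter i der y.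
Proof.
move=> le_L_n; rewrite /dop_app.
rewrite (big_ord_widen n (fun i => iota (L : {poly F})`_i * iter i der y)) //.
rewrite big_mkcond; apply: eq_bigr => i _; case: ltnP => // le_L_i.
by rewrite nth_default // rmorph0 mul0r.
Qed.

Lemma dop_appC a y : dop_app (dopC a) y = iota a * y.
Proof.
by rewrite (@dop_appE 1) ?size_polyC ?leq_b1 // big_ord1 coefC.
Qed.

Lemma dop_app_der y : dop_app (dop_der F) y = der y.
Proof.
rewrite (@dop_appE 2) ?size_polyX // big_ord_recl big_ord1 !coefX /=.
by rewrite rmorph0 rmorph1 mul0r mul1r add0r.
Qed.

Lemma dop_appD (L M : {diffop F}) y :
  dop_app (L + M) y = dop_app L y + dop_app M y.
Proof.
pose n := maxn (size (L : {poly F})) (size (M : {poly F})).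
rewrite (@dop_appE n (L + M)) ?size_polyD //.
rewrite (@dop_appE n L) ?leq_maxl // (@dop_appE n M) ?leq_maxr //.
rewrite -big_split; apply: eq_bigr => i _ /=.
by rewrite -mulrDl -rmorphD -coefD.
Qed.

Lemma dop_appM (L M : {diffop F}) y : diff_morphism iota ->
  dop_app (L * M) y = dop_app L (dop_app M y).
Proof.
move=> iota_der.
have app0 : dop_app 0 y = 0 by rewrite /dop_app size_poly0 big_ord0.
have appZ a (q : {poly F}) : dop_app (a *: q) y = iota a * dop_app q y.
  rewrite (@dop_appE (size q) (a *: q)) ?size_scale_leq // mulr_sumr.
  by apply: eq_bigr => i _; rewrite coefZ rmorphM mulrA.
have appder (q : {poly F}) : dop_app (dmul q) y = der (dop_app q y).
  rewrite dop_appD (@dop_appE (size q) (map_poly der q)) ?size_poly //.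
  rewrite (@dop_appE (size q).+1 (q * 'X)); last first.
    by rewrite (leq_trans (size_polyMleq _ _)) // size_polyX addn2.
  rewrite big_ord_recl coefMX /= rmorph0 mul0r add0r -big_split /= raddf_sum.
  apply: eq_bigr => i _; rewrite coefMX coef_map /= derM -iota_der addrC.
  by [].
rewrite [dop_app L _]/dop_app -[L * M]/(diffop_mul L M) /diffop_mul.
rewrite (big_morph (dop_app^~ y) (fun p q => dop_appD p q y) app0).
apply: eq_bigr => i _; rewrite appZ; congr (_ * _).
by elim: (nat_of_ord i) => //= k <-; rewrite appder.
Qed.

Definition cst (c : C) : E := iota (const_val c).

Definition no_new_constants : Prop :=
  forall c : E, der c = 0 -> exists a : F, c = iota a.

(* E is its only differential subfield containing F and A *)
Definition diff_generated_by (A : E -> Prop) : Prop :=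
  forall S : E -> Prop,
    [/\ forall a, S (iota a),
        forall x y, S x -> S y -> S (x - y),
        forall x y, S x -> S y -> S (x * y),
        forall x, S x -> S x^-1
      & forall x, S x -> S (der x)] ->
    (forall x, A x -> S x) -> forall x, S x.

Definition lin_indep n (v : 'I_n -> E) : Prop :=
  forall c : 'I_n -> C, \sum_i cst (c i) * v i = 0 -> forall i, c i = 0.

Definition solution_basis (L : {diffop F}) n (v : 'I_n -> E) : Prop :=
  [/\ forall i, dop_app L (v i) = 0,
      lin_indep v
    & forall y, dop_app L y = 0 -> exists c : 'I_n -> C,
        y = \sum_i cst (c i) * v i].

(* L need not be monic: f_1 ∂ ... f_l ∂ is not *)
Definition picard_vessiot (L : {diffop F}) : Prop :=
  [/\ L != 0, no_new_constants
    & exists v : 'I_(dop_order L) -> E,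
        solution_basis L v /\ diff_generated_by (fun y => exists i, y = v i)].

(* T(E|F) *)
Definition PV_ring (y : E) : Prop :=
  exists M : {diffop F}, M != 0 /\ dop_app M y = 0.

Definition nonzero_entries (f : seq F) : bool := all (fun a => a != 0) f.

Definition gen_iterated_integral (eta : E) : Prop :=
  exists f : seq F,
    [/\ (0 < size f)%N, nonzero_entries f & dop_app (Lop f) eta = 0].

(* the entries of f are numbered from 0, so that f_2 is f`_1 *)
Definition iterated_integral (eta : E) : Prop :=
  exists f : seq F,
    [/\ (0 < size f)%N, nonzero_entries f,
        forall i, (i < size f)%N -> i != 1%N -> f`_i = 1
      & dop_app (Lop f) eta = 0].

(* z = \int 1/g_1 (\int 1/g_2 ( ... (\int 1/g_k))) for some choice of the
   successive integrals in E; z = 1 when k = 0 *)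
Fixpoint nested_integral (g : seq F) (z : E) : Prop :=
  if g is a :: g' then
    exists w, nested_integral g' w /\ der z = (iota a)^-1 * w
  else z = 1.

Definition is_dgal (s : {rmorphism E -> E}) : Prop :=
  [/\ bijective s, diff_morphism s & forall a, s (iota a) = iota a].

(* When v is a basis of the solution space of an operator for which E is a
   Picard-Vessiot extension, this is the image of the faithful representation
   of the differential Galois group that makes it a linear algebraic group over
   C; another basis gives a conjugate subgroup of GL_n(C). *)
Definition dgal_mx n (v : 'I_n -> E) (A : 'M[C]_n) : Prop :=
  exists2 s, is_dgal s & forall j, s (v j) = \sum_i cst (A i j) * v i.

End Extension.

(* Linear algebraic groups over the algebraically closed field K are taken to be
   the Zariski closed subgroups of some GL_n(K). *)
Section AlgebraicGroups.
Variable K : fieldType.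

Definition mx_eval n (p : {mpoly K[n * n]}) (A : 'M[K]_n) : K :=
  p.@[fun k => mxvec A 0 k].

Definition zariski_closed n (G : 'M[K]_n -> Prop) : Prop :=
  exists I : {mpoly K[n * n]} -> Prop,
    forall A, G A <-> A \in unitmx /\ forall p, I p -> mx_eval p A = 0.

Definition linear_algebraic_group n (G : 'M[K]_n -> Prop) : Prop :=
  [/\ zariski_closed G, G 1%:M,
      forall A B, G A -> G B -> G (A *m B)
    & forall A, G A -> G (invmx A)].

Definition unipotent_mx n (A : 'M[K]_n) : Prop :=
  exists k : nat, (A - 1%:M) ^+ k = 0.

Definition unipotent_group n (G : 'M[K]_n -> Prop) : Prop :=
  linear_algebraic_group G /\ forall A, G A -> unipotent_mx A.

Definition commutative_group n (G : 'M[K]_n -> Prop) : Prop :=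
  forall A B, G A -> G B -> A *m B = B *m A.

(* the regular functions on GL_n(K) are the elements of K[x_ij, 1/det] *)
Definition regular_on n m (G : 'M[K]_n -> Prop) (phi : 'M[K]_n -> 'M[K]_m) :
    Prop :=
  forall i j, exists (p : {mpoly K[n * n]}) (k : nat),
    forall A, G A -> phi A i j = mx_eval p A / (\det A) ^+ k.

Definition alg_group_iso n m (G : 'M[K]_n -> Prop) (H : 'M[K]_m -> Prop) :
    Prop :=
  exists (phi : 'M[K]_n -> 'M[K]_m) (psi : 'M[K]_m -> 'M[K]_n),
    [/\ forall A, G A -> H (phi A) /\ psi (phi A) = A,
        forall B, H B -> G (psi B) /\ phi (psi B) = B,
        forall A B, G A -> G B -> phi (A *m B) = phi A *m phi B,
        regular_on G phi
      & regular_on H psi].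

End AlgebraicGroups.

(* Main.v *)
(* Let G be the group of differential automorphisms of E over F. A nonzero
   F-linear operator of order n has at most n solutions that are independent
   over C (Wronskian). For a fundamental matrix W of L the relations over F of
   the entries of W cut out G in GL_n(C), and the Nullstellensatz shows that the
   field fixed by G is F.

   If L = L_f f', the filtration of the solutions by partial integrals makes G
   unipotent. Conversely a unipotent G fixes a solution v_1, which lies in F;
   induction on the derivatives of the v_i / v_1 yields the factorization, and
   the same argument applied to the G-orbit of an element of T(E|F) shows that
   it is a generalized iterated integral. As F contains x, a cyclic vector
   argument produces one generator out of finitely many. A generalized iterated
   integral that generates E makes E a field of fractions of elements on which
   G acts unipotently, so G has no eigenvalue but 1 on solutions.

   For (ii), if eta^(l) is in F, then s(eta) - eta is a polynomial in x with
   constant coefficients, so that G is commutative. Conversely, an isomorphism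
   with a unipotent group makes G unipotent, since the entries of B^k are
   polynomials in k, whence so are those of A^k. When G is commutative
   and unipotent, an induction on the order of the differences (s_1 - 1) ...
   (s_k - 1) killing an element shows that E is generated by primitives p, that
   is p' in F, and eta + x^l p generates both p and eta for suitable l. *)
Require Import Defs.
From HB Require Import structures.
From Stdlib Require Import Classical ClassicalEpsilon FunctionalExtensionality.
From mathcomp Require Import all_boot all_order all_algebra.
From mathcomp Require classical_sets.
From mathcomp Require Import mpoly.
From mathcomp Require Import zify ring.
Set Implicit Arguments.
Unset Strict Implicit.
Unset Printing Implicit Defensive.
Import GRing.Theory.
Local Open Scope ring_scope.

(** * Kolchin's fixed vector *)

(** The fixed field calls for the tensor product of [E] and [F[W]] over [F], which is never built. A
    relation [p(W) = 0] is recorded as the polynomial [p(W X)] over [E]. As [W' = B W] with [B] over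
    [F], the [E]-span of these polynomials is stable under derivation of coefficients, hence spanned
    by its members with constant coefficients; these are the equations of [G]. If
    [z = alpha(W) / beta(W)] is fixed by [G], then [z beta(W X) - alpha(W X)] vanishes on [G]; the
    same descent leads to constant polynomials, where the Nullstellensatz over [C] applies.
    Substituting [W^-1 X] for [X] then makes [z ⊗ beta - 1 ⊗ alpha] nilpotent. A second obstacle:
    the elements on which an automorphism acts unipotently form a ring, but need not form a field. A
    generator of [E] describes solutions only as quotients of such elements, and the eigenvalue 1
    comes from comparing numerator and denominator. The element [x] enters the cyclic vector
    argument because a nonzero operator cannot kill all powers of [x], so that a vanishing
    coordinate can be repaired by an element of [F]. *)

Lemma span_rows (K : fieldType) n (P : 'rV[K]_n -> Prop) :
  exists m (M : 'M[K]_(m, n)),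
    (forall i, P (row i M)) /\ (forall v, P v -> (v <= M)%MS).
Proof.
suff: forall d m (M : 'M[K]_(m, n)), (forall i, P (row i M)) ->
    (n - \rank M <= d)%N -> exists m (M : 'M[K]_(m, n)),
    (forall i, P (row i M)) /\ (forall v, P v -> (v <= M)%MS).
  move=> /(_ n 0%N (0 : 'M_(0, n))); apply; first by case.
  by rewrite leq_subr.
elim=> [|d IHd] m M PM le_d.
  exists m, M; split=> // v _; apply: submx_full.
  by rewrite /row_full eqn_leq rank_leq_col -subn_eq0 -leqn0.
case: (classic (forall v, P v -> (v <= M)%MS)) => [spanM|].
  by exists m, M.
move=> /not_all_ex_not [v /(imply_to_and (P v)) [Pv vM]].
apply: (IHd (m + 1)%N (col_mx M v)) => [i|].
  case: (split_ordP i) => j ->; last by rewrite rowKd row_id.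
  by rewrite rowKu.
have lt: (M < col_mx M v)%MS.
  rewrite ltmxE; apply/andP; split.
    by apply/submxP; exists (row_mx 1%:M 0); rewrite mul_row_col mul1mx mul0mx addr0.
  apply/negP=> le; apply: vM; apply: submx_trans le.
  by apply/submxP; exists (row_mx 0 1%:M); rewrite mul_row_col mul1mx mul0mx add0r.
by have := rank_ltmx lt; have := rank_leq_col (col_mx M v); lia.
Qed.

(** A column killed by a spanning family [M] is zero, so [M] has full column rank. As the rows of
    [M] are still of the given kind, [B] provides explicit combinations of derivatives, or of
    differences, dual to a given family. *)
Lemma separating_left_inverse (K : fieldType) n (P : 'rV[K]_n -> Prop) :
  (forall g : 'cV_n, (forall v, P v -> v *m g = 0) -> g = 0) ->
  exists m (M : 'M[K]_(m, n)) (B : 'M[K]_(n, m)),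
    (forall i, P (row i M)) /\ B *m M = 1%:M.
Proof.
move=> sepP; have [m [M [PM spanM]]] := span_rows P.
have [B BM] : exists B, B *m M = 1%:M.
  apply/row_fullP; rewrite -cokermx_eq0; apply/eqP/matrixP=> i j.
  have /matrixP/(_ i 0) : col j (cokermx M) = 0.
    apply: sepP => v /spanM /submxP[w ->].
    by rewrite -mulmxA colE (mulmxA M) mulmx_coker mul0mx mulmx0.
  by rewrite !mxE.
by exists m, M, B.
Qed.

Lemma monic_single_root (K : fieldType) (c : K) (p : {poly K}) :
  GRing.closed_field_axiom K -> p \is monic ->
  (forall r, root p r -> r = c) -> p = ('X - c%:P) ^+ (size p).-1.
Proof.
move=> closedK p_mon p_c; have [m [q qN0 Dp]] := multiplicity_XsubC p c.
move: qN0; rewrite (monic_neq0 p_mon) /= => qc.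
have q_mon : q \is monic by rewrite Dp monicMr ?rpredX ?monicXsubC in p_mon.
have q1 : q = 1.
  have [/eqP/size_poly1P[a _ Dq]|] := eqVneq (size q) 1%N.
    by move: q_mon; rewrite Dq monicE lead_coefC => /eqP->.
  move/(PreClosedField.closed_rootP closedK) => [r qr].
  by move: qc; rewrite -(p_c r) ?qr // Dp rootM qr.
by rewrite Dp q1 mul1r size_exp_XsubC.
Qed.

Lemma char_poly_single_eigenvalue (K : fieldType) n (A : 'M[K]_n) (c : K) :
  GRing.closed_field_axiom K ->
  (forall a (v : 'rV_n), v != 0 -> v *m A = a *: v -> a = c) ->
  char_poly A = ('X - c%:P) ^+ n.
Proof.
move=> closedK eigA; rewrite (@monic_single_root K c (char_poly A)) //.
- by rewrite size_char_poly.
- exact: char_poly_monic.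
by move=> r; rewrite -eigenvalue_root_char => /eigenvalueP[v vA vN0]; apply: eigA vA.
Qed.

Lemma unipotent_single_eigenvalue (K : fieldType) n (A : 'M[K]_n) :
  GRing.closed_field_axiom K ->
  (forall a (v : 'rV_n), v != 0 -> v *m A = a *: v -> a = 1) ->
  unipotent_mx A.
Proof.
move=> closedK eigA; exists n; case: n A eigA => [|n] A eigA.
  by apply/matrixP; case.
have := Cayley_Hamilton A; rewrite (char_poly_single_eigenvalue closedK eigA).
by rewrite rmorphXn rmorphB /= horner_mx_X horner_mx_C.
Qed.

Lemma mulmx_iter_eigen (K : fieldType) n (A : 'M[K]_n) a (v : 'rV_n) k :
  v *m A = a *: v -> v *m A ^+ k = a ^+ k *: v.
Proof.
move=> vA; elim: k => [|k IHk]; first by rewrite !expr0 mulmx1 scale1r.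
by rewrite !exprS -mulmxE mulmxA vA -scalemxAl IHk scalerA.
Qed.

Lemma char_poly_unipotent (K : fieldType) n (A : 'M[K]_n) :
  GRing.closed_field_axiom K -> unipotent_mx A ->
  char_poly A = ('X - 1%:P) ^+ n.
Proof.
move=> closedK [k Ak]; apply: char_poly_single_eigenvalue => // a v vN0 vA.
have : v *m (A - 1%:M) = (a - 1) *: v.
  by rewrite mulmxBr vA mulmx1 scalerBl scale1r.
move/(mulmx_iter_eigen k); rewrite Ak mulmx0 => /esym/eqP.
by rewrite scalemx_eq0 (negPf vN0) orbF expf_eq0 subr_eq0 => /andP[_ /eqP].
Qed.

Lemma mxtrace_nilpotent (K : fieldType) n (A : 'M[K]_n) k :
  GRing.closed_field_axiom K -> A ^+ k = 0 -> \tr A = 0.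
Proof.
move=> closedK Ak; case: n A Ak => [|n] A Ak.
  by rewrite /mxtrace big_ord0.
apply/eqP; rewrite -oppr_eq0 -char_poly_trace //.
rewrite (@char_poly_single_eigenvalue _ _ A 0) => // [|a v vN0 /(mulmx_iter_eigen k)].
  by rewrite subr0 coefXn /= (ltn_eqF (leqnn _)).
move/esym/eqP; rewrite Ak mulmx0 scalemx_eq0 (negPf vN0) orbF expf_eq0.
by move=> /andP[_ /eqP].
Qed.

(** In the rank factorization of [e], idempotence makes the product of the two factors in the other
    order an identity matrix of size the rank. *)
Lemma mxtrace_idempotent (K : fieldType) n (e : 'M[K]_n) :
  e *m e = e -> \tr e = (\rank e)%:R.
Proof.
move=> ee; rewrite -{1}(mulmx_base e) mxtrace_mulC.
suff -> : row_base e *m col_base e = 1%:M by rewrite mxtrace1.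
apply: (row_full_inj (col_base_full e)).
apply: (row_free_inj (row_base_free e)).
by rewrite mulmxA mulmx_base -mulmxA mulmx_base mulmx1 mulmx_base.
Qed.

(* The Fitting idempotent of [a] at its nonzero eigenvalues is a polynomial in
   [a] without constant term, so its trace, that is its rank, vanishes. *)
Lemma power_trace0_no_fixed (K : fieldType) n (a : 'M[K]_n.+1) (u : 'rV_n.+1) :
  [pchar K] =i pred0 -> (forall k, (0 < k)%N -> \tr (a ^+ k) = 0) ->
  u *m a = u -> u = 0.
Proof.
move=> /pcharf0P charK tra ua.
have u_horner p : u *m horner_mx a p = p.[1] *: u.
  elim/poly_ind: p => [|p c IHp]; first by rewrite rmorph0 mulmx0 horner0 scale0r.
  rewrite rmorphD rmorphM /= horner_mx_X horner_mx_C mulmxDr -mulmxE mulmxA IHp.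
  by rewrite -scalemxAl ua mul_mx_scalar -scalerDl !hornerE.
have tr_horner p : \tr (horner_mx a (p * 'X)) = 0.
  rewrite -[p]coefK poly_def mulr_suml !raddf_sum big1 //= => i _.
  by rewrite -scalerAl linearZ linearZ /= -exprSr rmorphXn /= horner_mx_X tra ?mulr0.
have [m [q]] := multiplicity_XsubC (char_poly a) 0.
rewrite (monic_neq0 (char_poly_monic a)) subr0 /= => q0 Dchi.
(* The exponent is [m.+1] rather than [m] so that [h] is divisible by ['X] even when [a] is
   invertible. *)
have cop : coprimep q ('X ^+ m.+1).
  by rewrite coprimep_expr // -[X in coprimep _ X]subr0 coprimep_XsubC.
have /Bezout_eq1_coprimepP[[t s] /= st] := cop.
pose h := s * 'X ^+ m.+1.
have hh : h * h = h - s * t * 'X * char_poly a.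
  have hE : h = 1 - t * q by rewrite -st /h; ring.
  by rewrite {2}hE Dchi /h exprS; ring.
pose e := horner_mx a h.
have ee : e *m e = e.
  rewrite mulmxE /e -rmorphM hh rmorphB [X in _ - X]rmorphM /= Cayley_Hamilton.
  by rewrite mulr0 subr0.
have /eqP : \tr e = 0 by rewrite /e /h exprSr mulrA tr_horner.
rewrite mxtrace_idempotent // charK mxrank_eq0 => /eqP e0.
have := u_horner h; rewrite -/e e0 mulmx0.
have chi1 : (char_poly a).[1] *: u = 0.
  by rewrite -u_horner Cayley_Hamilton mulmx0.
have [->//|uN0] := eqVneq u 0.
(* If [u] is nonzero, then 1 is a root of the characteristic polynomial, hence of [q], and [h.[1] =
   1] contradicts [e = 0]. *)
have q1 : q.[1] = 0.
  move/eqP: chi1; rewrite scalemx_eq0 (negPf uN0) orbF Dchi !hornerE expr1n.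
  by rewrite mulr1 => /eqP.
have : h.[1] = 1.
  by have := congr1 (horner^~ 1) st; rewrite /h !hornerE q1 mulr0 add0r.
by move=> -> /esym/eqP; rewrite scale1r (negPf uN0).
Qed.

(** When [S] is a group, this is the image of the augmentation ideal of its group algebra. *)
Inductive augmentation (K : fieldType) n (S : 'M[K]_n -> Prop) :
    'M[K]_n -> Prop :=
  | aug0 : augmentation S 0
  | augD a b : augmentation S a -> augmentation S b -> augmentation S (a + b)
  | augZ c a : augmentation S a -> augmentation S (c *: a)
  | augS A : S A -> augmentation S (A - 1%:M).

(* Kolchin. Linear combinations of the [A - 1] form an algebra of trace zero
   matrices; hence no vector [u] of a minimal invariant subspace [U] satisfies
   [u = u a] with [a] in it, and [u] is fixed. *)
Lemma kolchin_fixed_vector (K : fieldType) n (S : 'M[K]_n.+1 -> Prop) :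
  GRing.closed_field_axiom K -> [pchar K] =i pred0 ->
  (forall A B, S A -> S B -> S (A *m B)) -> (forall A, S A -> unipotent_mx A) ->
  exists2 u : 'rV_n.+1, u != 0 & forall A, S A -> u *m A = u.
Proof.
move=> closedK charK SM Su.
pose aug := augmentation S.
have augM x y : aug x -> aug y -> aug (x *m y).
  move=> ax ay; elim: ax => {x} [|x1 x2 _ IH1 _ IH2|c x1 _ IH1|A SA].
  - by rewrite mul0mx; apply: aug0.
  - by rewrite mulmxDl; apply: augD.
  - by rewrite -scalemxAl; apply: augZ.
  elim: ay => {y} [|x1 x2 _ IH1 _ IH2|c x1 _ IH1|B SB].
  - by rewrite mulmx0; apply: aug0.
  - by rewrite mulmxDr; apply: augD.
  - by rewrite -scalemxAr; apply: augZ.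
  have -> : (A - 1%:M) *m (B - 1%:M) =
      (A *m B - 1%:M) + (-1) *: ((A - 1%:M) + (B - 1%:M)).
    rewrite mulmxBl !mulmxBr !mul1mx !mulmx1; move: (A *m B) => X.
    by apply/matrixP=> i j; rewrite !mxE; ring.
  by apply: augD; [apply/augS/SM | apply/augZ/augD; apply: augS].
have aug_tr a : aug a -> \tr a = 0.
  elim=> {a} [|x y _ x0 _ y0|c x _ x0|A SA]; rewrite ?mxtrace0 //.
  - by rewrite mxtraceD x0 y0 addr0.
  - by rewrite mxtraceZ x0 mulr0.
  by have [k Ak] := Su A SA; apply: mxtrace_nilpotent Ak.
have no_fix a (u : 'rV_n.+1) : aug a -> u *m a = u -> u = 0.
  move=> aa ua; apply: (power_trace0_no_fixed charK _ ua); case=> // k _.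
  apply: aug_tr; elim: k => [|k IHk]; rewrite ?expr1 // exprS -mulmxE.
  exact: augM.
suff: forall r (U : 'M[K]_n.+1), (\rank U < r)%N -> U != 0 ->
    (forall A, S A -> (U *m A <= U)%MS) ->
    exists2 u : 'rV_n.+1, u != 0 & forall A, S A -> u *m A = u.
  move=> /(_ n.+2 1%:M); apply; first by rewrite ltnS rank_leq_row.
    exact: oner_neq0.
  by move=> A _; apply: submx1.
elim=> // r IHr U lt_r U0 US.
pose u := nz_row U; have u0 : u != 0 by rewrite nz_row_eq0.
have uU : (u <= U)%MS := nz_row_sub U.
have [m [M [rM spanM]]] :=
  span_rows (fun v => exists2 A, S A & v = u *m (A - 1%:M)).
have MU : (M <= U)%MS.
  apply/row_subP => i; have [A SA ->] := rM i.
  rewrite mulmxBr mulmx1 addmx_sub ?eqmx_opp //.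
  exact: submx_trans (submxMr A uU) (US A SA).
have [M0|MN0] := eqVneq M 0.
  exists u => // A SA; apply/eqP; rewrite -subr_eq0 -{2}[u]mulmx1 -mulmxBr.
  have : (u *m (A - 1%:M) <= M)%MS by apply: spanM; exists A.
  by rewrite M0 => /submx0null->.
have [UM|/negP UM] := boolP (U <= M)%MS.
  have /submxP[w Du] := submx_trans uU UM.
  have [a aa Da] : exists2 a, aug a & w *m M = u *m a.
    rewrite mulmx_sum_row; elim/big_ind: _ => [|x y [a aa ->] [b ab ->]|i _].
    - by exists 0; [apply: aug0 | rewrite mulmx0].
    - by exists (a + b); [apply: augD | rewrite mulmxDr].
    have [A SA ->] := rM i; exists (w 0 i *: (A - 1%:M)); first exact/augZ/augS.
    by rewrite scalemxAr.
  by move: u0; rewrite (no_fix a u) ?eqxx // -Da -Du.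
apply: (IHr <<M>>%MS).
- rewrite mxrank_gen; apply: leq_trans (rank_ltmx _) lt_r.
  by rewrite ltmxE MU; apply/negP.
- by rewrite -mxrank_eq0 mxrank_gen mxrank_eq0.
move=> B SB; rewrite (eqmxMr B (genmxE M)) genmxE; apply/row_subP => i.
rewrite row_mul; have [A SA ->] := rM i.
have -> : u *m (A - 1%:M) *m B = u *m (A *m B - 1%:M) - u *m (B - 1%:M).
  rewrite -mulmxA -mulmxBr; congr (_ *m _).
  by rewrite mulmxBl mul1mx opprB addrA subrK.
rewrite addmx_sub ?eqmx_opp // spanM //.
  by exists (A *m B) => //; apply: SM.
by exists B.
Qed.

(** * Points of prime ideals *)

Lemma rmorphism_of_fun (R S : pzRingType) (f : R -> S) :
  (forall x y, f (x - y) = f x - f y) -> (forall x y, f (x * y) = f x * f y) ->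
  f 1 = 1 -> exists g : {rmorphism R -> S}, g =1 f.
Proof.
move=> fB fM f1.
pose g : {rmorphism R -> S} := HB.pack f (GRing.isZmodMorphism.Build R S f fB)
  (GRing.isMonoidMorphism.Build R S f (f1, fM)).
by exists g.
Qed.

Lemma not_forall_imply (T : Type) (A B : T -> Prop) :
  ~ (forall x, A x -> B x) -> exists2 x, A x & ~ B x.
Proof.
by move=> NAB; apply: NNPP => NE; apply: NAB => x Ax; apply: NNPP => Bx; apply: NE; exists x.
Qed.

Lemma ex_minimizer (T : Type) (m : T -> nat) (A : T -> Prop) :
  (exists t, A t) -> exists2 t, A t & forall u, A u -> (m t <= m u)%N.
Proof.
case=> t; have [k] := ubnP (m t); elim: k t => // k IHk t lt_tk At.
case: (classic (exists2 u, A u & (m u < m t)%N)) => [[u Au lt_ut]|noless].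
  by apply: (IHk u) => //; apply: leq_trans lt_ut _.
by exists t => // u Au; rewrite leqNgt; apply/negP => lt; apply: noless; exists u.
Qed.

Definition ideal_pred (R : comNzRingType) (P : R -> Prop) :=
  [/\ P 0, forall x y, P x -> P y -> P (x + y) & forall a x, P x -> P (a * x)].

Definition prime_pred (R : comNzRingType) (P : R -> Prop) :=
  [/\ ideal_pred P, ~ P 1 & forall x y, P (x * y) -> P x \/ P y].

Section Ideal.
Variables (R : comNzRingType) (P : R -> Prop).
Hypothesis idP : ideal_pred P.

Lemma ideal_sum (I : Type) (r : seq I) (A : pred I) (f : I -> R) :
  (forall i, A i -> P (f i)) -> P (\sum_(i <- r | A i) f i).
Proof. by case: idP => P0 PD _ Pf; elim/big_ind: _. Qed.

Lemma idealN x : P x -> P (- x).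
Proof. by case: idP => _ _ PM Px; rewrite -mulN1r; apply: PM. Qed.

Lemma idealB x y : P x -> P y -> P (x - y).
Proof. by case: idP => _ PD _ Px Py; apply/PD/idealN. Qed.

Lemma ideal_addl x y : P x -> P (x + y) -> P y.
Proof. by move=> Px Pxy; rewrite -(addKr x y) addrC; apply: idealB. Qed.

End Ideal.

Lemma prime_exp (R : comNzRingType) (P : R -> Prop) a k x :
  prime_pred P -> ~ P a -> P (a ^+ k * x) -> P x.
Proof.
move=> [_ _ PM] Pa; elim: k => [|k IHk]; first by rewrite mul1r.
by rewrite exprS -mulrA => /PM[].
Qed.

(* every prime ideal is the intersection of the K-points containing it *)
Definition point_property (K : fieldType) (R : comNzRingType)
    (c : K -> R) :=
  forall (P : R -> Prop) b, prime_pred P -> ~ P b ->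
  exists phi : {rmorphism R -> K},
    [/\ forall k, phi (c k) = k, forall x, P x -> phi x = 0 & phi b != 0].

(** The kernel of [g] lies in the preimage of [P], so a point of that preimage factors through
    [g]. *)
Lemma point_property_surj (K : fieldType) (R B : comNzRingType)
    (c : K -> R) (g : {rmorphism R -> B}) :
  (forall t, exists r, g r = t) -> point_property c -> point_property (g \o c).
Proof.
move=> g_surj ppR P b primeP Pb; have [[P0 PD PM] P1 Pxy] := primeP.
have [r gr] := g_surj b.
have [||phi [phic phiP phir]] := ppR (fun x => P (g x)) r.
- split; last by move=> x y; rewrite rmorphM => /Pxy.
    split=> [|x y|a x]; rewrite ?rmorph0 ?rmorphD ?rmorphM //; first exact: PD.
    exact: PM.
  by rewrite rmorph1.
- by rewrite gr.
pose lift t := sval (constructive_indefinite_description _ (g_surj t)).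
have liftK t : g (lift t) = t by rewrite /lift; case: constructive_indefinite_description.
have phi_eq x y : g x = g y -> phi x = phi y.
  move=> gxy; apply/eqP; rewrite -subr_eq0 -rmorphB; apply/eqP/phiP.
  by rewrite rmorphB gxy subrr.
have [|||h hE] := @rmorphism_of_fun B K (fun t => phi (lift t)).
- by move=> x y; rewrite -rmorphB; apply: phi_eq; rewrite rmorphB !liftK.
- by move=> x y; rewrite -rmorphM; apply: phi_eq; rewrite rmorphM !liftK.
- by rewrite -(rmorph1 phi); apply: phi_eq; rewrite rmorph1 liftK.
exists h; split=> [k|x Px|]; rewrite hE.
- by rewrite -[RHS]phic; apply: phi_eq; rewrite liftK.
- by apply: phiP; rewrite liftK.
by rewrite (phi_eq _ r) // liftK gr.
Qed.

Lemma point_property_field (K : fieldType) (c : K -> K) :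
  (forall k, c k = k) -> point_property c.
Proof.
move=> cK P b [[P0 PD PM] P1 _] Pb.
have PE x : P x -> x = 0.
  move=> Px; have [//|x0] := eqVneq x 0; case: P1.
  by rewrite -(mulVf x0); apply: PM.
exists idfun; split=> //=.
by apply/eqP => b0; apply: Pb; rewrite b0.
Qed.

Section PolynomialPoints.
Variables (K : fieldType) (R : comNzRingType) (c : K -> R).
Hypotheses (closedK : GRing.closed_field_axiom K) (ppR : point_property c).
Variables (P : {poly R} -> Prop) (b : {poly R}).
Hypotheses (primeP : prime_pred P) (Pb : ~ P b).

(** [P0] is the contraction of [P] to [R], and [coefP0] the ideal [P0[X]]. Computing modulo [coefP0]
    replaces polynomials over the domain [R / P0]. *)
Let P0 (r : R) := P r%:P.
Let coefP0 (p : {poly R}) := forall i, P0 p`_i.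

Let idP : ideal_pred P. Proof. by case: primeP. Qed.

Let primeP0 : prime_pred P0.
Proof.
case: primeP => [[Pz PD PM] P1 Pxy]; split; rewrite /P0 ?polyC1 //.
  split=> [|x y|a x]; rewrite ?polyC0 ?polyCD ?polyCM //; first exact: PD.
  exact: PM.
by move=> x y; rewrite polyCM => /Pxy.
Qed.

Let idP0 : ideal_pred P0. Proof. by case: primeP0. Qed.

Let coefP0_P p : coefP0 p -> P p.
Proof.
move=> cp; rewrite -[p]coefK poly_def; apply: ideal_sum => // i _.
by rewrite -mul_polyC mulrC; case: idP => _ _; apply; apply: cp.
Qed.

Let coefP0D p q : coefP0 p -> coefP0 q -> coefP0 (p + q).
Proof. by move=> cp cq i; rewrite coefD; case: idP0 => _ PD _; apply: PD. Qed.

Let coefP0M p q : coefP0 q -> coefP0 (p * q).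
Proof.
move=> cq i; rewrite coefM; apply: ideal_sum => // j _.
by case: idP0 => _ _; apply.
Qed.

(** Leading terms with coefficient in [P0] are dropped until the degree is that of the image over
    [R / P0]. *)
Let reduce p : ~ coefP0 p ->
  exists q, [/\ ~ P0 (lead_coef q), (size q <= size p)%N & coefP0 (p - q)].
Proof.
have [k] := ubnP (size p); elim: k p => // k IHk p lt_pk Np.
case: (classic (P0 (lead_coef p))) => [Pl|Pl]; last first.
  by exists p; split=> // i; rewrite subrr coef0; case: idP0.
pose q := take_poly (size p).-1 p.
have pq : coefP0 (p - q).
  move=> i; rewrite coefB coef_take_poly; case: ltnP => [_|le_pi].
    by rewrite subrr; case: idP0.
  rewrite subr0; have [->//|ne] := eqVneq i (size p).-1.
  rewrite nth_default; first by case: idP0.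
  by rewrite (leq_trans (leqSpred _)) // ltn_neqAle eq_sym ne.
have p0 : p != 0.
  by apply/eqP => p0; apply: Np => i; rewrite p0 coef0; case: idP0.
have lt_qp : (size q < size p)%N.
  by rewrite (leq_ltn_trans (size_take_poly _ _)) // prednK // size_poly_gt0.
have [||r [Pr le_r qr]] := IHk q.
- by apply: leq_trans lt_qp _.
- by move=> cq; apply: Np; rewrite -(subrK q p); apply: coefP0D.
exists r; split=> //; first by apply: leq_trans le_r (ltnW _).
by rewrite -(subrK q p) -addrA; apply: coefP0D.
Qed.

(** Over the fraction field of [R / P0], such a [g] is a generator of [Q]. *)
Let minimal (Q : {poly R} -> Prop) : ideal_pred Q ->
  (forall p, coefP0 p -> Q p) -> (exists2 p, Q p & ~ coefP0 p) ->
  exists g, [/\ Q g, ~ P0 (lead_coef g) &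
    forall s, Q s -> (size s < size g)%N -> coefP0 s].
Proof.
move=> idQ cQ [p Qp Np].
have [|g [Qg Pg] ming] := @ex_minimizer _ (fun q : {poly R} => size q)
    (fun q => Q q /\ ~ P0 (lead_coef q)).
  have [q [Pq _ pq]] := reduce Np; exists q; split=> //.
  by rewrite -(subKr p q); apply: idealB => //; apply: cQ.
exists g; split=> // s Qs lt_sg; apply: NNPP => /reduce[q [Pq le_q sq]].
have : (size g <= size q)%N.
  apply: ming; split=> //; rewrite -(subKr s q).
  by apply: idealB => //; apply: cQ.
by rewrite leqNgt (leq_ltn_trans le_q).
Qed.

(** The remainder is in [Q] and shorter than [g], so it vanishes modulo [P0]; the power of the
    leading coefficient clears denominators. *)
Let pseudo_division (Q : {poly R} -> Prop) g p : ideal_pred Q ->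
  Q g -> ~ P0 (lead_coef g) -> (forall s, Q s -> (size s < size g)%N -> coefP0 s) ->
  Q p -> exists k r, coefP0 (lead_coef g ^+ k *: p - r * g).
Proof.
move=> idQ Qg Pg ming Qp; have := Pdiv.ComRing.rdivp_eq g p.
set k := Pdiv.CommonRing.rscalp _ _; set r := Pdiv.CommonRing.rdivp _ _ => e.
exists k, r; rewrite e addrAC subrr add0r; apply: ming; last first.
  rewrite Pdiv.CommonRing.ltn_rmodpN0 //; apply/eqP => g0; apply: Pg.
  by rewrite g0 lead_coef0; case: idP0.
apply: (ideal_addl idQ (x := r * g)); first by case: idQ => _ _; apply.
by rewrite -e -mul_polyC; case: idQ => _ _; apply.
Qed.

Let lead_neq0 p : ~ P0 (lead_coef p) -> p != 0.
Proof. by move=> Pp; apply/eqP => p0; apply: Pp; rewrite p0 lead_coef0; case: idP0. Qed.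

Let P0_M x y : ~ P0 x -> ~ P0 y -> ~ P0 (x * y).
Proof. by move=> Px Py; case: primeP0 => _ _ PM /PM[]. Qed.

Let P0_exp x k : ~ P0 x -> ~ P0 (x ^+ k).
Proof.
move=> Px P0x; case: (primeP0) => _ P1 _; apply: P1.
by apply: (prime_exp (k := k) primeP0 Px); rewrite mulr1.
Qed.

(** Over the fraction field of [R / P0], the ideal [P] is zero or maximal. If zero, a point of [R]
    keeps some coefficient of [b], and the variable avoids the roots of [b]. If maximal, [b] is
    invertible modulo [P] up to a denominator [gam]; a point of [R] keeping [gam] and the leading
    coefficient of the generator [p] extends by a root of [p]. *)
Lemma polynomial_point : exists phi : {rmorphism {poly R} -> K},
    [/\ forall k, phi (c k)%:P = k, forall x, P x -> phi x = 0 & phi b != 0].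
Proof.
pose ev (phi : {rmorphism R -> K}) (xi : K) : {rmorphism {poly R} -> K} :=
  horner_eval xi \o map_poly phi.
have evC phi xi r : ev phi xi r%:P = phi r.
  by rewrite /ev /= map_polyC /= /horner_eval hornerC.
have ev_coefP0 (phi : {rmorphism R -> K}) (xi : K) (p : {poly R}) : (forall x, P0 x -> phi x = 0) -> coefP0 p -> ev phi xi p = 0.
  move=> phi0 cp; rewrite /ev /= /horner_eval.
  suff -> : map_poly phi p = 0 by rewrite horner0.
  by apply/polyP => i; rewrite coef_map coef0 /= phi0.
case: (classic (forall p, P p -> coefP0 p)) => [allP0|].
  have [i bi] : exists i, ~ P0 b`_i.
    by apply: not_all_ex_not => /coefP0_P.
  have [phi [phic phi0 phib]] := ppR primeP0 bi.
  have : map_poly phi b != 0.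
    by apply/eqP => /polyP/(_ i); rewrite coef_map coef0 /=; apply/eqP.
  move/(PreClosedField.closed_nonrootP closedK) => [xi b_xi].
  exists (ev phi xi); split=> // [k|p /allP0 cp]; first by rewrite evC phic.
  exact: ev_coefP0.
move/not_forall_imply => [p0 Pp0 Np0].
have [||p [Pp lp minp]] := minimal idP; [exact: coefP0_P | by exists p0 | ].
(* The ideal [P + (b)]; its minimal element [g] turns out to be constant. *)
pose Q h := exists u, P (h - u * b).
have idQ : ideal_pred Q.
  have [Pz PD PM] := idP; split=> [|x y [u ux] [v vy]|a x [u ux]].
  - by exists 0; rewrite mul0r subr0.
  - exists (u + v); rewrite mulrDl opprD addrACA; exact: PD.
  by exists (a * u); rewrite -mulrA -mulrBr; apply: PM.
have PQ h : P h -> Q h by exists 0; rewrite mul0r subr0.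
have Qb : Q b by exists 1; rewrite mul1r subrr; case: idP.
have [||g [Qg lg ming]] := minimal idQ.
- by move=> h /coefP0_P/PQ.
- by exists p0 => //; apply: PQ.
have [k [r e]] := pseudo_division idQ Qg lg ming (PQ p Pp).
have Pg : ~ P g.
  move=> Pg; have [k' [r' e']] := pseudo_division idQ Qg lg ming Qb.
  apply: Pb; apply: (prime_exp (a := (lead_coef g)%:P) (k := k') primeP) => //.
  rewrite -polyC_exp mul_polyC -(subrK (r' * g) (_ *: _)).
  by case: idP => _ PD PM; apply: PD; [apply: coefP0_P | apply: PM].
have Pr : P r.
  have : P (r * g).
    rewrite -(subKr (lead_coef g ^+ k *: p) (r * g)); apply: idealB => //.
      by rewrite -mul_polyC; case: idP => _ _; apply.
    exact: coefP0_P.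
  by case: primeP => _ _ PM /PM[].
have lkp : ~ P0 (lead_coef g ^+ k * lead_coef p) by apply: P0_M => //; apply: P0_exp.
have Nr : ~ coefP0 r.
  move=> cr; apply: lkp; have := coefP0D e (coefP0M g cr).
  by rewrite mulrC subrK => /(_ (size p).-1); rewrite coefZ.
have [r' [lr' le_r' rr']] := reduce Nr.
have Pr' : P r' by rewrite -(subKr r r'); apply: idealB => //; apply: coefP0_P.
have le_pr' : (size p <= size r')%N.
  by rewrite leqNgt; apply/negP => /(minp _ Pr') cr'; apply: lr'; apply: cr'.
(* Modulo [P0], a multiple of [p] by a scalar outside [P0] equals [r' g], where [r'] in [P] is at
   least as long as [p]; so [g] has degree 0. *)
have g1 : (size g <= 1)%N.
  have lrg : ~ P0 (lead_coef r' * lead_coef g) by apply: P0_M.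
  have e' : coefP0 (lead_coef g ^+ k *: p - r' * g).
    have -> : lead_coef g ^+ k *: p - r' * g =
        (lead_coef g ^+ k *: p - r * g) + g * (r - r').
      by move: (_ *: p) => X; ring.
    by apply: coefP0D => //; apply: coefP0M.
  have r'0 := lead_neq0 lr'; have g0 := lead_neq0 lg.
  rewrite leqNgt; apply/negP => g2; apply: lrg.
  have := e' (size r' + size g).-2; rewrite coefB coefZ -mul_lead_coef.
  have le_arith a d e1 : (a <= d -> 1 < e1 -> a <= (d + e1).-2)%N by lia.
  rewrite [p`__]nth_default ?mulr0 ?sub0r; last exact: le_arith.
  by move/(idealN idP0); rewrite opprK.
have [gam Dg] : exists gam, g = gam%:P.
  by exists g`_0; apply: size1_polyC.
have Pgam : ~ P0 gam by move: lg; rewrite Dg lead_coefC.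
have [u ug] := Qg; rewrite Dg in ug.
(* Here [p] keeps its positive degree and acquires a root [xi]; since [gam] is congruent to [u b]
   modulo [P] and stays nonzero, so does [b]. *)
have [phi [phic phi0 phi_lg]] := ppR primeP0 (P0_M lp Pgam).
have [phi_lp phi_gam] : phi (lead_coef p) != 0 /\ phi gam != 0.
  by apply/andP; move: phi_lg; rewrite rmorphM mulf_eq0 negb_or.
have [xi xi_root] : exists xi, root (map_poly phi p) xi.
  apply/(PreClosedField.closed_rootP closedK).
  rewrite size_map_poly_id0 //; apply/negP => /size_poly1P[a a0 Dp].
  apply: lp; rewrite Dp lead_coefC; have := Pp; rewrite Dp.
  done.
exists (ev phi xi).
have evp : ev phi xi p = 0 by apply/eqP.
have evP h : P h -> ev phi xi h = 0.
  move=> Ph; have [k' [r'' e']] := pseudo_division idP Pp lp minp Ph.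
  have := ev_coefP0 phi xi _ phi0 e'.
  rewrite rmorphB rmorphM evp mulr0 subr0 -mul_polyC rmorphM evC rmorphXn.
  by move/eqP; rewrite mulf_eq0 expf_eq0 (negPf phi_lp) andbF => /eqP.
split=> // [l|]; first by rewrite evC phic.
apply/eqP => evb; move: phi_gam; have := evP _ ug.
by rewrite rmorphB rmorphM evb mulr0 subr0 evC => ->; rewrite eqxx.
Qed.

End PolynomialPoints.

Lemma mpoly_closure (R : comNzRingType) n (T : {mpoly R[n]} -> Prop) :
  (forall c, T c%:MP) -> (forall i, T 'X_i) ->
  (forall p q, T p -> T q -> T (p + q)) ->
  (forall p q, T p -> T q -> T (p * q)) -> forall p, T p.
Proof.
move=> TC TX TD TM p; rewrite [p]mpolyE.
elim/big_ind: _ => [|x y|m _]; [by rewrite -mpolyC0|exact: TD|].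
rewrite -mul_mpolyC; apply: (TM) => //; rewrite mpolyXE_id.
elim/big_ind: _ => [|x y|i _]; [by rewrite -mpolyC1|exact: TM|].
by elim: (m i) => [|k IHk]; rewrite ?expr0 -?mpolyC1 // exprS; apply: TM.
Qed.

(** Induction on the number of variables: [{mpoly K[n.+1]}] is an image of the polynomials over
    [{mpoly K[n]}], the new variable being the last. *)
Lemma mpoly_point_property (K : fieldType) n :
  GRing.closed_field_axiom K -> point_property (@mpolyC n K).
Proof.
move=> closedK; elim: n => [|n IHn].
  have surj t : exists r, @mpolyC 0 K r = t.
    elim/mpoly_closure: t => [c|[]//|p q [a <-] [b <-]|p q [a <-] [b <-]].
    - by exists c.
    - by exists (a + b); rewrite mpolyCD.
    by exists (a * b); rewrite mpolyCM.
  exact: (point_property_surj surj (@point_property_field K id (fun k => erefl))).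
pose g : {rmorphism {poly {mpoly K[n]}} -> {mpoly K[n.+1]}} :=
  horner_eval 'X_ord_max \o map_poly (@mwiden n K).
have gC r : g r%:P = mwiden r by rewrite /g /= map_polyC /= /horner_eval hornerC.
have surj t : exists r, g r = t.
  elim/mpoly_closure: t => [c|i|p q [a <-] [b <-]|p q [a <-] [b <-]].
  - by exists (c%:MP)%:P; rewrite gC mwidenC.
  - have [->|ni] := eqVneq i ord_max.
      by exists 'X; rewrite /g /= map_polyX /horner_eval hornerX.
    have lt_in : (i < n)%N.
      by rewrite ltn_neqAle -ltnS ltn_ord andbT; apply: contra ni => /eqP ni; apply/eqP/val_inj.
    exists ('X_(Ordinal lt_in))%:P; rewrite gC mwidenX mnmwiden1.
    by congr ('X_[U_(_)]); apply: val_inj.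
  - by exists (a + b); rewrite rmorphD.
  by exists (a * b); rewrite rmorphM.
have pp : point_property (fun k => (@mpolyC n K k)%:P).
  by move=> P b; apply: polynomial_point.
move=> P b primeP Pb; have [phi [phiC phiP phib]] := point_property_surj surj pp primeP Pb.
by exists phi; split=> // k; rewrite -[RHS]phiC /=; congr (phi _); rewrite -(mwidenC _ k); symmetry; apply: gC.
Qed.

Lemma prime_avoiding (R : comNzRingType) (J : R -> Prop) (b : R) :
  ideal_pred J -> (forall k, ~ J (b ^+ k)) ->
  exists P, [/\ prime_pred P, forall x, J x -> P x & ~ P b].
Proof.
move=> idJ Jb.
pose good (A : R -> Prop) := [/\ ideal_pred A, forall x, J x -> A x & forall k, ~ A (b ^+ k)].
have [|A [goodA maxA]] :=
    @classical_sets.Zorn_bigcup R (fun A => (forall x, ~ A x) \/ good A).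
  move=> F Fgood Ftot; case: (classic (exists2 A, F A & good A)); last first.
    move=> Nex; left=> x [A FA Ax]; case: (Fgood A FA) => [/(_ x)//|gA].
    by apply: Nex; exists A.
  move=> [A0 FA0 [[A00 A0D A0M] JA0 _]]; right; split.
  - split; first by exists A0.
      move=> x y [A FA Ax] [B FB By].
      have [AB|BA] := Ftot A B FA FB.
        have By' : B x by apply: AB.
        case: (Fgood B FB) => [/(_ x)//|[[_ BD _] _ _]].
        by exists B => //; apply: BD.
      have Ay : A y by apply: BA.
      case: (Fgood A FA) => [/(_ x)//|[[_ AD _] _ _]].
      by exists A => //; apply: AD.
    move=> a x [A FA Ax]; case: (Fgood A FA) => [/(_ x)//|[[_ _ AM] _ _]].
    by exists A => //; apply: AM.
  - by move=> x Jx; exists A0 => //; apply: JA0.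
  move=> k [A FA Ab]; case: (Fgood A FA) => [/(_ (b ^+ k))//|[_ _ NAb]].
  exact: NAb Ab.
have goodJ : good J by [].
have {goodA} [idA JA Ab] : good A.
  case: goodA => // A0; case: (maxA J); last by right.
  split; first by move=> x /A0.
  by move/(_ 0) => AJ; apply: (A0 0); apply: AJ; case: idJ.
exists A; split=> //; last by rewrite -[b]expr1; apply: Ab.
have [Az AD AM] := idA.
(* By maximality, the ideal generated by [A] and [x] contains a power of [b]. *)
have ext x : ~ A x -> exists k a, A (b ^+ k - a * x).
  move=> Ax; apply: NNPP => Nex.
  pose B z := exists a, A (z - a * x).
  case: (maxA B).
    split=> [z Az'|BA]; first by exists 0; rewrite mul0r subr0.
    by apply: Ax; apply: BA; exists 1; rewrite mul1r subrr.
  right; split.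
  - split; first by exists 0; rewrite mul0r subrr.
      move=> z t [u uz] [v vt]; exists (u + v).
      by rewrite mulrDl opprD addrACA; apply: AD.
    by move=> a z [u uz]; exists (a * u); rewrite -mulrA -mulrBr; apply: AM.
  - by move=> z Jz; exists 0; rewrite mul0r subr0; apply: JA.
  by move=> k [a ka]; apply: Nex; exists k, a.
split=> //; first by rewrite -(expr0 b); apply: Ab.
move=> x y Axy; apply: NNPP => /not_or_and[/ext[k [u ux]] /ext[l [v vy]]].
apply: (Ab (k + l)%N); rewrite exprD.
have -> : b ^+ k * b ^+ l = b ^+ l * (b ^+ k - u * x) + (u * x) * (b ^+ l - v * y)
   + u * v * (x * y) by ring.
by apply: (AD); [apply: (AD); apply: (AM) | apply: (AM)].
Qed.

(** As no power of [b] is in [J], some prime above [J] omits [b], and a point of that prime can be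
    chosen off the zeros of [b]. *)
Lemma nullstellensatz (K : fieldType) n (J : {mpoly K[n]} -> Prop) b :
  GRing.closed_field_axiom K -> ideal_pred J -> (forall k, ~ J (b ^+ k)) ->
  exists2 v : 'I_n -> K, forall q, J q -> q.@[v] = 0 & b.@[v] != 0.
Proof.
move=> closedK idJ Jb; have [P [primeP JP Pb]] := prime_avoiding idJ Jb.
have [phi [phiC phiP phib]] := mpoly_point_property closedK primeP Pb.
pose v i := phi 'X_i.
have phiE q : phi q = q.@[v].
  elim/mpoly_closure: q => [c|i|p q IHp IHq|p q IHp IHq].
  - by rewrite phiC mevalC.
  - by rewrite mevalXU.
  - by rewrite rmorphD mevalD IHp IHq.
  by rewrite rmorphM mevalM IHp IHq.
by exists v => [q /JP/phiP|]; rewrite -phiE.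
Qed.

(** * Wronskians and differences *)

Section ConstantsExtension.
Variables (F E : diffFieldType) (iota : {rmorphism F -> E}).
HB.instance Definition _ :=
  GRing.RMorphism.copy (@cst F E iota) (iota \o (\val : constants F -> F)).
End ConstantsExtension.

Section DiffExtension.
Variables (F E : diffFieldType) (iota : {rmorphism F -> E}).
Hypothesis iota_der : diff_morphism iota.
Local Notation C := (constants F).
Local Notation cst := (cst iota).

Lemma der_cst (c : C) : der (cst c) = 0.
Proof. by rewrite /Defs.cst -iota_der (eqP (const_valP c)) rmorph0. Qed.

Lemma der_cstM (c : C) z : der (cst c * z) = cst c * der z.
Proof. by rewrite derM der_cst mul0r add0r. Qed.

Lemma const_cst : no_new_constants iota ->
  forall z : E, der z = 0 -> exists c, z = cst c.
Proof.
move=> nnc z dz; have [a za] := nnc z dz.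
have da : a \in @is_const F.
  by rewrite unfold_in -(fmorph_eq0 iota) iota_der -za dz.
by exists (Const da).
Qed.

Lemma iter_derD k (y z : E) : iter k der (y + z) = iter k der y + iter k der z.
Proof. by elim: k => //= k ->; rewrite derD. Qed.

Lemma iter_der0 k : iter k der 0 = 0 :> E.
Proof. by elim: k => //= k ->; rewrite der0. Qed.

Lemma iter_der_lin k m (c : 'I_m -> C) (u : 'I_m -> E) :
  iter k der (\sum_i cst (c i) * u i) = \sum_i cst (c i) * iter k der (u i).
Proof.
rewrite (big_morph _ (iter_derD k) (iter_der0 k)); apply: eq_bigr => i _.
by elim: k => //= k ->; rewrite der_cstM.
Qed.

Lemma dop_app_lin (M : {diffop F}) m (c : 'I_m -> C) (u : 'I_m -> E) :
  dop_app iota M (\sum_i cst (c i) * u i) = \sum_i cst (c i) * dop_app iota M (u i).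
Proof.
rewrite /dop_app; under [RHS]eq_bigr do rewrite mulr_sumr.
rewrite exchange_big; apply: eq_bigr => k _; rewrite iter_der_lin mulr_sumr.
by apply: eq_bigr => i _; rewrite mulrCA.
Qed.

(* A nonconstant vector of minimal support, one entry of which is 1, has a
   derivative of smaller support, and likewise after division by another
   entry. *)
Lemma constant_vectors_span (I : eqType) (U T : (I -> E) -> Prop) (s : seq I) u :
  no_new_constants iota ->
  (forall e u, U u -> U (fun i => e * u i)) ->
  (forall u, U u -> U (fun i => der (u i))) ->
  T (fun=> 0) ->
  (forall u v, T u -> T v -> T (fun i => u i + v i)) ->
  (forall e u, T u -> T (fun i => e * u i)) ->
  (forall c : I -> C, U (fun i => cst (c i)) -> T (fun i => cst (c i))) ->
  U u -> (forall i, i \notin s -> u i = 0) -> T u.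
Proof.
move=> nnc UZ UD T0 TD TZ TC; have [k] := ubnP (size s).
elim: k s u => // k IHk s u lt_sk Uu su.
have smaller i v : i \in s -> U v -> v i = 0 -> (forall j, j \notin s -> v j = 0) -> T v.
  move=> si Uv vi0 sv; apply: (IHk (filter (predC1 i) s)) => // [|j].
    rewrite size_filter -ltnS (leq_trans _ lt_sk) // ltnS.
    rewrite -(count_predC (pred1 i) s) -[X in (X < _)%N]add0n ltn_add2r.
    by rewrite -has_count has_pred1.
  by rewrite mem_filter negb_and /= negbK => /orP[/eqP->|/sv].
have TZI e v : e != 0 -> T (fun i => e * v i) -> T v.
  move=> e0 Tv; have -> : v = fun i => e^-1 * (e * v i).
    by apply: functional_extensionality => i; rewrite mulKf.
  exact: TZ.
case: (classic (forall i, i \in s -> u i = 0)) => [u0|/not_forall_imply[i si /eqP ui]].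
  have -> : u = fun=> 0.
    apply: functional_extensionality => i.
    by have [/u0|/su] := boolP (i \in s).
  exact: T0.
apply: (TZI (u i)^-1); rewrite ?invr_eq0 //.
pose v j := (u i)^-1 * u j; rewrite -/v.
have Uv : U v by apply: UZ.
have sv j : j \notin s -> v j = 0 by move=> /su uj; rewrite /v uj mulr0.
have TDv : T (fun j => der (v j)).
  apply: (smaller i) => //; [exact: UD | by rewrite /v mulVf ?der1 |].
  by move=> j /sv ->; rewrite der0.
case: (classic (forall j, der (v j) = 0)) => [vC|/not_all_ex_not[j /eqP dvj]].
  pose c j := sval (constructive_indefinite_description _ (const_cst nnc (vC j))).
  have vE : v = fun j => cst (c j).
    apply: functional_extensionality => j; rewrite /c.
    by case: constructive_indefinite_description.
  by rewrite vE; apply: TC; rewrite -vE.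
have vj : v j != 0 by apply: contraNneq dvj => ->; rewrite der0.
have sj : j \in s by apply: contraNT vj => /sv->.
(* Both terms of the product rule for [(v j)^-1 * v] have smaller support: the derivative of the
   product vanishes at [j], that of [v] at [i]. *)
apply: (TZI (der (v j)^-1)).
  by rewrite derV oppr_eq0 mulf_neq0 // invr_eq0 expf_neq0.
have -> : (fun l => der (v j)^-1 * v l) =
    fun l => der ((v j)^-1 * v l) + - (v j)^-1 * der (v l).
  by apply: functional_extensionality => l; rewrite derM mulNr addrK.
apply: TD; last exact: TZ.
apply: (smaller j) => //; first exact/UD/UZ.
  by rewrite mulVf ?der1.
by move=> l /sv->; rewrite mulr0 der0.
Qed.

(** Deriving a relation and using the one for the next [k] shows that the relations are stable under
    derivation. A constant relation contradicts independence already at [k = 0]. *)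
Lemma wronskian_kernel0 m (u : 'I_m -> E) (e : 'I_m -> E) :
  no_new_constants iota -> lin_indep iota u ->
  (forall k, \sum_i e i * iter k der (u i) = 0) -> forall i, e i = 0.
Proof.
move=> nnc indu e0.
pose U (e : 'I_m -> E) := forall k, \sum_i e i * iter k der (u i) = 0.
apply: (@constant_vectors_span _ U (fun e => forall i, e i = 0) (enum 'I_m) e) => //.
- move=> a v Uv k; under eq_bigr do rewrite -mulrA.
  by rewrite -mulr_sumr Uv mulr0.
- move=> v Uv k; have := congr1 der (Uv k); rewrite der0 raddf_sum /=.
  under eq_bigr do rewrite derM.
  by rewrite big_split /= (Uv k.+1) addr0.
- by move=> v w v0 w0 i; rewrite v0 w0 addr0.
- by move=> a v v0 i; rewrite v0 mulr0.
- by move=> c /(_ 0%N) Uc i; rewrite (indu c Uc) rmorph0.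
by move=> i; rewrite mem_enum.
Qed.

Section Solutions.
Variables (M : {diffop F}).
Hypothesis M_neq0 : M != 0.
Let n := dop_order M.

Let reducible (phi : E -> E) :=
  exists b : 'I_n -> F, forall z, dop_app iota M z = 0 ->
    phi z = \sum_j iota (b j) * iter j der z.

(** The equation yields the [n]-th derivative and its derivatives the later ones. The coefficients
    are common to all solutions, so a relation between solutions that holds for the first [n]
    derivatives holds for all. *)
Lemma iter_der_reducible k : reducible (iter k der).
Proof.
have redD phi psi : reducible phi -> reducible psi ->
    reducible (fun z => phi z + psi z).
  move=> [b bE] [c cE]; exists (fun j => b j + c j) => z Mz.
  rewrite bE // cE // -big_split; apply: eq_bigr => j _.
  by rewrite rmorphD mulrDl.
have redZ a phi : reducible phi -> reducible (fun z => iota a * phi z).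
  move=> [b bE]; exists (fun j => a * b j) => z Mz.
  by rewrite bE // mulr_sumr; apply: eq_bigr => j _; rewrite rmorphM mulrA.
have red_sum (phi : 'I_n -> E -> E) : (forall j, reducible (phi j)) ->
    reducible (fun z => \sum_j phi j z).
  move=> redphi; have [b bE] : exists b : 'I_n -> 'I_n -> F, forall i z,
      dop_app iota M z = 0 -> phi i z = \sum_j iota (b i j) * iter j der z.
    exists (fun i => sval (constructive_indefinite_description _ (redphi i))).
    by move=> i z Mz; case: constructive_indefinite_description => b /= ->.
  exists (fun j => \sum_i b i j) => z Mz.
  under eq_bigr do rewrite bE //.
  rewrite exchange_big; apply: eq_bigr => j _.
  by rewrite rmorph_sum mulr_suml.
have red_lt j : (j < n)%N -> reducible (iter j der).
  move=> lt_jn; exists (fun i => (i == Ordinal lt_jn)%:R) => z _.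
  rewrite (bigD1 (Ordinal lt_jn)) //= eqxx rmorph1 mul1r big1 ?addr0 //.
  by move=> i /negPf->; rewrite rmorph0 mul0r.
have red_n : reducible (iter n der).
  exists (fun j => - (M : {poly F})`_j / lead_coef (M : {poly F})) => z Mz.
  have lM : iota (lead_coef (M : {poly F})) != 0 by rewrite fmorph_eq0 lead_coef_eq0.
  apply: (mulfI lM); move: Mz; rewrite /dop_app.
  have -> : size (M : {poly F}) = n.+1 by rewrite /n /dop_order prednK // size_poly_gt0.
  rewrite big_ord_recr /= addrC => /eqP; rewrite addr_eq0 => /eqP ->.
  rewrite mulr_sumr -sumrN; apply: eq_bigr => j _.
  by rewrite mulrA -rmorphM mulrCA divff -?(fmorph_eq0 iota) // mulr1 rmorphN mulNr.
elim: k => [|k [b bE]].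
  have [n0|] := posnP n; last exact: red_lt.
  by rewrite -n0.
have [c cE] : reducible (fun z => \sum_(j < n) (iota (der (b j)) * iter j der z +
     iota (b j) * iter j.+1 der z)).
  apply: red_sum => j; apply: redD; apply: redZ; first exact: red_lt.
  by have := ltn_ord j; rewrite leq_eqVlt => /predU1P[->|/red_lt].
exists c => z Mz; rewrite -cE //= bE // raddf_sum; apply: eq_bigr => j _.
by rewrite /= derM iota_der.
Qed.

Lemma solution_wronskian_kernel0 m (u : 'I_m -> E) (e : 'I_m -> E) :
  no_new_constants iota -> lin_indep iota u ->
  (forall i, dop_app iota M (u i) = 0) ->
  (forall k, (k < n)%N -> \sum_i e i * iter k der (u i) = 0) ->
  forall i, e i = 0.
Proof.
move=> nnc indu Mu e0; apply: (wronskian_kernel0 nnc indu) => k.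
have [b bE] := iter_der_reducible k.
under eq_bigr do rewrite bE // mulr_sumr.
rewrite exchange_big big1 //= => j _.
under eq_bigr do rewrite mulrCA.
by rewrite -mulr_sumr e0 ?mulr0.
Qed.

Lemma indep_solutions_bound m (u : 'I_m -> E) :
  no_new_constants iota -> lin_indep iota u ->
  (forall i, dop_app iota M (u i) = 0) -> (m <= n)%N.
Proof.
move=> nnc indu Mu; rewrite leqNgt; apply/negP => lt_nm.
pose W := \matrix_(i < m, k < n) iter k der (u i).
have /rowV0Pn[e /sub_kermxP eW] : kermx W != 0.
  by rewrite -mxrank_eq0 mxrank_ker subn_eq0 -ltnNge (leq_ltn_trans _ lt_nm) ?rank_leq_col.
case/eqP; apply/rowP => i; rewrite mxE.
apply: (@solution_wronskian_kernel0 m u (e 0) nnc indu Mu) => k lt_kn.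
have /rowP/(_ (Ordinal lt_kn)) := eW; rewrite !mxE => eWk; rewrite -[RHS]eWk.
by apply: eq_bigr => j _; rewrite ?mxE.
Qed.

End Solutions.

Definition Cspan m (u : 'I_m -> E) (z : E) :=
  exists c : 'I_m -> C, z = \sum_i cst (c i) * u i.

Definition extend m (u : 'I_m -> E) (z : E) (i : 'I_m.+1) : E :=
  if unlift ord0 i is Some j then u j else z.

Lemma extend0 m (u : 'I_m -> E) z : extend u z ord0 = z.
Proof. by rewrite /extend unlift_none. Qed.

Lemma extend_lift m (u : 'I_m -> E) z j : extend u z (lift ord0 j) = u j.
Proof. by rewrite /extend liftK. Qed.

Lemma Cspan_sum m (u : 'I_m -> E) (I : Type) (r : seq I) (P : pred I) (f : I -> E) :
  (forall i, P i -> Cspan u (f i)) -> Cspan u (\sum_(i <- r | P i) f i).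
Proof.
move=> Pf; elim/big_ind: _ => // [|_ _ [b ->] [c ->]].
  by exists (fun=> 0); rewrite big1 // => i _; rewrite rmorph0 mul0r.
exists (fun i => b i + c i); rewrite -big_split; apply: eq_bigr => i _.
by rewrite rmorphD mulrDl.
Qed.

Lemma Cspan_scale m (u : 'I_m -> E) c z : Cspan u z -> Cspan u (cst c * z).
Proof.
move=> [b ->]; exists (fun i => c * b i); rewrite mulr_sumr; apply: eq_bigr => i _.
by rewrite rmorphM mulrA.
Qed.

Lemma Cspan_mem m (u : 'I_m -> E) i : Cspan u (u i).
Proof.
exists (fun j => (j == i)%:R); rewrite (bigD1 i) //= eqxx rmorph1 mul1r big1 ?addr0 //.
by move=> j /negPf->; rewrite rmorph0 mul0r.
Qed.

Lemma lin_indep_extend m (u : 'I_m -> E) z :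
  lin_indep iota u -> ~ Cspan u z -> lin_indep iota (extend u z).
Proof.
move=> indu zu c; rewrite big_ord_recl extend0.
under eq_bigr do rewrite extend_lift.
have [c00 | c0] := eqVneq (c ord0) 0.
  rewrite c00 rmorph0 mul0r add0r => /indu cl i.
  by case: (unliftP ord0 i) => [j|] ->; rewrite ?cl ?c00.
move=> /eqP; rewrite addr_eq0 => /eqP e; case: zu.
have -> : z = cst (- (c ord0)^-1) * \sum_i cst (c (lift ord0 i)) * u i.
  apply: (@mulfI _ (cst (c ord0))); first by rewrite fmorph_eq0.
  rewrite e mulrA -rmorphM mulrN divff // rmorphN rmorph1 mulN1r.
  by [].
by apply: Cspan_scale; exists (fun i => c (lift ord0 i)).
Qed.

Lemma lin_indep_coef m (u : 'I_m -> E) (b c : 'I_m -> C) : lin_indep iota u ->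
  \sum_i cst (b i) * u i = \sum_i cst (c i) * u i -> b =1 c.
Proof.
move=> indu /eqP; rewrite -subr_eq0 -sumrB => /eqP bc i.
apply/eqP; rewrite -subr_eq0; apply/eqP; move: i.
apply: indu; rewrite -[RHS]bc; apply: eq_bigr => i _.
by rewrite rmorphB mulrBl.
Qed.

Lemma maximal_indep_family (X : E -> Prop) N :
  (forall m (u : 'I_m -> E), (forall i, X (u i)) -> lin_indep iota u -> (m <= N)%N) ->
  exists m (u : 'I_m -> E),
    [/\ forall i, X (u i), lin_indep iota u & forall z, X z -> Cspan u z].
Proof.
move=> bound; suff: forall d m (u : 'I_m -> E), (forall i, X (u i)) ->
    lin_indep iota u -> (N - m <= d)%N -> exists m (u : 'I_m -> E),
    [/\ forall i, X (u i), lin_indep iota u & forall z, X z -> Cspan u z].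
  move=> /(_ N 0%N (fun=> 0)); apply; rewrite ?leq_subr //; first by case.
  by move=> c _; case.
elim=> [|d IHd] m u Xu indu le_d;
  case: (classic (forall z, X z -> Cspan u z)) => [spanu|/not_forall_imply[z Xz zu]].
- by exists m, u.
- have Xuz i : X (extend u z i).
    by case: (unliftP ord0 i) => [j|] ->; rewrite ?extend_lift ?extend0.
  have := bound _ _ Xuz (lin_indep_extend indu zu); lia.
- by exists m, u.
have Xuz i : X (extend u z i).
  by case: (unliftP ord0 i) => [j|] ->; rewrite ?extend_lift ?extend0.
by apply: (IHd _ _ Xuz (lin_indep_extend indu zu)); lia.
Qed.

Lemma solution_basis_of_indep (M : {diffop F}) m (u : 'I_m -> E) :
  no_new_constants iota -> M != 0 -> dop_order M = m -> lin_indep iota u ->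
  (forall i, dop_app iota M (u i) = 0) -> solution_basis iota M u.
Proof.
move=> nnc M0 oM indu Mu; split=> // z Mz.
apply: NNPP => zu; suff: (m < dop_order M)%N by rewrite oM ltnn.
apply: (indep_solutions_bound M0 nnc (lin_indep_extend indu zu)) => i.
by case: (unliftP ord0 i) => [j|] ->; rewrite ?extend_lift ?extend0.
Qed.

(** Applies the differences [act t - 1], the head of the list first. The index type serves both the
    whole group and, as [unit], a single automorphism. *)
Definition iter_diff (T : Type) (act : T -> E -> E) : seq T -> E -> E :=
  fix D s z := if s is t :: s' then D s' (act t z - z) else z.

(** For a group action: the elements killed by the [k]-th power of the augmentation ideal. *)
Definition fil (T : Type) (act : T -> E -> E) k z :=
  forall s : seq T, size s = k -> iter_diff act s z = 0.

Section Filtration.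
Variables (T : Type) (act : T -> {rmorphism E -> E}).
Local Notation D := (iter_diff act).
Local Notation fil := (fil act).

Lemma iter_diffD s x y : D s (x + y) = D s x + D s y.
Proof.
by elim: s x y => //= t s IHs x y; rewrite -IHs rmorphD opprD addrACA.
Qed.

Lemma iter_diff0 s : D s 0 = 0.
Proof. by elim: s => //= t s IHs; rewrite rmorph0 subr0. Qed.

Lemma iter_diffM s a x : (forall t, act t a = a) -> D s (a * x) = a * D s x.
Proof.
move=> fa; elim: s x => //= t s IHs x; rewrite -IHs.
by rewrite rmorphM fa mulrBr.
Qed.

Lemma iter_diff_sum s (I : Type) (r : seq I) (P : pred I) (f : I -> E) :
  D s (\sum_(i <- r | P i) f i) = \sum_(i <- r | P i) D s (f i).
Proof. exact: (big_morph _ (iter_diffD s) (iter_diff0 s)). Qed.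

Lemma iter_diff_cat s1 s2 x : D (s1 ++ s2) x = D s2 (D s1 x).
Proof. by elim: s1 x => //=. Qed.

Lemma fil0 z : fil 0 z <-> z = 0.
Proof.
by split=> [fz | -> s _]; [exact: (fz [::] erefl) | exact: iter_diff0].
Qed.

Lemma filS k z : fil k.+1 z <-> forall t, fil k (act t z - z).
Proof.
split=> [fz t s sk | fz [//|t s] [sk]]; first by apply: (fz (t :: s)); rewrite /= sk.
exact: fz.
Qed.

Lemma fil_zero k : fil k 0. Proof. by move=> s _; rewrite iter_diff0. Qed.

Lemma fil_mono k l z : (k <= l)%N -> fil k z -> fil l z.
Proof.
move=> le_kl fz s sl; rewrite -(cat_take_drop k s) iter_diff_cat fz ?iter_diff0 //.
by rewrite size_takel ?sl.
Qed.

Lemma filD k x y : fil k x -> fil k y -> fil k (x + y).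
Proof. by move=> fx fy s sk; rewrite iter_diffD fx ?fy ?addr0. Qed.

Lemma filZ k a x : (forall t, act t a = a) -> fil k x -> fil k (a * x).
Proof. by move=> fa fx s sk; rewrite iter_diffM // fx ?mulr0. Qed.

Lemma filN k x : fil k x -> fil k (- x).
Proof. by rewrite -mulN1r; apply: filZ => t; rewrite rmorphN1. Qed.

Lemma filB k x y : fil k x -> fil k y -> fil k (x - y).
Proof. by move=> fx fy; apply/filD/filN. Qed.

Lemma fil1 a : fil 1 a <-> forall t, act t a = a.
Proof.
rewrite filS; split=> fa t; first by apply/eqP; rewrite -subr_eq0; apply/eqP/fil0.
by apply/fil0/eqP; rewrite subr_eq0 fa.
Qed.

Lemma filM k l x y : fil k x -> fil l y -> fil (k + l) (x * y).
Proof.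
have [m] := ubnP (k + l); elim: m k l x y => // m IHm [|k] [|l] x y; rewrite ?ltnS.
- by move=> _ /fil0-> _; rewrite mul0r; apply: fil_zero.
- by move=> _ /fil0-> _; rewrite mul0r; apply: fil_zero.
- by move=> _ _ /fil0->; rewrite mulr0; apply: fil_zero.
move=> le_klm fx fy; rewrite addSn; apply/filS => t.
have dx := (filS k x).1 fx t; have dy := (filS l y).1 fy t.
have -> : act t (x * y) - x * y = (act t x - x) * (act t y - y) +
    (act t x - x) * y + x * (act t y - y) by rewrite rmorphM; ring.
apply: filD; [apply: filD|].
- by apply: (@fil_mono (k + l)); [lia | apply: IHm => //; lia].
- by apply: IHm => //; lia.
by rewrite addnS -addSn; apply: IHm => //; lia.
Qed.

Lemma fil_der k x : (forall t, diff_morphism (act t)) -> fil k x -> fil k (der x).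
Proof.
move=> dact fx s sk; suff -> : D s (der x) = der (D s x) by rewrite fx ?der0.
by elim: s {sk fx} x => //= t s IHs x; rewrite -IHs derB dact.
Qed.

Lemma iter_diff_commute s t x :
  (forall t u z, act t (act u z) = act u (act t z)) ->
  act t (D s x) - D s x = D s (act t x - x).
Proof.
move=> com; elim: s x => //= u s IHs x; rewrite IHs; congr (D s _).
by rewrite !rmorphB com opprB addrACA [RHS]addrC !addrA; ring.
Qed.

End Filtration.

Lemma fil_single T (act : T -> {rmorphism E -> E}) t k z :
  fil act k z -> fil (fun _ : unit => act t) k z.
Proof. by elim: k z => [|k IHk] z; [rewrite !fil0 | rewrite !filS => fz _; apply: IHk]. Qed.

Definition unip (s : {rmorphism E -> E}) z := exists k, fil (fun _ : unit => s) k z.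

Section Unip.
Variable s : {rmorphism E -> E}.
Local Notation unip := (unip s).

Lemma unip_fixed z : s z = z -> unip z.
Proof. by move=> sz; exists 1%N; apply/fil1. Qed.

Lemma unipB x y : unip x -> unip y -> unip (x - y).
Proof.
move=> [k kx] [l ly]; exists (maxn k l).
by apply: filB; [apply: fil_mono kx | apply: fil_mono ly]; rewrite ?leq_maxl ?leq_maxr.
Qed.

Lemma unipM x y : unip x -> unip y -> unip (x * y).
Proof. by move=> [k kx] [l ly]; exists (k + l)%N; apply: filM. Qed.

Lemma unip_der x : diff_morphism s -> unip x -> unip (der x).
Proof. by move=> ds [k kx]; exists k; apply: fil_der. Qed.

(** On multiples of [u] the operator [s - 1] becomes [c s - 1], so a power of [c s - 1] kills [Q],
    as does a power of [s - 1]. The two operators commute; by induction [Q] may be taken fixed by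
    [s], and then [(c - 1) ^+ k * Q = 0]. *)
Lemma unip_quotient_eigenvalue u P Q c : unip P -> unip Q ->
  u * Q = P -> u != 0 -> Q != 0 -> s u = c * u -> s c = c -> c = 1.
Proof.
move=> [k kP] [l lQ] uQ u0 Q0 su sc.
pose tw (z : E) := c * s z - z.
have uE N z : iter N (fun z => s z - z) (u * z) = u * iter N tw z.
  by elim: N => //= N ->; rewrite rmorphM su /tw; ring.
have kP' : iter k (fun z => s z - z) P = 0.
  elim: k P kP {uQ} => [|k IHk] P; first by move/fil0.
  by move=> /filS/(_ tt)/IHk; rewrite -iterSr.
have {uE kP' uQ} : iter k tw Q = 0.
  by apply: (mulfI u0); rewrite -uE uQ kP' mulr0.
have [//|c1 twQ] := eqVneq c 1; case/eqP: Q0.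
elim: l Q lQ twQ => [|l IHl] Q; first by move/fil0.
move=> /filS/(_ tt) lQ twQ.
have sQ : s Q = Q.
  apply/eqP; rewrite -subr_eq0; apply/eqP/IHl => //.
  have -> : iter k tw (s Q - Q) = s (iter k tw Q) - iter k tw Q.
    elim: (k) => //= j ->; rewrite /tw !rmorphB !rmorphM sc; ring.
  by rewrite twQ rmorph0 subr0.
have twE : iter k tw Q = (c - 1) ^+ k * Q.
  elim: (k) => [|j /= ->]; first by rewrite expr0 mul1r.
  by rewrite /tw rmorphM rmorphXn rmorphB sc sQ rmorph1 exprS; ring.
move/eqP: twQ; rewrite twE mulf_eq0 expf_eq0 subr_eq0 (negPf c1) andbF.
by move/eqP.
Qed.

End Unip.

Section DiffAutomorphism.
Variable s : {rmorphism E -> E}.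
Hypothesis sG : is_dgal iota s.

Lemma dgal_der z : s (der z) = der (s z). Proof. by case: sG. Qed.

Lemma dgal_base a : s (iota a) = iota a. Proof. by case: sG. Qed.

Lemma dgal_cst c : s (cst c) = cst c. Proof. exact: dgal_base. Qed.

Lemma dgal_iter k z : s (iter k der z) = iter k der (s z).
Proof. by elim: k => //= k <-; rewrite dgal_der. Qed.

Lemma dgal_dop M z : dop_app iota M (s z) = s (dop_app iota M z).
Proof.
rewrite /dop_app rmorph_sum; apply: eq_bigr => i _.
by rewrite rmorphM dgal_base dgal_iter.
Qed.

Lemma dgal_lin m (c : 'I_m -> C) (u : 'I_m -> E) :
  s (\sum_i cst (c i) * u i) = \sum_i cst (c i) * s (u i).
Proof. by rewrite rmorph_sum; apply: eq_bigr => i _; rewrite rmorphM dgal_cst. Qed.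

End DiffAutomorphism.

Lemma dgal_id : is_dgal iota (idfun : {rmorphism E -> E}).
Proof. by split=> //; exists id. Qed.

Lemma dgal_comp (s t : {rmorphism E -> E}) :
  is_dgal iota s -> is_dgal iota t -> is_dgal iota (s \o t : {rmorphism E -> E}).
Proof.
move=> [bs ds si] [bt dt ti]; split; first exact: bij_comp.
  by move=> z /=; rewrite dt ds.
by move=> a /=; rewrite ti si.
Qed.

Lemma dgal_inv (s : {rmorphism E -> E}) : is_dgal iota s ->
  exists2 t : {rmorphism E -> E}, is_dgal iota t & cancel t s.
Proof.
move=> [[g sK gK] ds si].
have [|||t tE] := @rmorphism_of_fun E E g.
- by move=> x y; apply: (can_inj sK); rewrite rmorphB !gK.
- by move=> x y; apply: (can_inj sK); rewrite rmorphM !gK.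
- by apply: (can_inj sK); rewrite rmorph1 gK.
have tK : cancel t s by move=> z; rewrite tE gK.
have sK' : cancel s t by move=> z; rewrite tE sK.
exists t => //; split; first by exists s.
  by move=> z; apply: (can_inj sK'); rewrite ds !tK.
by move=> a; apply: (can_inj sK'); rewrite tK si.
Qed.

Lemma lin_indep_matrix m (u : 'I_m -> E) (A B : 'M[C]_m) : lin_indep iota u ->
  (forall j, \sum_i cst (A i j) * u i = \sum_i cst (B i j) * u i) -> A = B.
Proof.
by move=> indu AB; apply/matrixP => i j; apply: (lin_indep_coef indu (AB j)).
Qed.

End DiffExtension.

(** * The fixed field of the Galois group *)

Section MatrixSubstitution.
Variables (R S : comNzRingType) (n : nat).

Definition mxsubst (f : R -> S) (X : 'M[S]_n) (p : {mpoly R[n * n]}) : S :=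
  mmap f (fun k => mxvec X 0 k) p.

Variable f : {rmorphism R -> S}.
HB.instance Definition _ X := GRing.RMorphism.copy (mxsubst f X)
  (mmap f (fun k => mxvec X 0 k)).

Lemma mxsubstC X c : mxsubst f X c%:MP = f c.
Proof. by rewrite /mxsubst mmapC. Qed.

Lemma mxsubstX X i j : mxsubst f X 'X_(mxvec_index i j) = X i j.
Proof. by rewrite /mxsubst mmapX mmap1U mxvecE. Qed.

Lemma mxsubst_closure (T : {mpoly R[n * n]} -> Prop) :
  (forall c, T c%:MP) -> (forall i j, T 'X_(mxvec_index i j)) ->
  (forall p q, T p -> T q -> T (p + q)) ->
  (forall p q, T p -> T q -> T (p * q)) -> forall p, T p.
Proof.
move=> TC TX TD TM p; apply: mpoly_closure => // k.
by case/mxvec_indexP: k.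
Qed.

End MatrixSubstitution.

Definition mx_var (R : comNzRingType) n : 'M[{mpoly R[n * n]}]_n :=
  \matrix_(i, j) 'X_(mxvec_index i j).

Lemma mxsubst_comp (R S S' : comNzRingType) n (f : {rmorphism R -> S})
    (g : {rmorphism S -> S'}) (h : {rmorphism R -> S'}) (X : 'M_n) p :
  (forall r, g (f r) = h r) -> g (mxsubst f X p) = mxsubst h (map_mx g X) p.
Proof.
move=> gf; elim/mxsubst_closure: p => [c|i j|p q IHp IHq|p q IHp IHq].
- by rewrite !mxsubstC gf.
- by rewrite !mxsubstX mxE.
- by rewrite !rmorphD IHp IHq.
by rewrite !rmorphM IHp IHq.
Qed.

Section LocallyFinite.
Variables (K : fieldType) (V : lmodType K) (T : {linear V -> V}).

(** That is, [v] lies in a finite-dimensional [T]-stable subspace. It is given by a spanning family,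
    possibly dependent, so that sums and products of families need no choice of basis. *)
Definition locally_finite v :=
  exists (I : finType) (u : I -> V) (M : I -> I -> K) (c : I -> K),
    (forall i, T (u i) = \sum_j M i j *: u j) /\ v = \sum_i c i *: u i.

(* Cayley-Hamilton expresses [v] through the [T^i v] with [i > 0]. *)
Lemma locally_finite_preimage (S : V -> Prop) v :
  injective T -> locally_finite v -> S 0 ->
  (forall x y, S x -> S y -> S (x + y)) -> (forall a x, S x -> S (a *: x)) ->
  (forall x, S x -> S (T x)) -> S (T v) -> S v.
Proof.
move=> injT [I [u [M [c [Tu Dv]]]]] S0 SD SZ ST STv.
have [|] := posnP #|I|.
  move=> I0; suff -> : v = 0 by [].
  by rewrite Dv big1 // => i; have := enum_rank i; rewrite I0; case.
case DI: #|I| => [//|m] _.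
pose e (k : 'I_m.+1) : I := enum_val (cast_ord (esym DI) k).
have e_bij : bijective e.
  exists (fun i => cast_ord DI (enum_rank i)) => [k|i]; rewrite /e.
    by rewrite enum_valK cast_ordKV.
  by rewrite cast_ordK enum_rankK.
pose A := \matrix_(i, j) M (e i) (e j).
pose w := \row_i c (e i).
pose lc (r : 'rV[K]_m.+1) := \sum_i r 0 i *: u (e i).
have lcD r r' : lc (r + r') = lc r + lc r'.
  by rewrite -big_split; apply: eq_bigr => i _; rewrite mxE scalerDl.
have lcZ a r : lc (a *: r) = a *: lc r.
  by rewrite scaler_sumr; apply: eq_bigr => i _; rewrite mxE scalerA.
have lc_v : lc w = v.
  rewrite Dv (reindex e) /=; last exact: onW_bij.
  by apply: eq_bigr => i _; rewrite mxE.
have lcT r : T (lc r) = lc (r *m A).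
  rewrite linear_sum /=; under eq_bigr => i _.
    rewrite linearZ /= Tu (reindex e) /=; last exact: onW_bij.
    rewrite scaler_sumr.
  over.
  rewrite exchange_big; apply: eq_bigr => j _; rewrite mxE scaler_suml.
  by apply: eq_bigr => i _; rewrite scalerA mxE.
have lc0 : lc 0 = 0 by rewrite /lc big1 // => i _; rewrite mxE scale0r.
have lc_iter k r : lc (r *m A ^+ k) = iter k T (lc r).
  elim: k => [|k IHk]; first by rewrite expr0 mulmx1.
  by rewrite exprSr -mulmxE mulmxA -lcT IHk.
have horner_iter (p : {poly K}) :
    lc (w *m horner_mx A p) = \sum_(i < size p) p`_i *: iter i T v.
  rewrite -{1}[p]coefK poly_def linear_sum mulmx_sumr /= (big_morph lc lcD lc0).
  apply: eq_bigr => i _; rewrite linearZ /= -scalemxAr lcZ rmorphXn /= horner_mx_X.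
  by rewrite lc_iter lc_v.
(* Injectivity of [T] removes the factor ['X^k] of the characteristic polynomial; the constant term
   of [q] is nonzero and can be divided out. *)
have [k [q]] := multiplicity_XsubC (char_poly A) 0.
rewrite (monic_neq0 (char_poly_monic A)) subr0 /= => q0 Dchi.
have : iter k T (lc (w *m horner_mx A q)) = 0.
  have AX : A ^+ k = horner_mx A 'X^k by rewrite rmorphXn /= horner_mx_X.
  by rewrite -lc_iter -mulmxA mulmxE AX -rmorphM -Dchi /= Cayley_Hamilton mulmx0 lc0.
have iter_inj x : iter k T x = 0 -> x = 0.
  elim: (k) x => //= j IHj x Tx; apply: IHj; apply: injT.
  by rewrite Tx linear0.
move=> /iter_inj; rewrite horner_iter.
have {}q0 : q`_0 != 0 by rewrite -horner_coef0.
have : (0 < size q)%N.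
  by rewrite lt0n; apply: contra q0 => /eqP/size0nil->; rewrite nth_nil.
case: (size q) => // s _; rewrite big_ord_recl /= => /eqP.
rewrite addr_eq0 => /eqP qv; rewrite -[v]scale1r -(mulVf q0) -scalerA qv -scaleN1r.
apply/SZ/SZ; elim/big_ind: _ => // i _; apply: SZ; rewrite /bump /= ?add1n /=.
by elim: (nat_of_ord i) => //= j; apply: ST.
Qed.

End LocallyFinite.

(** The variables of one row span a stable space; a sum uses the disjoint union of two families, a
    product their pairwise products. *)
Lemma locally_finite_mx_translation (K : fieldType) n (A : 'M[K]_n)
    (T : {lrmorphism {mpoly K[n * n]} -> {mpoly K[n * n]}}) p :
  (forall i j, T 'X_(mxvec_index i j) = \sum_k A k j *: 'X_(mxvec_index i k)) ->
  locally_finite T p.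
Proof.
move=> TX; elim/mxsubst_closure: p => [c|i j|p q IHp IHq|p q IHp IHq].
- exists unit, (fun=> 1), (fun _ _ => 1), (fun=> c).
  split=> [i|]; rewrite big_const card_unit /= addr0.
    by rewrite rmorph1 scale1r.
  by rewrite -mul_mpolyC mulr1.
- exists 'I_n, (fun k => 'X_(mxvec_index i k)), (fun j k => A k j), (fun k => (k == j)%:R).
  split=> [k|]; first exact: TX.
  rewrite (bigD1 j) //= eqxx scale1r big1 ?addr0 // => k /negPf->.
  by rewrite scale0r.
- case: IHp => I [u [M [c [/= Tu ->]]]]; case: IHq => J [v [N [d [/= Tv ->]]]].
  exists (I + J)%type, (fun k => match k with inl i => u i | inr j => v j end),
    (fun k l => match k, l with inl i, inl i' => M i i' | inr j, inr j' => N j j'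
                | _, _ => 0 end),
    (fun k => match k with inl i => c i | inr j => d j end).
  split=> [[i|j]|]; rewrite big_sumType /=.
  + by rewrite Tu [X in _ + X]big1 ?addr0 // => j _; rewrite scale0r.
  + by rewrite Tv [X in X + _]big1 ?add0r // => i _; rewrite scale0r.
  by [].
case: IHp => I [u [M [c [/= Tu ->]]]]; case: IHq => J [v [N [d [/= Tv ->]]]].
exists (I * J)%type, (fun k => u k.1 * v k.2),
  (fun k l => M k.1 l.1 * N k.2 l.2), (fun k => c k.1 * d k.2).
split=> [[i j]|] /=.
  rewrite rmorphM /= Tu Tv big_distrlr /= pair_big /=.
  by apply: eq_bigr => -[k l] _ /=; rewrite -scalerAl -scalerAr scalerA.
rewrite big_distrlr /= pair_big /=.
by apply: eq_bigr => -[k l] _ /=; rewrite -scalerAl -scalerAr scalerA.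
Qed.

Section CoefficientDerivation.
Variables (E : diffFieldType) (m : nat).
Implicit Types p q : {mpoly E[m]}.

Definition mder p : {mpoly E[m]} := map_mpoly (@der E) p.

Lemma mcoeff_mder p k : (mder p)@_k = der p@_k.
Proof. by rewrite /mder mcoeff_map_mpoly. Qed.

Lemma mderD p q : mder (p + q) = mder p + mder q.
Proof. by apply/mpolyP => k; rewrite !(mcoeff_mder, mcoeffD) derD. Qed.

Lemma mderC c : mder c%:MP = (der c)%:MP.
Proof. by rewrite /mder map_mpolyC. Qed.

Lemma mderX k : mder 'X_[k] = 0.
Proof.
apply/mpolyP => l; rewrite mcoeff_mder mcoeffX mcoeff0.
by case: eqP; rewrite ?der1 ?der0.
Qed.

Lemma mderM p q : mder (p * q) = mder p * q + p * mder q.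
Proof.
apply/mpolyP => k; rewrite mcoeff_mder mcoeffD !mcoeffM raddf_sum -big_split.
by apply: eq_bigr => l _ /=; rewrite derM !mcoeff_mder.
Qed.

Lemma mderZ c p : mder (c *: p) = der c *: p + c *: mder p.
Proof. by rewrite -!mul_mpolyC mderM mderC. Qed.

End CoefficientDerivation.

(** Descent to constants for coefficient vectors, supported on [msupp u]. With [T] left arbitrary,
    it applies both to vanishing at a point and to membership in a radical. *)
Lemma constant_mpolys_span (F E : diffFieldType) (iota : {rmorphism F -> E}) m
    (U T : {mpoly E[m]} -> Prop) u :
  diff_morphism iota -> no_new_constants iota ->
  (forall e u, U u -> U (e *: u)) -> (forall u, U u -> U (mder u)) ->
  T 0 -> (forall u v, T u -> T v -> T (u + v)) -> (forall e u, T u -> T (e *: u)) ->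
  (forall q : {mpoly (constants F)[m]},
     U (map_mpoly (cst iota) q) -> T (map_mpoly (cst iota) q)) ->
  U u -> T u.
Proof.
move=> iota_der nnc UZ UD T0 TD TZ UT Uu.
pose onC (A : {mpoly E[m]} -> Prop) (f : 'X_{1..m} -> E) :=
  exists2 p, A p & forall k, f k = p@_k.
suff [p Tp pE] : onC T (fun k => u@_k).
  by have -> : u = p by apply/mpolyP.
apply: (@constant_vectors_span _ _ iota iota_der _ (onC U) (onC T) (msupp u)) => //.
- move=> e f [p Up pE]; exists (e *: p); first exact: UZ.
  by move=> k; rewrite mcoeffZ pE.
- move=> f [p Up pE]; exists (mder p); first exact: UD.
  by move=> k; rewrite mcoeff_mder pE.
- by exists 0 => // k; rewrite mcoeff0.
- move=> f g [p Tp pE] [q Tq qE]; exists (p + q); first exact: TD.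
  by move=> k; rewrite mcoeffD pE qE.
- move=> e f [p Tp pE]; exists (e *: p); first exact: TZ.
  by move=> k; rewrite mcoeffZ pE.
- move=> c [p Up pE].
  pose q := \sum_(k <- msupp p) c k *: 'X_[k] : {mpoly (constants F)[m]}.
  have qE : map_mpoly (cst iota) q = p.
    rewrite [RHS]mpolyE /q raddf_sum; apply: eq_bigr => k _ /=.
    by rewrite map_mpolyZ map_mpolyX /= pE.
  exists p => //; rewrite -qE; apply: UT; by rewrite qE.
- by exists u.
by move=> k; apply: memN_msupp_eq0.
Qed.

Lemma coef_pred_XsubC_exp (R : comNzRingType) (z : R) k :
  (('X - z%:P) ^+ k.+1)`_k = - (z *+ k.+1).
Proof.
elim: k => [|k IHk]; first by rewrite expr1 coefB coefX coefC sub0r.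
have top : (('X - z%:P) ^+ k.+1)`_k.+1 = 1.
  have /monicP := monic_exp k.+1 (monicXsubC z).
  by rewrite lead_coefE size_exp_XsubC.
by rewrite exprS mulrBl coefB coefXM coefCM IHk top mulr1 -opprD -mulrSr.
Qed.

Section FieldExtension.
Variables (F E : fieldType) (iota : {rmorphism F -> E}).

(** A shortest family [t] is free, since a relation would eliminate one of its members. Comparing
    coordinates along [t] replaces computing in a tensor product over [F]. *)
Lemma free_coordinates m (e : 'I_m -> E) :
  exists r (t : 'I_r -> E) (Z : 'M[F]_(m, r)),
    (forall k, e k = \sum_j iota (Z k j) * t j) /\
    (forall g : 'I_r -> F, \sum_j iota (g j) * t j = 0 -> forall j, g j = 0).
Proof.
pose rep r := exists (t : 'I_r -> E) (Z : 'M[F]_(m, r)),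
  forall k, e k = \sum_j iota (Z k j) * t j.
have [|r [t [Z eZ]] minr] := @ex_minimizer nat id rep.
  exists m, e, 1%:M => k; rewrite (bigD1 k) //= mxE eqxx rmorph1 mul1r big1 ?addr0 //.
  by move=> j /negPf jk; rewrite mxE eq_sym jk rmorph0 mul0r.
exists r, t, Z; split=> // g g0; apply: NNPP => /not_all_ex_not[j /eqP gj].
case: r t Z eZ minr g g0 j gj => [|r] t Z eZ minr g g0 j gj; first by case: j gj.
have : (r.+1 <= r)%N; last by rewrite ltnn.
apply: minr; exists (fun i => t (lift j i)).
exists (\matrix_(k, i) (Z k (lift j i) - Z k j * g (lift j i) / g j)) => k.
have tj : t j = - (\sum_i iota (g (lift j i) / g j) * t (lift j i)).
  have igj : iota (g j) != 0 by rewrite fmorph_eq0.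
  apply: (mulfI igj); move: g0; rewrite (bigD1_ord j) //= => /eqP.
  rewrite addr_eq0 => /eqP->; rewrite mulrN mulr_sumr; congr (- _).
  by apply: eq_bigr => i _; rewrite mulrA -rmorphM mulrCA divff // mulr1.
rewrite eZ (bigD1_ord j) //= tj mulrN mulr_sumr addrC -sumrB.
apply: eq_bigr => i _; rewrite mxE rmorphB mulrBl; congr (_ - _).
by rewrite mulrA -rmorphM mulrA.
Qed.

(* In characteristic zero [z ⊗ 1 - 1 ⊗ z] is nilpotent only if [z] is in [F]:
   the minimal polynomial of [z] would divide [('X - z) ^ N], hence be a power
   of ['X - z], and its second coefficient gives [z]. *)
Lemma nilpotent_difference_base (z : E) N r (t : 'I_r -> E) (Z : 'M[F]_(N.+1, r)) :
  [pchar F] =i pred0 ->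
  (forall i : 'I_N.+1, z ^+ i = \sum_j iota (Z i j) * t j) ->
  (forall j, \sum_(i < N.+1) iota (Z i j) * ((- z) ^+ (N - i) *+ 'C(N, i)) = 0) ->
  exists a, z = iota a.
Proof.
move=> /pcharf0P charF zZ Z0.
pose c := \row_(i < N.+1) ((- z) ^+ (N - i) *+ 'C(N, i)).
have Dc : ('X - z%:P) ^+ N = rVpoly c.
  rewrite [in LHS]addrC exprDn [RHS]poly_def; apply: eq_bigr => i _.
  rewrite -polyCN -polyC_exp mul_polyC -scaler_nat scalerA; congr (_ *: _).
  by rewrite insubT // => lt_i; rewrite mxE mulr_natl /=; congr (_ ^+ (_ - _) *+ 'C(_, _)).
pose root_of (h : {poly F}) := (map_poly iota h).[z] = 0.
have root_ker (h : 'rV_N.+1) : h *m Z = 0 -> root_of (rVpoly h).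
  move=> hZ; rewrite /root_of (@horner_coef_wide _ N.+1) ?size_map_poly ?size_poly //.
  transitivity (\sum_j iota ((h *m Z) 0 j) * t j).
    under [RHS]eq_bigr do rewrite mxE rmorph_sum mulr_suml.
    rewrite exchange_big; apply: eq_bigr => i _.
    rewrite coef_map /= coef_rVpoly_ord zZ mulr_sumr; apply: eq_bigr => j _.
    by rewrite rmorphM mulrA.
  by rewrite hZ big1 // => j _; rewrite mxE rmorph0 mul0r.
(* As [Z] has entries in [F], its kernel over [E] is spanned by its kernel over [F], whose rows are
   polynomials over [F] with root [z]. *)
have /submxP[w Dw] : (c <= map_mx iota (kermx Z))%MS.
  rewrite map_kermx; apply/sub_kermxP/rowP => j; rewrite !mxE -[RHS](Z0 j).
  by apply: eq_bigr => i _; rewrite !mxE mulrC.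
have DXz : ('X - z%:P) ^+ N =
    \sum_l w 0 l *: map_poly iota (rVpoly (row l (kermx Z))).
  rewrite Dc Dw mulmx_sum_row raddf_sum; apply: eq_bigr => l _ /=.
  rewrite linearZ /=; congr (_ *: _); apply/polyP => i.
  rewrite coef_map /= !coef_rVpoly; case: insub => [k|] /=; last by rewrite rmorph0.
  by rewrite !mxE.
have root_row l : root_of (rVpoly (row l (kermx Z))).
  by apply: root_ker; rewrite -row_mul mulmx_ker row0.
have [|mu [mu0 mu_z] min_mu] := @ex_minimizer _ (fun h : {poly F} => size h)
    (fun h => h != 0 /\ root_of h).
  apply: NNPP => Nex; have : ('X - z%:P) ^+ N != 0 by rewrite expf_neq0 // polyXsubC_eq0.
  rewrite DXz big1 ?eqxx // => l _.
  have [->|h0] := eqVneq (rVpoly (row l (kermx Z))) 0; first by rewrite rmorph0 scaler0.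
  by case: Nex; exists (rVpoly (row l (kermx Z))).
have mu_dvd (h : {poly F}) : root_of h -> map_poly iota mu %| map_poly iota h.
  move=> hz; rewrite dvdp_map; apply/eqP; apply: NNPP => /eqP hmu.
  have : (size mu <= size (h %% mu)%R)%N.
    apply: min_mu; split=> //; move: hz; rewrite /root_of {1}(divp_eq h mu).
    by rewrite rmorphD rmorphM /= hornerD hornerM mu_z mulr0 add0r.
  by rewrite leqNgt ltn_modp mu0.
have : map_poly iota mu %| ('X - z%:P) ^+ N.
  rewrite DXz; elim/big_ind: _ => [|h h'|l _]; [exact: dvdp0 | exact: dvdp_add|].
  by rewrite -mul_polyC; apply/dvdp_mull/mu_dvd.
case/dvdp_exp_XsubCP => k _ /eqpP[[a b] /= /andP[a0 b0] Dmu].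
have {a0 b0} [a' a'0 {}Dmu] : exists2 a', a' != 0 & map_poly iota mu = a' *: ('X - z%:P) ^+ k.
  exists (a^-1 * b); first by rewrite mulf_neq0 // invr_eq0.
  by rewrite -scalerA -Dmu scalerA mulVf // scale1r.
case: k Dmu => [|k] Dmu.
  by move: mu_z; rewrite /root_of Dmu expr0 hornerZ hornerC mulr1 => /eqP; rewrite (negPf a'0).
have top : (('X - z%:P) ^+ k.+1)`_k.+1 = 1.
  have /monicP := monic_exp k.+1 (monicXsubC z).
  by rewrite lead_coefE size_exp_XsubC.
have mu1 := congr1 (fun h : {poly E} => h`_k.+1) Dmu.
have mu2 := congr1 (fun h : {poly E} => h`_k) Dmu.
move: mu1 mu2; rewrite !coefZ !coef_map top coef_pred_XsubC_exp mulr1 => mu1 mu2.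
have k0 : (k.+1)%:R != 0 :> E by rewrite -(rmorph_nat iota) fmorph_eq0 charF.
exists (- mu`_k / (mu`_k.+1 * k.+1%:R)).
rewrite fmorph_div rmorphN rmorphM rmorph_nat.
move: mu1 mu2 => -> ->; rewrite -[z *+ _]mulr_natr.
by rewrite mulrN opprK mulrCA mulfK // mulf_neq0.
Qed.

End FieldExtension.

Section MxEval.
Variables (K : fieldType) (n : nat) (A : 'M[K]_n).
Implicit Types p q : {mpoly K[n * n]}.

Lemma mx_evalC c : mx_eval c%:MP A = c. Proof. exact: mevalC. Qed.
Lemma mx_evalX i j : mx_eval 'X_(mxvec_index i j) A = A i j.
Proof. by rewrite /mx_eval mevalXU mxvecE. Qed.
Lemma mx_eval0 : mx_eval 0 A = 0. Proof. exact: meval0. Qed.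
Lemma mx_evalD p q : mx_eval (p + q) A = mx_eval p A + mx_eval q A.
Proof. exact: mevalD. Qed.
Lemma mx_evalB p q : mx_eval (p - q) A = mx_eval p A - mx_eval q A.
Proof. exact: mevalB. Qed.
Lemma mx_evalM p q : mx_eval (p * q) A = mx_eval p A * mx_eval q A.
Proof. exact: mevalM. Qed.
Lemma mx_evalZ c p : mx_eval (c *: p) A = c * mx_eval p A.
Proof. exact: mevalZ. Qed.

End MxEval.

Definition mx_translate (K : fieldType) n (A : 'M[K]_n) :
    {mpoly K[n * n]} -> {mpoly K[n * n]} :=
  comp_mpoly [tuple mxvec (mx_var K n *m map_mx (@mpolyC (n * n) K) A) 0 k | k < n * n].
HB.instance Definition _ (K : fieldType) n (A : 'M[K]_n) :=
  GRing.LRMorphism.copy (mx_translate A)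
  (comp_mpoly [tuple mxvec (mx_var K n *m map_mx (@mpolyC (n * n) K) A) 0 k | k < n * n]).

Section Translation.
Variables (K : fieldType) (n : nat).
Implicit Types (A B : 'M[K]_n) (p : {mpoly K[n * n]}).

Lemma mx_translateC A c : mx_translate A c%:MP = c%:MP.
Proof. exact: comp_mpolyC. Qed.

Lemma mx_translateX A i j : mx_translate A 'X_(mxvec_index i j) =
  \sum_k A k j *: 'X_(mxvec_index i k).
Proof.
rewrite /mx_translate comp_mpolyXU (nth_map (mxvec_index i j)) ?size_enum_ord //.
rewrite nth_ord_enum mxvecE mxE; apply: eq_bigr => k _.
by rewrite !mxE mulrC mul_mpolyC.
Qed.

Lemma mxsubst_translate (S : comNzRingType) (f : {rmorphism K -> S}) A (X : 'M[S]_n) p :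
  mxsubst f X (mx_translate A p) = mxsubst f (X *m map_mx f A) p.
Proof.
elim/mxsubst_closure: p => [c|i j|p q IHp IHq|p q IHp IHq].
- by rewrite mx_translateC !mxsubstC.
- rewrite mx_translateX raddf_sum mxsubstX mxE; apply: eq_bigr => k _.
  by rewrite -mul_mpolyC /= rmorphM /= mxsubstC mxsubstX mxE mulrC.
- by rewrite !rmorphD /= IHp IHq.
by rewrite !rmorphM /= IHp IHq.
Qed.

Lemma mx_translate_inj A : A \in unitmx -> injective (mx_translate A).
Proof.
move=> uA; apply: (can_inj (g := mx_translate (invmx A))) => p.
elim/mxsubst_closure: p => [c|i j|p q IHp IHq|p q IHp IHq].
- by rewrite !mx_translateC.
- rewrite mx_translateX raddf_sum /=.
  transitivity (\sum_l (invmx A *m A) l j *: 'X_(mxvec_index i l) : {mpoly K[n * n]}).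
    under eq_bigr do rewrite linearZ /= mx_translateX scaler_sumr.
    rewrite exchange_big; apply: eq_bigr => l _ /=.
    rewrite mxE scaler_suml; apply: eq_bigr => k _.
    by rewrite scalerA mulrC.
  rewrite mulVmx // (bigD1 j) //= mxE eqxx scale1r big1 ?addr0 // => l /negPf lj.
  by rewrite mxE lj scale0r.
- by rewrite !rmorphD /= IHp IHq.
by rewrite !rmorphM /= IHp IHq.
Qed.

End Translation.

Section GaloisGroup.
Variables (F E : diffFieldType) (iota : {rmorphism F -> E}).
Hypothesis iota_der : diff_morphism iota.
Local Notation C := (constants F).
Local Notation cst := (cst iota).
Hypothesis nnc : no_new_constants iota.
Variables (n : nat) (L : {diffop F}) (y : 'I_n -> E).
Hypotheses (L_neq0 : L != 0) (L_order : dop_order L = n).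
Hypothesis y_basis : solution_basis iota L y.
Hypothesis y_gen : diff_generated_by iota (fun z => exists i, z = y i).

Let y_sol i : dop_app iota L (y i) = 0. Proof. by case: y_basis. Qed.
Let y_indep : lin_indep iota y. Proof. by case: y_basis. Qed.
Let y_span z : dop_app iota L z = 0 -> Cspan iota y z. Proof. by case: y_basis => _ _; apply. Qed.

Definition wronskian : 'M[E]_n := \matrix_(k, i) iter k der (y i).
Local Notation W := wronskian.
Local Notation cmx := (map_mx cst).

Lemma wronskian_unit : W \in unitmx.
Proof.
rewrite -unitmx_tr -row_free_unit -kermx_eq0; apply/rowV0P => e /sub_kermxP eW.
apply/rowP => i; rewrite mxE.
apply: (@solution_wronskian_kernel0 _ _ _ iota_der _ L_neq0 n y (e 0) nnc y_indep) => // k.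
rewrite L_order => lt_kn; have /rowP/(_ (Ordinal lt_kn)) := eW.
rewrite !mxE => eWk; rewrite -[RHS]eWk; apply: eq_bigr => j _.
by rewrite !mxE.
Qed.

Lemma wronskian_der : exists B : 'M[F]_n, map_mx der W = map_mx iota B *m W.
Proof.
have red k := iter_der_reducible iota_der L_neq0 k.
pose b (k : nat) := sval (constructive_indefinite_description _ (red k)).
exists (\matrix_(k, j) b k.+1 (cast_ord (esym L_order) j)).
apply/matrixP => k i; rewrite !mxE.
have := svalP (constructive_indefinite_description _ (red k.+1)) (y i) (y_sol i).
rewrite -/(b k.+1) /= => ->.
rewrite (reindex (cast_ord (esym L_order))) /=; last first.
  by exists (cast_ord L_order) => j _; rewrite ?cast_ordK ?cast_ordKV.
by apply: eq_bigr => j _; rewrite !mxE.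
Qed.

(** The substitution of [W X] for [X]. At a constant invertible matrix [A] it gives the value of [p]
    at another fundamental matrix [W A]. *)
Definition generic : {mpoly F[n * n]} -> {mpoly E[n * n]} :=
  mxsubst (@mpolyC (n * n) E \o iota)
    (map_mx (@mpolyC (n * n) E) W *m mx_var E n).
HB.instance Definition _ := GRing.RMorphism.on generic.
Local Notation Phi := generic.
Local Notation ev p X := (mxsubst iota X p).

Lemma generic_eval p A : mx_eval (Phi p) A = ev p (W *m A).
Proof.
rewrite /mx_eval /meval -/(mxsubst idfun A _).
rewrite (@mxsubst_comp _ _ _ _ _ (mxsubst idfun A) iota) => [|r]; last first.
  by rewrite /= mxsubstC.
congr mxsubst; rewrite map_mxM; congr (_ *m _); apply/matrixP => i j; rewrite !mxE.
  by rewrite /= mxsubstC.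
by rewrite /= mxsubstX.
Qed.

(** Because [W' = B W] with [B] over [F], derivation of coefficients corresponds to the derivation
    of the polynomials over [F] that extends that of [F] and sends [X] to [B X]. *)
Lemma mder_generic p : exists q, mder (Phi p) = Phi q.
Proof.
have [B WB] := wronskian_der.
elim/mxsubst_closure: p => [c|i j|p q [p' p'E] [q' q'E]|p q [p' p'E] [q' q'E]].
- by exists (der c)%:MP; rewrite /Phi !mxsubstC /= mderC iota_der.
- exists (\sum_k (B i k)%:MP * 'X_(mxvec_index k j)).
  rewrite rmorph_sum /Phi mxsubstX mxE /mder raddf_sum.
  have -> : \sum_k mder ((map_mx (@mpolyC (n * n) E) W) i k * (mx_var E n) k j) =
      \sum_k (der (W i k))%:MP * 'X_(mxvec_index k j).
    by apply: eq_bigr => k _; rewrite mderM [_ k j]mxE mderX mulr0 addr0 mxE mderC.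
  under [RHS]eq_bigr => k _.
    rewrite rmorphM /= -[Phi _%:MP]/(mxsubst _ _ _) mxsubstC -[Phi _]/(mxsubst _ _ _) mxsubstX /= mxE mulr_sumr.
  over.
  rewrite exchange_big; apply: eq_bigr => k _ /=.
  have /matrixP/(_ i k) := WB; rewrite !mxE => ->.
  rewrite rmorph_sum mulr_suml; apply: eq_bigr => l _.
  by rewrite !mxE rmorphM mulrA.
- by exists (p' + q'); rewrite !rmorphD /= mderD p'E q'E.
by exists (p' * q + p * q'); rewrite rmorphD !rmorphM /= mderM p'E q'E.
Qed.

Lemma mx_eval_mder u (A : 'M[C]_n) : mx_eval (mder u) (cmx A) = der (mx_eval u (cmx A)).
Proof.
elim/mxsubst_closure: u => [c|i j|p q IHp IHq|p q IHp IHq].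
- by rewrite mderC !mx_evalC.
- by rewrite mderX mx_eval0 mx_evalX mxE (der_cst iota_der).
- by rewrite mderD !mx_evalD derD IHp IHq.
by rewrite mderM mx_evalD !mx_evalM derM IHp IHq.
Qed.

Lemma der_ev p : exists q, forall A : 'M[C]_n, der (ev p (W *m cmx A)) = ev q (W *m cmx A).
Proof.
have [q qE] := mder_generic p; exists q => A.
by rewrite -!generic_eval -mx_eval_mder qE.
Qed.

(** The quotient of the polynomials over [E] by this space is the tensor product over [F] of [E] and
    [F[W]]. Only scalars from [E] are built in, which gives stability under derivation at once. *)
Inductive rel_ideal : {mpoly E[n * n]} -> Prop :=
  | rel0 : rel_ideal 0
  | relD u v : rel_ideal u -> rel_ideal v -> rel_ideal (u + v)
  | relZ e u : rel_ideal u -> rel_ideal (e *: u)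
  | rel_gen p : ev p W = 0 -> rel_ideal (Phi p).

Local Notation U := rel_ideal.
Let J q := U (map_mpoly cst q).

Lemma rel_mder u : U u -> U (mder u).
Proof.
elim=> {u} [|u v _ IHu _ IHv|e u Uu IHu|p pW].
- by rewrite /mder raddf0; apply: rel0.
- by rewrite mderD; apply: relD.
- by rewrite mderZ; apply: relD; apply: relZ.
have [q qE] := mder_generic p; rewrite qE; apply: rel_gen.
have ev1 r : ev r W = mx_eval (Phi r) (cmx 1%:M).
  by rewrite generic_eval map_mx1 mulmx1.
by rewrite ev1 -qE mx_eval_mder -ev1 pW der0.
Qed.

(** Writing [X] as [W^-1 (W X)] expresses a variable over [E] through images of variables under
    [Phi], and these multiply generators to generators. *)
Lemma rel_idealP : ideal_pred U.
Proof.
split; [exact: rel0 | exact: relD | move=> v u Uu].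
elim/mxsubst_closure: v u Uu => [c|i j|p q IHp IHq|p q IHp IHq] u Uu.
- by rewrite mul_mpolyC; apply: relZ.
- have -> : 'X_(mxvec_index i j) = \sum_k (invmx W i k) *: Phi 'X_(mxvec_index k j).
    have -> : 'X_(mxvec_index i j) = (mx_var E n) i j by rewrite mxE.
    rewrite -[mx_var E n]mul1mx -(map_mx1 (@mpolyC (n * n) E)) -(mulVmx wronskian_unit).
    rewrite map_mxM -mulmxA mxE; apply: eq_bigr => k _.
    by rewrite /Phi mxsubstX mxE mul_mpolyC.
  rewrite mulr_suml; elim/big_ind: _ => [|a b|k _]; [exact: rel0 | exact: relD |].
  rewrite -scalerAl; apply: relZ.
  elim: Uu => {u} [|u v _ IHu _ IHv|e u Uu IHu|p pW].
  + by rewrite mulr0; apply: rel0.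
  + by rewrite mulrDr; apply: relD.
  + by rewrite -scalerAr; apply: relZ.
  by rewrite -rmorphM; apply: rel_gen; rewrite rmorphM /= pW mulr0.
- by rewrite mulrDl; apply: relD; [apply: IHp | apply: IHq].
by rewrite -mulrA; apply/IHp/IHq.
Qed.

Lemma rel_const_idealP : ideal_pred J.
Proof.
have [U0 UD UM] := rel_idealP; split; rewrite /J ?raddf0 //.
  by move=> p q; rewrite rmorphD; apply: UD.
by move=> p q; rewrite rmorphM; apply: UM.
Qed.

Lemma mx_eval_cst q (A : 'M[C]_n) : mx_eval (map_mpoly cst q) (cmx A) = cst (mx_eval q A).
Proof.
elim/mxsubst_closure: q => [c|i j|p q IHp IHq|p q IHp IHq].
- by rewrite map_mpolyC !mx_evalC.
- by rewrite map_mpolyX !mx_evalX mxE.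
- by rewrite rmorphD !mx_evalD rmorphD IHp IHq.
by rewrite rmorphM !mx_evalM rmorphM IHp IHq.
Qed.

(** [J] sees only the members with constant coefficients; by descent they span the whole ideal over
    [E]. *)
Lemma rel_eval (A : 'M[C]_n) : (forall q, J q -> mx_eval q A = 0) ->
  forall u, U u -> mx_eval u (cmx A) = 0.
Proof.
move=> JA u Uu.
apply: (@constant_mpolys_span _ _ iota _ U (fun u => mx_eval u (cmx A) = 0) u iota_der nnc) => //.
- exact: relZ.
- exact: rel_mder.
- exact: mx_eval0.
- by move=> v w v0 w0; rewrite mx_evalD v0 w0 addr0.
- by move=> e v v0; rewrite mx_evalZ v0 mulr0.
by move=> q Jq; rewrite mx_eval_cst JA ?rmorph0.
Qed.

Lemma dgal_matrix (s : {rmorphism E -> E}) : is_dgal iota s ->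
  exists A : 'M[C]_n, forall j, s (y j) = \sum_i cst (A i j) * y i.
Proof.
move=> sG; have sy j : Cspan iota y (s (y j)).
  by apply: y_span; rewrite (dgal_dop sG) y_sol rmorph0.
exists (\matrix_(i, j) sval (constructive_indefinite_description _ (sy j)) i) => j.
rewrite {1}(svalP (constructive_indefinite_description _ (sy j))).
by apply: eq_bigr => i _; rewrite mxE.
Qed.

Lemma dgal_wronskian (s : {rmorphism E -> E}) (A : 'M[C]_n) : is_dgal iota s ->
  (forall j, s (y j) = \sum_i cst (A i j) * y i) -> map_mx s W = W *m cmx A.
Proof.
move=> sG sy; apply/matrixP => k j; rewrite !mxE (dgal_iter sG) sy (iter_der_lin iota_der).
by apply: eq_bigr => i _; rewrite !mxE mulrC.
Qed.

Lemma dgal_matrix_unit (s : {rmorphism E -> E}) (A : 'M[C]_n) : is_dgal iota s ->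
  (forall j, s (y j) = \sum_i cst (A i j) * y i) -> A \in unitmx.
Proof.
move=> sG /(dgal_wronskian sG) sW; rewrite unitmxE unitfE.
have : \det (map_mx s W) != 0.
  by rewrite det_map_mx fmorph_eq0 -unitfE -unitmxE wronskian_unit.
by rewrite sW det_mulmx det_map_mx mulf_eq0 negb_or fmorph_eq0 => /andP[].
Qed.

Lemma dgal_rel (s : {rmorphism E -> E}) (A : 'M[C]_n) q : is_dgal iota s ->
  (forall j, s (y j) = \sum_i cst (A i j) * y i) -> J q -> mx_eval q A = 0.
Proof.
move=> sG sy Jq; suff: cst (mx_eval q A) = 0.
  by move/eqP; rewrite fmorph_eq0 => /eqP.
rewrite -mx_eval_cst.
move: Jq; rewrite /J; elim=> [|u v _ u0 _ v0|e u _ u0|p pW].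
- exact: mx_eval0.
- by rewrite mx_evalD u0 v0 addr0.
- by rewrite mx_evalZ u0 mulr0.
rewrite generic_eval -(dgal_wronskian sG sy).
rewrite -(@mxsubst_comp _ _ _ _ iota s iota) ?pW ?rmorph0 //.
by case: sG.
Qed.

Lemma fraction z : exists p q, ev q W != 0 /\ z = ev p W / ev q W.
Proof.
have ev1 : ev 1 W != 0 by rewrite rmorph1 oner_neq0.
apply: (y_gen (S := fun z => exists p q, ev q W != 0 /\ z = ev p W / ev q W)) z => [|_ [i ->]]; last first.
  have n0 : (0 < n)%N by apply: leq_trans (ltn_ord i).
  exists 'X_(mxvec_index (Ordinal n0) i), 1; split=> //.
  by rewrite rmorph1 divr1 mxsubstX mxE.
split=> [a|_ _ [p [q [q0 ->]]] [p' [q' [q'0 ->]]]|_ _ [p [q [q0 ->]]] [p' [q' [q'0 ->]]]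
        |_ [p [q [q0 ->]]]|_ [p [q [q0 ->]]]].
- by exists a%:MP, 1; rewrite rmorph1 divr1 mxsubstC oner_neq0.
- exists (p * q' - p' * q), (q * q'); rewrite rmorphB !rmorphM mulf_neq0 //.
  by split=> //; field; apply/andP; split.
- exists (p * p'), (q * q'); rewrite !rmorphM mulf_neq0 //.
  by split=> //; field; apply/andP; split.
- have [p0|p0] := eqVneq (ev p W) 0.
    by exists 0, 1; rewrite rmorph0 !mul0r p0 mul0r invr0.
  by exists q, p; rewrite invfM invrK mulrC.
have [p' /(_ 1%:M)] := der_ev p; have [q' /(_ 1%:M)] := der_ev q.
rewrite map_mx1 mulmx1 => q'E p'E.
exists (p' * q - p * q'), (q * q).
rewrite rmorphB !rmorphM mulf_neq0 //= -q'E -p'E derM derV.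
by split=> //; field.
Qed.

(** The equations [J] at [A] give only that relations are preserved, and nothing is known yet about
    the inverse of [A]. Translation by [A] is injective and locally finite, so a stable space of
    relations contains the preimages of its elements. *)
Lemma ev_translate (A : 'M[C]_n) p : A \in unitmx ->
  (forall q, J q -> mx_eval q A = 0) ->
  (ev p (W *m cmx A) == 0) = (ev p W == 0).
Proof.
move=> uA JA.
have stable q : ev q W = 0 -> ev q (W *m cmx A) = 0.
  by move=> qW; rewrite -generic_eval; apply: rel_eval => //; apply: rel_gen.
apply/eqP/eqP => [pWA|]; last exact: stable.
pose AF := map_mx (\val : C -> F) A.
have AE : map_mx iota AF = cmx A by rewrite -map_mx_comp.
have uAF : AF \in unitmx by rewrite map_unitmx.
have TE q : ev (mx_translate AF q) W = ev q (W *m cmx A).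
  by rewrite mxsubst_translate AE.
apply: (@locally_finite_preimage _ _ (mx_translate AF) (fun q => ev q W = 0) p).
- exact: mx_translate_inj.
- by apply: locally_finite_mx_translation => i j; apply: mx_translateX.
- exact: rmorph0.
- by move=> q r q0 r0; rewrite rmorphD /= q0 r0 addr0.
- by move=> a q q0; rewrite -mul_mpolyC rmorphM /= q0 mulr0.
- by move=> q q0; rewrite TE; apply: stable.
by rewrite TE.
Qed.

(** The automorphism sends [p(W) / q(W)] to [p(W A) / q(W A)], which is well defined because the
    same [p] vanish at [W] and at [W A]. *)
Lemma dgal_of_matrix (A : 'M[C]_n) : A \in unitmx ->
  (forall q, J q -> mx_eval q A = 0) -> dgal_mx iota y A.
Proof.
move=> uA JA; have evA p := ev_translate p uA JA.
pose num z := sval (constructive_indefinite_description _ (fraction z)).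
pose den z := sval (constructive_indefinite_description _
  (svalP (constructive_indefinite_description _ (fraction z)))).
have den0 z : ev (den z) W != 0.
  by case: (svalP (constructive_indefinite_description _
    (svalP (constructive_indefinite_description _ (fraction z))))).
have numden z : z = ev (num z) W / ev (den z) W.
  by case: (svalP (constructive_indefinite_description _
    (svalP (constructive_indefinite_description _ (fraction z))))).
pose f z := ev (num z) (W *m cmx A) / ev (den z) (W *m cmx A).
have fE p q : ev q W != 0 ->
    f (ev p W / ev q W) = ev p (W *m cmx A) / ev q (W *m cmx A).
  move=> q0; set z := _ / _; apply/eqP; rewrite /f eqr_div ?evA //.
  rewrite -!rmorphM -subr_eq0 -rmorphB evA rmorphB !rmorphM subr_eq0 /=.
  by rewrite -eqr_div // -numden.
have [|||s sE] := @rmorphism_of_fun E E f.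
- move=> z t; rewrite {1}(numden z) {1}(numden t) -mulNr addf_div //.
  rewrite mulNr -!rmorphM -rmorphB fE; last by rewrite rmorphM /= mulf_neq0 ?den0.
  rewrite /f -[in RHS]mulNr addf_div ?evA //.
  by rewrite rmorphB !rmorphM mulNr.
- move=> z t; rewrite {1}(numden z) {1}(numden t) mulf_div.
  rewrite -!rmorphM fE; last by rewrite rmorphM /= mulf_neq0 ?den0.
  by rewrite /f mulf_div !rmorphM.
- by have := fE 1 1; rewrite !rmorph1 !divr1 oner_neq0; apply.
have sev p : s (ev p W) = ev p (W *m cmx A).
  by have := fE p 1; rewrite !rmorph1 !divr1 oner_neq0 sE; apply.
have s_base a : s (iota a) = iota a by rewrite -(mxsubstC iota W) sev !mxsubstC.
have s_der : diff_morphism s.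
  have dev p : s (der (ev p W)) = der (s (ev p W)).
    have [q qE] := der_ev p; have := qE 1%:M; rewrite map_mx1 mulmx1 => ->.
    by rewrite !sev qE.
  move=> z; have [p [q [_ ->]]] := fraction z.
  by rewrite rmorphM fmorphV !derM !derV rmorphD !rmorphM rmorphN rmorphM !fmorphV rmorphXn !dev.
have s_y j : s (y j) = \sum_i cst (A i j) * y i.
  have n0 : (0 < n)%N by apply: leq_trans (ltn_ord j).
  have yE i : y i = W (Ordinal n0) i by rewrite mxE.
  rewrite yE -(mxsubstX iota) sev mxsubstX mxE; apply: eq_bigr => i _.
  by rewrite -yE mxE mulrC.
have s_surj z : exists t, s t = z.
  apply: (y_gen (S := fun z => exists t, s t = z)) z => [|_ [j ->]].
    split=> [a|_ _ [z <-] [t <-]|_ _ [z <-] [t <-]|_ [z <-]|_ [z <-]].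
    + by exists (iota a).
    + by exists (z - t); rewrite rmorphB.
    + by exists (z * t); rewrite rmorphM.
    + by exists z^-1; rewrite fmorphV.
    by exists (der z).
  exists (\sum_i cst (invmx A i j) * y i); rewrite rmorph_sum.
  transitivity (\sum_k cst ((A *m invmx A) k j) * y k).
    under eq_bigr => i _ do rewrite rmorphM [s (cst _)]s_base s_y mulr_sumr.
    rewrite exchange_big; apply: eq_bigr => k _; rewrite mxE rmorph_sum mulr_suml.
    by apply: eq_bigr => i _; rewrite rmorphM mulrA [cst (A _ _) * _]mulrC.
  rewrite mulmxV // (bigD1 j) //= mxE eqxx rmorph1 mul1r big1 ?addr0 // => k /negPf kj.
  by rewrite mxE kj rmorph0 mul0r.
exists s => //; split=> //.
exists (fun z => sval (constructive_indefinite_description _ (s_surj z))) => z.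
  by apply: (fmorph_inj s); case: constructive_indefinite_description.
by case: constructive_indefinite_description.
Qed.

Lemma dgal_mxE (A : 'M[C]_n) :
  dgal_mx iota y A <-> A \in unitmx /\ forall q, J q -> mx_eval q A = 0.
Proof.
split=> [[s sG sy]|[uA JA]]; last exact: dgal_of_matrix.
split; first exact: dgal_matrix_unit sG sy.
by move=> q; apply: dgal_rel sG sy.
Qed.

Lemma dgal_comp_matrix (s t : {rmorphism E -> E}) (A B : 'M[C]_n) : is_dgal iota s ->
  (forall j, s (y j) = \sum_i cst (A i j) * y i) ->
  (forall j, t (y j) = \sum_i cst (B i j) * y i) ->
  forall j, s (t (y j)) = \sum_i cst ((A *m B) i j) * y i.
Proof.
move=> sG sy ty j; rewrite ty (dgal_lin sG).
transitivity (\sum_i \sum_k cst (B i j) * (cst (A k i) * y k)).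
  by apply: eq_bigr => i _; rewrite -mulr_sumr; congr (_ * _); apply: sy.
rewrite exchange_big; apply: eq_bigr => i _; rewrite mxE rmorph_sum mulr_suml.
by apply: eq_bigr => k _; rewrite rmorphM mulrA [cst (A _ _) * _]mulrC.
Qed.

Lemma dgal_mx_mul (A B : 'M[C]_n) :
  dgal_mx iota y A -> dgal_mx iota y B -> dgal_mx iota y (A *m B).
Proof.
move=> [s sG sy] [t tG ty]; exists (s \o t : {rmorphism E -> E}); first exact: dgal_comp.
exact: dgal_comp_matrix.
Qed.

Lemma dgal_mx1 : dgal_mx iota y 1%:M.
Proof.
exists (idfun : {rmorphism E -> E}); first exact: dgal_id.
move=> j; rewrite (bigD1 j) //= mxE eqxx rmorph1 mul1r big1 ?addr0 // => k /negPf kj.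
by rewrite mxE kj rmorph0 mul0r.
Qed.

Lemma dgal_mx_inv (A : 'M[C]_n) : dgal_mx iota y A -> dgal_mx iota y (invmx A).
Proof.
move=> [s sG sy]; have [t tG tK] := dgal_inv sG; have [B ty] := dgal_matrix tG.
suff <- : B = invmx A by exists t.
have uA := dgal_matrix_unit sG sy.
apply: (can_inj (mulKmx uA)); rewrite mulmxV //.
apply: (lin_indep_matrix y_indep) => j.
have := tK (y j); rewrite ty (dgal_lin sG) => yE.
have {}yE : \sum_k \sum_i cst (B i j) * (cst (A k i) * y k) = y j.
  rewrite exchange_big -yE; apply: eq_bigr => i _.
  by rewrite -mulr_sumr; congr (_ * _); symmetry; apply: sy.
transitivity (y j).
  rewrite -[RHS]yE; apply: eq_bigr => i _; rewrite mxE rmorph_sum mulr_suml.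
  by apply: eq_bigr => k _; rewrite rmorphM mulrA [cst (A _ _) * _]mulrC.
rewrite (bigD1 j) //= mxE eqxx rmorph1 mul1r big1 ?addr0 // => k /negPf kj.
by rewrite mxE kj rmorph0 mul0r.
Qed.

Lemma dgal_linear_algebraic_group : linear_algebraic_group (dgal_mx iota y).
Proof.
split; [exists J; exact: dgal_mxE | exact: dgal_mx1 | exact: dgal_mx_mul |].
exact: dgal_mx_inv.
Qed.

(* the identity [(z ⊗ β - 1 ⊗ α)^N = 0] in [E ⊗ F[W]] *)
Lemma rel_power_base z (alpha beta : {mpoly F[n * n]}) N :
  [pchar F] =i pred0 -> ev beta W != 0 -> z = ev alpha W / ev beta W ->
  U (((z *: Phi beta - Phi alpha) * map_mpoly cst (\det (mx_var C n))) ^+ N) ->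
  exists a, z = iota a.
Proof.
move=> charF beta0 Dz Uf.
have Urep u : U u -> exists r : seq (E * {mpoly F[n * n]}),
    (forall x, x \in r -> ev x.2 W = 0) /\ u = \sum_(x <- r) x.1 *: Phi x.2.
  elim=> {u} [|u v _ [r [rW ->]] _ [r' [r'W ->]]|c u _ [r [rW ->]]|p pW].
  - by exists [::]; rewrite big_nil.
  - exists (r ++ r'); rewrite big_cat; split=> // x.
    by rewrite mem_cat => /orP[/rW|/r'W].
  - exists [seq (c * x.1, x.2) | x <- r]; split=> [_ /mapP[x /rW xW ->]//|].
    by rewrite big_map scaler_sumr; apply: eq_bigr => x _; rewrite scalerA.
  exists [:: (1, p)]; rewrite big_seq1 scale1r; split=> // x.
  by rewrite inE => /eqP->.
have [r0 [rW Df]] := Urep _ Uf; pose m := size r0.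
pose e (k : 'I_m) := (nth (0, 0) r0 k).1; pose p (k : 'I_m) := (nth (0, 0) r0 k).2.
have pW k : ev (p k) W = 0 by apply/rW/mem_nth.
have {}Df : ((z *: Phi beta - Phi alpha) * map_mpoly cst (\det (mx_var C n))) ^+ N =
    \sum_k e k *: Phi (p k).
  by rewrite Df (big_nth (0, 0)) big_mkord.
pose im := map_mpoly (n := n * n) iota.
(* Substituting [W^-1 X] undoes [Phi], so that every [Phi q] returns to a polynomial with
   coefficients in [F]. *)
pose X' : 'M[{mpoly E[n * n]}]_n := map_mx (@mpolyC _ E) (invmx W) *m mx_var E n.
pose psi : {rmorphism {mpoly E[n * n]} -> {mpoly E[n * n]}} := mxsubst (@mpolyC _ E) X'.
have psi_var : map_mx psi (mx_var E n) = X'.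
  by apply/matrixP => k l; rewrite [LHS]mxE [mx_var E n k l]mxE; apply: mxsubstX.
have psiC c : psi c%:MP = c%:MP by apply: mxsubstC.
have psiZ c u : psi (c *: u) = c *: psi u.
  by rewrite -mul_mpolyC rmorphM psiC mul_mpolyC.
have psi_gen q : psi (Phi q) = im q.
  have psi_entry k l :
      psi ((map_mx (@mpolyC _ E) W *m mx_var E n) k l) = mx_var E n k l.
    transitivity ((map_mx (@mpolyC _ E) W *m X') k l).
      rewrite mxE [RHS]mxE rmorph_sum; apply: eq_bigr => j _.
      by rewrite rmorphM -psi_var [map_mx _ W k j]mxE psiC [map_mx psi _ j l]mxE.
    by rewrite mulmxA -map_mxM mulmxV ?wronskian_unit // map_mx1 mul1mx.
  elim/mxsubst_closure: q => [c|i j|q r IHq IHr|q r IHq IHr].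
  - by rewrite /generic mxsubstC psiC /im map_mpolyC.
  - by rewrite /generic mxsubstX psi_entry /im map_mpolyX mxE.
  - have -> : Phi (q + r) = Phi q + Phi r by apply: rmorphD.
    by rewrite rmorphD IHq IHr /im rmorphD.
  have -> : Phi (q * r) = Phi q * Phi r by apply: rmorphM.
  by rewrite rmorphM IHq IHr /im rmorphM.
have detE (K : fieldType) (g : {rmorphism K -> E}) :
    map_mpoly g (\det (mx_var K n)) = \det (mx_var E n).
  rewrite -det_map_mx; congr (\det _); apply/matrixP => i j.
  by rewrite !mxE /= map_mpolyX.
pose d := \det (invmx W).
have d0 : d != 0 by rewrite -unitfE -unitmxE unitmx_inv wronskian_unit.
have psi_det : psi (map_mpoly cst (\det (mx_var C n))) = d *: im (\det (mx_var F n)).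
  rewrite /im !detE -[LHS]det_map_mx psi_var.
  by rewrite det_mulmx det_map_mx mul_mpolyC.
pose g (i : nat) := (- alpha) ^+ (N - i) * beta ^+ i * \det (mx_var F n) ^+ N *+ 'C(N, i).
have identity : \sum_(i < N.+1) z ^+ i *: im (g i) =
    \sum_k (d ^- N * e k) *: im (p k).
  have e1 : psi (((z *: Phi beta - Phi alpha) * map_mpoly cst (\det (mx_var C n))) ^+ N) =
      d ^+ N *: ((z *: im beta - im alpha) ^+ N * im (\det (mx_var F n)) ^+ N).
    rewrite rmorphXn rmorphM rmorphB psiZ !psi_gen psi_det.
    by rewrite -scalerAr exprZn exprMn.
  transitivity (d ^- N *: psi (\sum_k e k *: Phi (p k))); last first.
    rewrite rmorph_sum scaler_sumr; apply: eq_bigr => k _.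
    by rewrite psiZ psi_gen scalerA.
  rewrite -Df e1 scalerA mulVf ?expf_neq0 // scale1r addrC exprDn mulr_suml.
  apply: eq_bigr => i _; rewrite /g /im rmorphMn !rmorphM !rmorphXn rmorphN /=.
  by rewrite exprZn -scalerAr mulrnAl -scalerMnr -scalerAl.
(* The powers of [z] and the coefficients of the relations are expanded along one free family, so
   that [identity] can be compared coordinate by coordinate over [F]. *)
pose fam (k : 'I_(N.+1 + m)) :=
  match split k with inl i => z ^+ i | inr j => d ^- N * e j end.
have [r [t [Z [famZ free]]]] := free_coordinates iota fam.
have famL (i : 'I_N.+1) : z ^+ i = \sum_j iota (Z (lshift m i) j) * t j.
  by have := famZ (lshift m i); rewrite /fam (unsplitK (inl i)).
have famR k : d ^- N * e k = \sum_j iota (Z (rshift N.+1 k) j) * t j.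
  by have := famZ (rshift N.+1 k); rewrite /fam (unsplitK (inr k)).
apply: (@nilpotent_difference_base _ _ iota z N r t (usubmx Z)) => // [i|j].
  by rewrite famL; apply: eq_bigr => j _; rewrite mxE.
have coord : \sum_(i < N.+1) Z (lshift m i) j *: g i = \sum_k Z (rshift N.+1 k) j *: p k.
  apply/mpolyP => mm; apply/eqP; rewrite -subr_eq0 !raddf_sum /=; apply/eqP.
  pose G j := \sum_(i < N.+1) Z (lshift m i) j * (g i)@_mm -
    \sum_k Z (rshift N.+1 k) j * (p k)@_mm.
  have G0 : \sum_j iota (G j) * t j = 0.
    have := congr1 (mcoeff mm) identity; rewrite !raddf_sum /= => /eqP.
    rewrite -subr_eq0 => /eqP e1; rewrite -[RHS]e1.
    under eq_bigr do rewrite /G rmorphB mulrBl !rmorph_sum !mulr_suml.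
    rewrite sumrB exchange_big [X in _ - X]exchange_big /=.
    congr (_ - _); apply: eq_bigr => i _ /=; rewrite mcoeffZ mcoeff_map_mpoly /=.
      by rewrite famL mulr_suml; apply: eq_bigr => l _; rewrite rmorphM mulrAC.
    by rewrite famR mulr_suml; apply: eq_bigr => l _; rewrite rmorphM mulrAC.
  rewrite -[RHS](free _ G0 j) /G.
  rewrite sumrN; congr (_ - _); by apply: eq_bigr => i _; rewrite mcoeffZ.
(* Evaluated at [W], [alpha] is [z] times [beta], so this is a common factor of all the terms. *)
have w0 : (ev beta W * \det W) ^+ N != 0.
  by rewrite expf_neq0 // mulf_neq0 // -unitfE -unitmxE wronskian_unit.
apply: (mulIf w0); rewrite mul0r.
have coordW : \sum_(i < N.+1) iota (Z (lshift m i) j) * ev (g i) W = 0.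
  have := congr1 (mxsubst iota W) coord; rewrite !rmorph_sum /= => e1.
  transitivity (\sum_k ev (Z (rshift N.+1 k) j *: p k) W).
    by rewrite -e1; apply: eq_bigr => i _; rewrite -mul_mpolyC rmorphM /= mxsubstC.
  by rewrite big1 // => k _; rewrite -mul_mpolyC rmorphM /= pW mulr0.
rewrite -[RHS]coordW mulr_suml; apply: eq_bigr => i _.
rewrite mxE -mulrA; congr (_ * _); rewrite /g rmorphMn !rmorphM !rmorphXn rmorphN /=.
have -> : ev (\det (mx_var F n)) W = \det W.
  rewrite -[LHS]det_map_mx; congr (\det _); apply/matrixP => k l.
  by rewrite !mxE /= mxsubstX mxE.
rewrite mulrnAl; congr (_ *+ _); have -> : ev alpha W = z * ev beta W.
  by rewrite Dz divfK.
have le_iN : (i <= N)%N by rewrite -ltnS.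
have bN : ev beta W ^+ N = ev beta W ^+ (N - i) * ev beta W ^+ i.
  by rewrite -exprD subnK.
by rewrite -mulNr !exprMn bN; ring.
Qed.

Lemma rel_radicalD u v k l : U (u ^+ k) -> U (v ^+ l) -> U ((u + v) ^+ (k + l)).
Proof.
have [U0 UD UM] := rel_idealP => Uu Uv; rewrite exprDn; apply: ideal_sum => [|i _].
  exact: rel_idealP.
rewrite -mulr_natl; apply: (UM); have [le_li|lt_il] := leqP l i.
  by rewrite -(subnK le_li) exprD; do 2!apply: (UM).
have le_k : (k <= k + l - i)%N by lia.
by rewrite mulrC -(subnK le_k) exprD; do 2!apply: (UM).
Qed.

(** [V] is vanishing on [G] and [T] is membership in the radical of the relation ideal after
    inverting the determinant; descent passes from one to the other. *)
Theorem dgal_fixed_base z : GRing.closed_field_axiom C -> [pchar F] =i pred0 ->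
  (forall s : {rmorphism E -> E}, is_dgal iota s -> s z = z) -> exists a, z = iota a.
Proof.
move=> closedC charF zfix; have [alpha [beta [beta0 Dz]]] := fraction z.
pose dC := \det (mx_var C n).
pose T u := exists k, U ((u * map_mpoly cst dC) ^+ k).
have [U0 UD UM] := rel_idealP.
suff [N UN] : T (z *: Phi beta - Phi alpha) by apply: rel_power_base UN.
pose V u := forall A, dgal_mx iota y A -> mx_eval u (cmx A) = 0.
apply: (@constant_mpolys_span _ _ iota _ V T _ iota_der nnc).
- by move=> e u Vu A GA; rewrite mx_evalZ Vu ?mulr0.
- by move=> u Vu A GA; rewrite mx_eval_mder Vu ?der0.
- by exists 1%N; rewrite mul0r expr1.
- by move=> u v [k Uu] [l Uv]; exists (k + l)%N; rewrite mulrDl; apply: rel_radicalD.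
- by move=> e u [k Uu]; exists k; rewrite -scalerAl exprZn; apply: relZ.
- move=> q Vq; apply: NNPP => Nq.
  (* The factor [dC] forces the zero found to be an invertible matrix, hence a point of [G]. *)
  have [k JN|v vJ] := @nullstellensatz C _ J (q * dC) closedC rel_const_idealP.
    by apply: Nq; exists k; rewrite -rmorphM -rmorphXn.
  pose A : 'M[C]_n := vec_mx (\row_k v k).
  have evA r : r.@[v] = mx_eval r A.
    by apply: meval_eq => k; rewrite vec_mxK mxE.
  rewrite evA mx_evalM.
  have -> : mx_eval dC A = \det A.
    rewrite /mx_eval -[LHS]det_map_mx; congr (\det _).
    by apply/matrixP => k l; rewrite [LHS]mxE [mx_var C n k l]mxE /= mevalXU mxvecE.
  rewrite mulf_eq0 negb_or => /andP[qA dA].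
  have GA : dgal_mx iota y A.
    apply/dgal_mxE; split; first by rewrite unitmxE unitfE.
    by move=> r Jr; rewrite -evA vJ.
  have : cst (mx_eval q A) = 0 by rewrite -mx_eval_cst Vq.
  by move/eqP; rewrite fmorph_eq0 (negPf qA).
move=> A [s sG sy]; rewrite mx_evalB mx_evalZ !generic_eval -(dgal_wronskian sG sy).
have ev_s q : ev q (map_mx s W) = s (ev q W).
  by rewrite (@mxsubst_comp _ _ _ _ iota s iota) //; apply: dgal_base.
rewrite !ev_s -{1}(zfix s sG) -rmorphM -rmorphB {1}Dz divfK // subrr.
by rewrite rmorph0.
Qed.

End GaloisGroup.

(** * Factorization of operators with unipotent action *)

Lemma row_completion (K : fieldType) n (c : 'rV[K]_n.+1) : c != 0 ->
  exists2 P : 'M_n.+1, P \in unitmx & exists2 k, k != 0 & row 0 P = k *: c.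
Proof.
move=> c0; exists (row_ebase c); first exact: row_ebase_unit.
have Dc : c = col_ebase c 0 0 *: row 0 (row_ebase c).
  rewrite -{1}(mulmx_ebase c) rank_rV c0 [col_ebase c]mx11_scalar -mulmxA mul_scalar_mx.
  rewrite [_%:M 0 0]mxE eqxx mulr1n; congr (_ *: _).
  rewrite rowE; congr (_ *m _); apply/matrixP => i j; rewrite !mxE !ord1 /=.
  by rewrite ltnS leqn0 andbC eq_sym; case: eqP.
have k0 : col_ebase c 0 0 != 0.
  by apply: contraNneq c0 => k0; rewrite Dc k0 scale0r.
by exists (col_ebase c 0 0)^-1; rewrite ?invr_eq0 // {3}Dc scalerA mulVf // scale1r.
Qed.

Lemma trmx_exp (R : comNzRingType) n (A : 'M[R]_n) k : A^T ^+ k = (A ^+ k)^T.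
Proof.
elim: k => [|k IHk]; first by rewrite !expr0 [RHS]trmx1.
by rewrite exprS exprSr IHk -!mulmxE trmx_mul.
Qed.

Lemma size_Lop_dopC (F : diffFieldType) (f : seq F) (a : F) :
  nonzero_entries f -> a != 0 ->
  size (Lop f * dopC a : {poly F}) = (size f).+1.
Proof.
move=> f0 a0; elim: f f0 => [_|g f IHf /= /andP[g0 /IHf sf]].
  by rewrite /Lop big_nil mul1r size_polyC a0.
rewrite /Lop big_cons -!mulrA -/(Lop f); set M := Lop f * dopC a in sf *.
rewrite [dopC g * _]diffop_mulC [dop_der F * M]diffop_mulX size_scale //.
rewrite /dmul size_polyDl size_mulX -?size_poly_gt0 ?sf //.
by rewrite ltnS (leq_trans (size_poly _ _)) ?sf.
Qed.

Section Factorization.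
Variables (F E : diffFieldType) (iota : {rmorphism F -> E}).
Hypothesis iota_der : diff_morphism iota.
Local Notation C := (constants F).
Local Notation cst := (cst iota).
Local Notation app := (dop_app iota).

Lemma dop_app0r M : app M 0 = 0.
Proof. by rewrite /dop_app big1 // => i _; rewrite iter_der0 mulr0. Qed.

Lemma app_cons g f z : app (Lop (g :: f)) z = iota g * der (app (Lop f) z).
Proof. by rewrite /Lop big_cons !dop_appM // dop_appC dop_app_der. Qed.

Lemma app_rcons f g z : app (Lop (rcons f g)) z = app (Lop f) (iota g * der z).
Proof.
by rewrite /Lop -cats1 big_cat big_seq1 !dop_appM // dop_appC dop_app_der.
Qed.

Lemma app_nil z : app (Lop [::]) z = z.
Proof. by rewrite /Lop big_nil -[1]/(dopC 1) dop_appC rmorph1 mul1r. Qed.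

Lemma appN (M : {diffop F}) z : app (- M) z = - app M z.
Proof.
have DN1 : (-1 : {diffop F}) = dopC (-1) by rewrite /dopC polyCN.
by rewrite -mulN1r DN1 dop_appM // dop_appC rmorphN1 mulN1r.
Qed.

Lemma lin_indep_unitmx m (u : 'I_m -> E) (P : 'M[C]_m) :
  P \in unitmx -> lin_indep iota u ->
  lin_indep iota (fun j => \sum_i cst (P j i) * u i).
Proof.
move=> uP indu c c0; pose r := \row_j c j.
suff /rowP r0 : r = 0 by move=> j; have := r0 j; rewrite !mxE.
apply: (can_inj (mulmxK uP)); rewrite mul0mx; apply/rowP => i.
rewrite mxE [RHS]mxE; move: i; apply: indu; rewrite -[RHS]c0.
under eq_bigr do rewrite rmorph_sum mulr_suml.
rewrite exchange_big; apply: eq_bigr => j _; rewrite mulr_sumr.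
by apply: eq_bigr => i _; rewrite mxE rmorphM mulrA.
Qed.

Lemma Cspan_unitmx m (u : 'I_m -> E) (P : 'M[C]_m) i : P \in unitmx ->
  Cspan iota (fun j => \sum_i cst (P j i) * u i) (u i).
Proof.
move=> uP; exists (fun j => invmx P i j).
under eq_bigr do rewrite mulr_sumr.
rewrite exchange_big (bigD1 i) //= -[LHS]addr0; congr (_ + _).
  under eq_bigr do rewrite mulrA -rmorphM.
  rewrite -mulr_suml -rmorph_sum.
  have := congr1 (fun A : 'M_m => A i i) (mulVmx uP); rewrite !mxE eqxx => ->.
  by rewrite rmorph1 mul1r.
rewrite big1 // => k ki; under eq_bigr do rewrite mulrA -rmorphM.
rewrite -mulr_suml -rmorph_sum.
have := congr1 (fun A : 'M_m => A i k) (mulVmx uP); rewrite !mxE eq_sym (negPf ki) => ->.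
by rewrite rmorph0 mul0r.
Qed.

Lemma Cspan_trans m p (u : 'I_m -> E) (v : 'I_p -> E) z :
  (forall i, Cspan iota v (u i)) -> Cspan iota u z -> Cspan iota v z.
Proof. by move=> uv [c ->]; apply: Cspan_sum => i _; apply: Cspan_scale. Qed.

Lemma Cspan_matrix m (s : E -> E) (u : 'I_m -> E) :
  (forall j, Cspan iota u (s (u j))) ->
  exists B : 'M[C]_m, forall j, s (u j) = \sum_i cst (B j i) * u i.
Proof.
move=> su; pose b j := sval (constructive_indefinite_description _ (su j)).
exists (\matrix_(j, i) b j i) => j.
rewrite {1}(svalP (constructive_indefinite_description _ (su j))).
by apply: eq_bigr => i _; rewrite mxE.
Qed.

Section SingleAutomorphism.
Variable s : {rmorphism E -> E}.
Hypothesis sG : is_dgal iota s.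

(** Coefficients of [s (u j)] form row [j] of [B], the transpose of the convention of [dgal_mx], so
    that [B] acts on coordinate rows from the right. *)
Lemma iter_diff_matrix m (u : 'I_m -> E) (B : 'M[C]_m) (sq : seq unit) (c : 'rV[C]_m) :
  (forall j, s (u j) = \sum_i cst (B j i) * u i) ->
  iter_diff (fun _ => s) sq (\sum_i cst (c 0 i) * u i) =
  \sum_i cst ((c *m (B - 1%:M) ^+ size sq) 0 i) * u i.
Proof.
move=> su; elim: sq c => [|t sq IHsq] c /=; first by rewrite expr0 mulmx1.
rewrite exprS -mulmxE mulmxA -IHsq; congr (iter_diff _ _ _).
rewrite (dgal_lin sG) mulmxBr mulmx1; under [RHS]eq_bigr do rewrite mxE rmorphD mulrDl.
rewrite big_split /=; congr (_ + _).
  under eq_bigr do rewrite su mulr_sumr.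
  rewrite exchange_big; apply: eq_bigr => i _; rewrite mxE rmorph_sum mulr_suml.
  by apply: eq_bigr => j _; rewrite rmorphM mulrA.
by rewrite -sumrN; apply: eq_bigr => i _; rewrite mxE rmorphN mulNr.
Qed.

Lemma Cspan_delta m (u : 'I_m -> E) j :
  u j = \sum_i cst ((delta_mx 0 j : 'rV[C]_m) 0 i) * u i.
Proof.
rewrite (bigD1 j) //= mxE !eqxx rmorph1 mul1r big1 ?addr0 // => i /negPf ij.
by rewrite mxE ij andbF rmorph0 mul0r.
Qed.

Lemma unip_matrix m (u : 'I_m -> E) (B : 'M[C]_m) :
  lin_indep iota u -> (forall j, s (u j) = \sum_i cst (B j i) * u i) ->
  (forall j, unip s (u j)) <-> unipotent_mx B.
Proof.
move=> indu su; split=> [uu|[k Bk] j]; last first.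
  exists k => sq sk; rewrite (Cspan_delta u j) (iter_diff_matrix _ _ su) sk Bk mulmx0.
  by rewrite big1 // => i _; rewrite mxE rmorph0 mul0r.
pose N j := sval (constructive_indefinite_description _ (uu j)).
pose k := \max_j N j; exists k; apply/matrixP => j i; rewrite [RHS]mxE.
have uk : fil (fun _ : unit => s) k (u j).
  apply: (@fil_mono _ _ _ (N j)); first exact: leq_bigmax.
  exact: svalP (constructive_indefinite_description _ (uu j)).
have := uk (nseq k tt) (size_nseq _ _).
rewrite (Cspan_delta u j) (iter_diff_matrix _ _ su) size_nseq -rowE => /indu/(_ i).
by rewrite mxE.
Qed.

(** Inverses leave the ring of unipotent elements, but its quotients form a differential field. *)
Lemma unip_fractions (A : E -> Prop) z : diff_generated_by iota A ->
  (forall a, A a -> unip s a) ->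
  exists P Q, [/\ unip s P, unip s Q, Q != 0 & z = P / Q].
Proof.
move=> genA uA.
have u1 : unip s 1 by apply: unip_fixed; rewrite rmorph1.
apply: (genA (fun z => exists P Q, [/\ unip s P, unip s Q, Q != 0 & z = P / Q])); last first.
  by move=> a /uA ua; exists a, 1; rewrite divr1 oner_neq0.
have ds : diff_morphism s by case: sG.
split=> [a|_ _ [P [Q [uP uQ Q0 ->]]] [P' [Q' [uP' uQ' Q'0 ->]]]
        |_ _ [P [Q [uP uQ Q0 ->]]] [P' [Q' [uP' uQ' Q'0 ->]]]
        |_ [P [Q [uP uQ Q0 ->]]]|_ [P [Q [uP uQ Q0 ->]]]].
- exists (iota a), 1; rewrite divr1 oner_neq0; split=> //.
  exact/unip_fixed/(dgal_base sG).
- exists (P * Q' - P' * Q), (Q * Q'); rewrite mulf_neq0 //; split=> //.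
  + by apply: unipB; apply: unipM.
  + exact: unipM.
  by field; apply/andP; split.
- exists (P * P'), (Q * Q'); rewrite mulf_neq0 //; split=> //; try exact: unipM.
  by field; apply/andP; split.
- have [->|P0] := eqVneq P 0.
    by exists 0, 1; rewrite oner_neq0 !mul0r invr0; split=> //; apply: unip_fixed; rewrite rmorph0.
  by exists Q, P; rewrite invfM invrK mulrC.
exists (der P * Q - P * der Q), (Q * Q); rewrite mulf_neq0 //; split=> //.
- by apply: unipB; apply: unipM => //; apply: unip_der.
- exact: unipM.
by rewrite derM derV; field.
Qed.

(** An eigenvector of [s] in the span is a quotient of unipotent elements, so its eigenvalue is
    1. *)
Lemma unip_stable_span (A : E -> Prop) m (u : 'I_m -> E) j :
  GRing.closed_field_axiom C -> diff_generated_by iota A ->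
  (forall a, A a -> unip s a) -> lin_indep iota u ->
  (forall j, Cspan iota u (s (u j))) -> unip s (u j).
Proof.
move=> closedC genA uA indu /Cspan_matrix[B su].
move: j; apply/(unip_matrix indu su).
apply: unipotent_single_eigenvalue => // a v v0 vB.
pose w := \sum_i cst (v 0 i) * u i.
have w0 : w != 0.
  by apply: contraNneq v0 => /indu w0; apply/eqP/rowP => i; rewrite w0 mxE.
have sw : s w = cst a * w.
  rewrite (dgal_lin sG) mulr_sumr; under eq_bigr do rewrite su mulr_sumr.
  rewrite exchange_big; apply: eq_bigr => i _ /=.
  have /rowP/(_ i) := vB; rewrite !mxE mulrA -rmorphM => <-.
  rewrite rmorph_sum mulr_suml; apply: eq_bigr => k _.
  by rewrite rmorphM mulrA.
have [P [Q [uP uQ Q0 Dw]]] := unip_fractions w genA uA.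
have : cst a = 1.
  apply: (unip_quotient_eigenvalue uP uQ _ w0 Q0 sw); first by rewrite Dw divfK.
  exact: dgal_cst.
by rewrite -(rmorph1 cst) => /fmorph_inj.
Qed.

End SingleAutomorphism.

Definition dgal_type := {s : {rmorphism E -> E} | is_dgal iota s}.
Definition dgal_act (t : dgal_type) : {rmorphism E -> E} := sval t.

Hypothesis nnc : no_new_constants iota.

(** Without its first factor the operator sends [z] to a constant, which the group fixes; each
    difference therefore costs one factor. *)
Lemma Lop_fil f z : nonzero_entries f -> app (Lop f) z = 0 -> fil dgal_act (size f) z.
Proof.
elim: f z => [|g f IHf] z /=; first by move=> _; rewrite app_nil => ->; apply: fil_zero.
move=> /andP[g0 f0] /eqP; rewrite app_cons mulf_eq0 fmorph_eq0 (negPf g0) /=.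
move=> /eqP/(const_cst iota_der nnc)[c Dc]; apply/filS => t.
have tG : is_dgal iota (dgal_act t) := svalP t.
apply: IHf => //; rewrite -[X in X - _]mul1r -mulN1r.
have := dop_app_lin iota_der (Lop f) (fun i : 'I_2 => if i == 0 then 1 else -1)
  (fun i : 'I_2 => if i == 0 then dgal_act t z else z).
rewrite !big_ord_recl !big_ord0 !addr0 /= rmorph1 rmorphN rmorph1 => ->.
by rewrite (dgal_dop tG) Dc (dgal_cst tG) mul1r mulN1r subrr.
Qed.

Lemma Lop_unip f z s : nonzero_entries f -> app (Lop f) z = 0 ->
  is_dgal iota s -> unip s z.
Proof.
move=> f0 fz sG; exists (size f); have := Lop_fil f0 fz.
exact: (@fil_single _ _ dgal_act (exist _ s sG)).
Qed.

End Factorization.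

Section UnipotentFactorization.
Variables (F E : diffFieldType) (iota : {rmorphism F -> E}).
Hypothesis iota_der : diff_morphism iota.
Local Notation C := (constants F).
Local Notation cst := (cst iota).
Local Notation app := (dop_app iota).
Hypothesis nnc : no_new_constants iota.
Hypotheses (closedC : GRing.closed_field_axiom C) (charF : [pchar F] =i pred0).
Hypothesis fixed_base : forall z,
  (forall s : {rmorphism E -> E}, is_dgal iota s -> s z = z) -> exists a, z = iota a.

Lemma pchar_constants : [pchar C] =i pred0.
Proof.
apply/pcharf0P => k; move/pcharf0P: charF => /(_ k) <-.
by rewrite -(rmorph_nat (\val : C -> F)) fmorph_eq0.
Qed.

(* The first vector of the basis [v] is fixed by the group, hence in [F]; the
   derivatives of the quotients by it span a space of smaller dimension. *)
Lemma unipotent_factorization m (u : 'I_m -> E) :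
  lin_indep iota u ->
  (forall s : {rmorphism E -> E}, is_dgal iota s -> forall j, Cspan iota u (s (u j))) ->
  (forall s : {rmorphism E -> E}, is_dgal iota s -> forall j, unip s (u j)) ->
  exists (f : seq F) (f' : F), [/\ size f = m, nonzero_entries f, f' != 0 &
    forall j, app (Lop f * dopC f') (u j) = 0].
Proof.
elim: m u => [|m IHm] u indu su uu.
  by exists [::], 1; split=> //; [apply: oner_neq0 | case].
pose S (B : 'M[C]_m.+1) := exists2 s : {rmorphism E -> E}, is_dgal iota s &
  forall j, s (u j) = \sum_i cst (B j i) * u i.
have [||c c0 cS] := @kolchin_fixed_vector _ _ S closedC pchar_constants.
- move=> A B [s sG sA] [t tG tB]; exists (t \o s : {rmorphism E -> E}).
    exact: dgal_comp.
  move=> j /=; rewrite sA (dgal_lin tG).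
  transitivity (\sum_i \sum_k cst (A j i) * (cst (B i k) * u k)).
    by apply: eq_bigr => i _; rewrite -mulr_sumr; congr (_ * _); apply: tB.
  rewrite exchange_big; apply: eq_bigr => i _; rewrite mxE rmorph_sum mulr_suml.
  by apply: eq_bigr => k _; rewrite rmorphM mulrA.
- by move=> B [s sG sB]; apply/(unip_matrix sG indu sB) => j; apply: uu.
have [P uP [k k0 Pc]] := row_completion c0.
pose v j := \sum_i cst (P j i) * u i.
have v0E : v ord0 = cst k * \sum_i cst (c 0 i) * u i.
  rewrite mulr_sumr; apply: eq_bigr => i _.
  by have /rowP/(_ i) := Pc; rewrite !mxE => ->; rewrite rmorphM mulrA.
have indv : lin_indep iota v by apply: lin_indep_unitmx.
have uv i : Cspan iota v (u i) by apply: Cspan_unitmx.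
have [a Da] : exists a, v ord0 = iota a.
  apply: fixed_base => s sG; rewrite v0E rmorphM (dgal_cst sG) (dgal_lin sG).
  congr (_ * _); have [B sB] := Cspan_matrix (su s sG).
  under eq_bigr do rewrite sB mulr_sumr.
  rewrite exchange_big; apply: eq_bigr => i _ /=.
  have /rowP/(_ i) : c *m B = c by apply: cS; exists s.
  rewrite mxE => <-; rewrite rmorph_sum mulr_suml.
  by apply: eq_bigr => j _; rewrite rmorphM mulrA.
have ia0 : iota a != 0.
  rewrite -Da; apply/eqP => v00; have := indv (fun j => (j == ord0)%:R).
  rewrite (bigD1 ord0) //= v00 mulr0 add0r big1 => [/(_ erefl ord0)/eqP|j /negPf->].
    by rewrite oner_eq0.
  by rewrite rmorph0 mul0r.
pose w j := der (v (lift ord0 j) / iota a).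
have span_w z : Cspan iota u z -> Cspan iota w (der (z / iota a)).
  move=> uz; have [e ->] := Cspan_trans uv uz; exists (fun j => e (lift ord0 j)).
  rewrite mulr_suml raddf_sum big_ord_recl /= Da mulfK // der_cst // add0r.
  by apply: eq_bigr => j _; rewrite -mulrA der_cstM.
have uvj j : Cspan iota u (v j) by exists (fun i => P j i).
have [|||f [f' [sf f0 f'0 fw]]] := IHm w.
- move=> e e0; have : der ((\sum_j cst (e j) * v (lift ord0 j)) / iota a) = 0.
    rewrite mulr_suml raddf_sum -[RHS]e0; apply: eq_bigr => j _ /=.
    by rewrite -mulrA der_cstM.
  move=> /(const_cst iota_der nnc)[d Dd].
  have Dd' : \sum_j cst (e j) * v (lift ord0 j) = cst d * v ord0.
    by rewrite Da -Dd divfK.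
  pose e' j := if unlift ord0 j is Some i then e i else - d.
  have /indv e'0 : \sum_j cst (e' j) * v j = 0.
    rewrite big_ord_recl {1}/e' unlift_none rmorphN mulNr.
    under eq_bigr do rewrite /e' liftK.
    by rewrite Dd' addNr.
  by move=> j; have := e'0 (lift ord0 j); rewrite /e' liftK.
- move=> s sG j; rewrite (dgal_der sG) rmorphM fmorphV (dgal_base sG).
  apply: span_w; rewrite (dgal_lin sG); apply: Cspan_sum => i _.
  exact/Cspan_scale/su.
- move=> s sG j; apply: unip_der; first by case: sG.
  apply: unipM; last by apply: unip_fixed; rewrite fmorphV (dgal_base sG).
  rewrite /v; elim/big_ind: _ => [|x y ux uy|i _].
  + by apply: unip_fixed; rewrite rmorph0.
  + rewrite -[y]opprK; apply: unipB => //; rewrite -sub0r; apply: unipB => //.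
    by apply: unip_fixed; rewrite rmorph0.
  by apply: unipM; [apply/unip_fixed/(dgal_cst sG) | apply: uu].
have a0 : a != 0 by rewrite -(fmorph_eq0 iota).
(* Division by [v ord0], that is by [a], followed by derivation sends the [v] to 0 and the [w];
   hence the new right end of the operator. *)
exists (rcons f f'), a^-1; split; rewrite ?size_rcons ?sf ?invr_eq0 //.
  by rewrite /nonzero_entries all_rcons f'0.
suff appv j : app (Lop (rcons f f') * dopC a^-1) (v j) = 0.
  move=> j; have [e ->] := uv j; rewrite dop_app_lin // big1 // => i _.
  by rewrite appv mulr0.
rewrite dop_appM // dop_appC app_rcons // fmorphV.
rewrite [X in app _ X](_ : _ = app (dopC f') (der (v j / iota a))); last first.
  by rewrite dop_appC mulrC [_^-1 * _]mulrC mulrC.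
rewrite -dop_appM //; case: (unliftP ord0 j) => [i|] ->; first exact: fw.
by rewrite Da divff // der1 dop_app0r.
Qed.

Lemma size_Lop f : nonzero_entries f -> size (Lop f : {poly F}) = (size f).+1.
Proof.
move=> f0; have := size_Lop_dopC f0 (oner_neq0 F).
by rewrite -[dopC 1]/(1 : {diffop F}) mulr1.
Qed.

Lemma gen_iterated_PV z : gen_iterated_integral iota z -> PV_ring iota z.
Proof.
move=> [f [f_gt0 f0 fz]]; exists (Lop f); split=> //.
by rewrite -size_poly_gt0 size_Lop.
Qed.

(** Subtracting from [L] the multiple [dopC a * M] with the same leading term leaves an operator of
    smaller size with [n] independent solutions, hence zero. *)
Lemma factor_of_unipotent n (L : {diffop F}) (y : 'I_n -> E) :
  monic_op L -> dop_order L = n -> solution_basis iota L y ->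
  (forall s : {rmorphism E -> E}, is_dgal iota s -> forall j, unip s (y j)) ->
  exists (f : n.-tuple F) (f' : F),
    [/\ nonzero_entries f, f' != 0 & L = Lop f * dopC f'].
Proof.
move=> L_monic L_order [y_sol y_indep y_span] uy.
have L0 : L != 0 by apply: monic_neq0.
have [s sG j|f [f' [sf f0 f'0 fy]]] := unipotent_factorization y_indep _ uy.
  by apply: y_span; rewrite (dgal_dop sG) y_sol rmorph0.
set M := Lop f * dopC f' in fy.
have sM : size (M : {poly F}) = n.+1 by rewrite size_Lop_dopC // sf.
have sL : size (L : {poly F}) = n.+1.
  by rewrite -L_order prednK // size_poly_gt0.
have [a [a0 LM]] : exists a, a != 0 /\ L = dopC a * M.
  pose a := (lead_coef (M : {poly F}))^-1.
  have a0 : a != 0 by rewrite invr_eq0 lead_coef_eq0 -size_poly_gt0 sM.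
  exists a; split=> //; apply/eqP; rewrite -subr_eq0; apply/eqP; set R := L - _; apply: NNPP => /eqP R0.
  have : (n <= dop_order R)%N.
    apply: (indep_solutions_bound iota_der R0 nnc y_indep) => i.
    rewrite /R dop_appD appN // dop_appM // fy.
    by rewrite y_sol dop_app0r oppr0 addr0.
  have : (size (R : {poly F}) <= n)%N.
    apply/leq_sizeP => j le_nj; rewrite [R]/(L - diffop_mul _ _) diffop_mulC.
    rewrite coefB coefZ; move: le_nj; rewrite leq_eqVlt => /predU1P[<-|lt_nj].
      have -> : (M : {poly F})`_n = lead_coef (M : {poly F}) by rewrite lead_coefE sM.
      rewrite mulVf; last by rewrite -invr_eq0.
      by have /monicP := L_monic; rewrite lead_coefE sL => ->; rewrite subrr.
    by rewrite !nth_default ?sM ?sL // mulr0 subrr.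
  by have := size_poly_gt0 (R : {poly F}); rewrite R0 /dop_order; lia.
(* The scalar [a] is absorbed into the first entry of [f], or into [f'] when [f] is empty. *)
rewrite /M in LM; clear fy sM M; case: f sf f0 LM => [|g f] sf f0 LM.
  have n0 : size ([::] : seq F) == n by rewrite sf.
  exists (Tuple n0), (a * f'); split=> //; first by rewrite mulf_neq0.
  rewrite LM /Lop !big_nil !mul1r [LHS]diffop_mulC /dopC -mul_polyC.
  by rewrite polyCM.
have sg : size (a * g :: f) == n by rewrite -sf.
move: f0 => /= /andP[g0 f0].
exists (Tuple sg), f'; split=> //=; first by rewrite mulf_neq0.
rewrite LM /Lop !big_cons !mulrA; congr (_ * _ * _ * _).
by rewrite [LHS]diffop_mulC /dopC -mul_polyC polyCM.
Qed.

(** The orbit of [der z] is used in place of that of [z]: an operator [Lop f * dopC f'] killing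
    [der z] becomes, after one more derivation, one of the form [Lop] with a nonempty list. *)
Lemma gen_iterated_of_unipotent (A : E -> Prop) z :
  diff_generated_by iota A ->
  (forall s : {rmorphism E -> E}, is_dgal iota s -> forall a, A a -> unip s a) ->
  PV_ring iota z -> gen_iterated_integral iota z.
Proof.
move=> genA uA [M [M0 Mz]].
pose X w := exists2 s : {rmorphism E -> E}, is_dgal iota s & w = s (der z).
have [|m [u [Xu indu spanu]]] := @maximal_indep_family _ _ iota X (dop_order M).
  move=> m u Xu indu.
  pose s i := sval (constructive_indefinite_description _ (
    let: ex_intro2 s sG us := Xu i in
    ex_intro (fun s : {rmorphism E -> E} => is_dgal iota s /\ u i = s (der z)) s (conj sG us))).
  have [sG us] : (forall i, is_dgal iota (s i)) /\ (forall i, u i = s i (der z)).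
    by split=> i; rewrite /s; case: constructive_indefinite_description => t [].
  apply: (@indep_solutions_bound _ _ _ iota_der _ M0 _ (fun i => s i z) nnc) => [c c0|i].
    apply: indu; have := congr1 der c0; rewrite der0 => dc0.
    rewrite -[RHS]dc0 raddf_sum; apply: eq_bigr => i _ /=.
    by rewrite der_cstM // us (dgal_der (sG i)).
  by rewrite (dgal_dop (sG i)) Mz rmorph0.
have su (s : {rmorphism E -> E}) : is_dgal iota s -> forall j, Cspan iota u (s (u j)).
  move=> sG j; apply: spanu; have [t tG ->] := Xu j.
  by exists (s \o t : {rmorphism E -> E}); first exact: dgal_comp.
have uu (s : {rmorphism E -> E}) : is_dgal iota s -> forall j, unip s (u j).
  move=> sG j; apply: (unip_stable_span sG _ closedC genA) => //; first exact: uA.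
  exact: su.
have [f [f' [sf f0 f'0 fu]]] := unipotent_factorization indu su uu.
exists (rcons f f'); split; rewrite ?size_rcons ?/nonzero_entries ?all_rcons ?f'0 //.
rewrite app_rcons // -dop_appC -dop_appM //.
have [|c ->] := spanu (der z).
  by exists (idfun : {rmorphism E -> E}); first exact: dgal_id.
by rewrite dop_app_lin // big1 // => i _; rewrite fu mulr0.
Qed.

End UnipotentFactorization.

(** * Cyclic vectors *)

Section CyclicVector.
Variables (F E : diffFieldType) (iota : {rmorphism F -> E}).
Hypothesis iota_der : diff_morphism iota.
Local Notation app := (dop_app iota).

Fixpoint Fspan (s : seq E) (z : E) : Prop :=
  if s is w :: s' then exists a, Fspan s' (z - iota a * w) else z = 0.

(** The derivative of each member lies in the span of the later ones. For a generalized iterated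
    integral, these are the integral and its successive integrands. *)
Fixpoint flag (s : seq E) : Prop :=
  if s is w :: s' then Fspan s' (der w) /\ flag s' else True.

Lemma Fspan0 s : Fspan s 0.
Proof. by elim: s => //= w s IHs; exists 0; rewrite rmorph0 mul0r subr0. Qed.

Lemma FspanD s y z : Fspan s y -> Fspan s z -> Fspan s (y + z).
Proof.
elim: s y z => [|w s IHs] y z /=; first by move=> -> ->; rewrite addr0.
move=> [a ya] [b zb]; exists (a + b); have := IHs _ _ ya zb.
by rewrite rmorphD mulrDl opprD addrACA.
Qed.

Lemma FspanZ s a z : Fspan s z -> Fspan s (iota a * z).
Proof.
elim: s z => [|w s IHs] z /=; first by move=> ->; rewrite mulr0.
by move=> [b zb]; exists (a * b); have := IHs _ zb; rewrite mulrBr rmorphM mulrA.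
Qed.

Lemma FspanN s z : Fspan s z -> Fspan s (- z).
Proof. by move/(FspanZ (-1)); rewrite rmorphN1 mulN1r. Qed.

Lemma FspanB s y z : Fspan s y -> Fspan s z -> Fspan s (y - z).
Proof. by move=> sy sz; apply/FspanD/FspanN. Qed.

Lemma Fspan_consr w s z : Fspan s z -> Fspan (w :: s) z.
Proof. by exists 0; rewrite rmorph0 mul0r subr0. Qed.

Lemma Fspan_head w s : Fspan (w :: s) w.
Proof. by exists 1; rewrite rmorph1 mul1r subrr; apply: Fspan0. Qed.

Lemma Fspan_catr s1 s2 z : Fspan s2 z -> Fspan (s1 ++ s2) z.
Proof. by elim: s1 => //= w s1 IHs /IHs; apply: Fspan_consr. Qed.

Lemma Fspan_catl s1 s2 z : Fspan s1 z -> Fspan (s1 ++ s2) z.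
Proof.
elim: s1 z => [|w s1 IHs] z /=; first by move=> ->; apply: Fspan0.
by move=> [a /IHs]; exists a.
Qed.

Lemma flag_cat s1 s2 : flag s1 -> flag s2 -> flag (s1 ++ s2).
Proof.
elim: s1 => //= w s1 IHs [dw fs1] fs2; split; last exact: IHs.
exact: Fspan_catl.
Qed.

Lemma Fspan_der s z : flag s -> Fspan s z -> Fspan s (der z).
Proof.
elim: s z => [|w s IHs] z; first by move=> _ /= ->; rewrite der0.
move=> [dw fs] [a za]; rewrite -(subrK (iota a * w) z) derD.
apply: FspanD; first by apply/Fspan_consr/IHs.
rewrite derM -iota_der; apply: FspanD; apply: FspanZ; first exact: Fspan_head.
exact: Fspan_consr.
Qed.

Lemma Fspan_app s M z : flag s -> Fspan s z -> Fspan s (app M z).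
Proof.
move=> fs sz; rewrite /dop_app; elim/big_ind: _ => [|y t|i _]; [exact: Fspan0|exact: FspanD|].
by apply: FspanZ; elim: (nat_of_ord i) => //= k; apply: Fspan_der.
Qed.

(** As [der w] is in the span of [s], derivatives of [g w] fall on [g] alone modulo that span. *)
Lemma app_scale_head w s M g : flag (w :: s) ->
  Fspan s (app M (iota g * w) - iota (dop_app (idfun : {rmorphism F -> F}) M g) * w).
Proof.
move=> [dw fs]; rewrite /dop_app rmorph_sum mulr_suml -sumrB.
elim/big_ind: _ => [|y t|i _]; [exact: Fspan0 | exact: FspanD |].
rewrite rmorphM -mulrA -mulrBr; apply: FspanZ.
elim: (nat_of_ord i) => [|k /(Fspan_der fs)] /=; first by rewrite subrr; apply: Fspan0.
move=> sk; have := FspanD sk (FspanZ (iter k der g) dw).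
by rewrite derB derM iota_der opprD addrA subrK.
Qed.

Section Cyclic.
Variable x : F.
Hypotheses (x_der : der x = 1) (charF : [pchar F] =i pred0).

Lemma iter_der_exp i k : iter i der (x ^+ k) = x ^+ (k - i) *+ (k ^_ i).
Proof.
have der_exp m : der (x ^+ m) = x ^+ m.-1 *+ m.
  elim: m => [|m IHm]; first by rewrite expr0 der1 mulr0n.
  rewrite exprS derM x_der mul1r IHm /= mulrS; case: m {IHm} => [|m] /=.
    by rewrite !mulr0n mulr0.
  by rewrite mulrnAr -exprS.
elim: i => [|i IHi]; first by rewrite subn0 ffactn0.
by rewrite /= IHi raddfMn /= der_exp -mulrnA ffactnSr mulnC subnS.
Qed.

(** For the least [k] with a nonzero coefficient, only the [k]-th term survives on [x ^+ k], with
    value [k!] times that coefficient. *)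
Lemma dop_app_neq0 (M : {diffop F}) : M != 0 ->
  exists g : F, dop_app (idfun : {rmorphism F -> F}) M g != 0.
Proof.
move=> M0; have exi : exists i, (M : {poly F})`_i != 0.
  by exists (size (M : {poly F})).-1; rewrite -lead_coefE lead_coef_eq0.
case: (ex_minnP exi) => k Mk mink; exists (x ^+ k); rewrite /dop_app /=.
have lt_k : (k < size (M : {poly F}))%N.
  by rewrite ltnNge; apply: contra Mk => /leq_sizeP/(_ k (leqnn k))->.
rewrite (bigD1 (Ordinal lt_k)) //= big1 => [|i ik].
  rewrite addr0 iter_der_exp subnn ffactnn mulf_neq0 //.
  by move/pcharf0P: charF => ->; rewrite -lt0n fact_gt0.
rewrite iter_der_exp; have [lt_ik|] := ltnP i k.
  have [->|/mink] := eqVneq (M : {poly F})`_i 0; first by rewrite mul0r.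
  by rewrite leqNgt lt_ik.
rewrite leq_eqVlt => /predU1P[ki|lt_ki]; first by case/eqP: ik; apply: val_inj.
by rewrite ffact_small // mulr0n mulr0.
Qed.

(** Modulo the span of [s], [eta] is killed by a nonzero operator and operators over [F] recover
    every member of [t] from it. *)
Definition cyclic_mod (s t : seq E) eta :=
  (exists2 N : {diffop F}, N != 0 & Fspan s (app N eta)) /\
  (forall w, w \in t -> exists N, Fspan s (app N eta - w)).

(** If the [w]-coordinate of [N eta] vanishes, adding [g w] with [N g] nonzero makes it nonzero and
    changes nothing modulo [w :: s]. Normalized, [N] then recovers [w] modulo [s]; deriving once
    more lands in the span of [s], and multiples of [N] correct the operators for [t]. *)
Lemma cyclic_mod_step w s t eta : flag (w :: s) ->
  cyclic_mod (w :: s) t eta -> exists eta', cyclic_mod s (w :: t) eta'.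
Proof.
move=> fws [[N N0 [b Nb]] Nt]; have [dw fs] := fws.
have [eta1 [b1 [b10 Nb1 Nt1]]] : exists eta1 b1, [/\ b1 != 0,
    Fspan s (app N eta1 - iota b1 * w) &
    forall v, v \in t -> exists N, Fspan (w :: s) (app N eta1 - v)].
  have [b0|b0] := eqVneq b 0; last by exists eta, b.
  have [g g0] := dop_app_neq0 N0; exists (eta + iota g * w).
  have appD M z1 z2 : app M (z1 + z2) = app M z1 + app M z2.
    rewrite /dop_app -big_split; apply: eq_bigr => i _.
    by rewrite (iter_derD i) mulrDr.
  exists (dop_app (idfun : {rmorphism F -> F}) N g); split=> //.
    rewrite appD -addrA; apply: FspanD; last exact: app_scale_head.
    by move: Nb; rewrite b0 rmorph0 mul0r subr0.
  move=> v /Nt[N' N'v]; exists N'; rewrite appD addrAC; apply: FspanD => //.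
  by apply: Fspan_app => //; apply: FspanZ; apply: Fspan_head.
pose N1 := dopC b1^-1 * N.
have N1w : Fspan s (app N1 eta1 - w).
  have := FspanZ b1^-1 Nb1; rewrite mulrBr mulrA -rmorphM mulVf // rmorph1 mul1r.
  by rewrite /N1 dop_appM // dop_appC.
have N10 : N1 != 0 by rewrite /N1 [_ * N]diffop_mulC scaler_eq0 invr_eq0 (negPf b10).
exists eta1; split.
  exists (dop_der F * N1).
    rewrite [_ * N1]diffop_mulX -size_poly_gt0 /dmul size_polyDl size_mulX //.
    by rewrite ltnS size_poly.
  rewrite dop_appM // dop_app_der -(subrK w (app N1 eta1)) derD.
  by apply: FspanD => //; apply: Fspan_der.
move=> v; rewrite inE => /predU1P[->|/Nt1[N' [c N'c]]]; first by exists N1.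
exists (N' - dopC c * N1); rewrite dop_appD appN // dop_appM // dop_appC.
have := FspanB N'c (FspanZ c N1w); rewrite mulrBr opprB addrA.
by rewrite subrK addrAC.
Qed.

Lemma cyclic_vector s : flag s -> exists eta,
  PV_ring iota eta /\ forall w, w \in s -> exists N, w = app N eta.
Proof.
move=> fs.
have reach r t eta : flag r -> cyclic_mod r t eta ->
    exists eta', cyclic_mod [::] (catrev r t) eta'.
  elim: r t eta => [|w r IHr] t eta; first by exists eta.
  move=> fwr /(cyclic_mod_step fwr)[eta']; apply: IHr.
  by case: fwr.
have [|eta [[N N0 N_eta] cyc]] := reach s [::] 0 fs.
  split=> //; exists 1; first exact: oner_neq0.
  by rewrite dop_app0r //; apply: Fspan0.
exists eta; split; first by exists N.
move=> w; rewrite -mem_rev => /cyc[N' /eqP]; rewrite subr_eq0 => /eqP <-.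
by exists N'.
Qed.

Lemma diff_generated_app (S : E -> Prop) (M : {diffop F}) z :
  [/\ forall a, S (iota a), forall x y, S x -> S y -> S (x - y),
      forall x y, S x -> S y -> S (x * y), forall x, S x -> S x^-1
    & forall x, S x -> S (der x)] -> S z -> S (app M z).
Proof.
move=> [Si SB SM _ SD] Sz.
have S0 : S 0 by rewrite -(rmorph0 iota).
rewrite /dop_app; elim/big_ind: _ => [//|a b Sa Sb|i _].
  by rewrite -[b]opprK -[- b]sub0r; apply: (SB) => //; apply: SB.
by apply: (SM) => //; elim: (nat_of_ord i) => //= k; apply: SD.
Qed.

Lemma gen_iterated_flag z : gen_iterated_integral iota z ->
  exists2 s, flag s & Fspan s z.
Proof.
move=> [f [_ f0 fz]]; elim/last_ind: f z f0 fz => [|f g IHf] z.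
  by move=> _; rewrite app_nil // => ->; exists [::].
rewrite /nonzero_entries all_rcons app_rcons // => /andP[g0 f0] /(IHf _ f0)[s fs sz].
exists (z :: s); last exact: Fspan_head.
split=> //; have := FspanZ g^-1 sz.
by rewrite mulrA -rmorphM mulVf // rmorph1 mul1r.
Qed.

Lemma gen_iterated_primitive_element n (y : 'I_n -> E) :
  diff_generated_by iota (fun z => exists i, z = y i) ->
  (forall i, gen_iterated_integral iota (y i)) ->
  exists2 eta, PV_ring iota eta & diff_generated_by iota (fun z => z = eta).
Proof.
move=> geny yI; have [s fs sy] : exists2 s, flag s & forall i, Fspan s (y i).
  suff [s fs sy] : exists2 s, flag s & forall i, i \in enum 'I_n -> Fspan s (y i).
    by exists s => // i; apply: sy; rewrite mem_enum.
  elim: (enum 'I_n) => [|i r [s fs sy]]; first by exists [::].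
  have [s' fs' s'y] := gen_iterated_flag (yI i); exists (s' ++ s); first exact: flag_cat.
  move=> j; rewrite inE => /predU1P[->|/sy]; first exact: Fspan_catl.
  exact: Fspan_catr.
have [eta [eta_PV eta_s]] := cyclic_vector fs.
exists eta => // S Sclosed Seta; apply: geny => // _ [i ->].
have [Si SB SM _ _] := Sclosed.
have Ss w : w \in s -> S w.
  by move=> /eta_s[N ->]; apply: diff_generated_app => //; apply: Seta.
move: (y i) (sy i) Ss => z sz Ss; clear eta_s sy fs.
elim: s z sz Ss => [|w s IHs] z /=.
  by move=> -> _; rewrite -(rmorph0 iota).
move=> [a /IHs Sz] Ss.
have Sw : S (iota a * w) by apply: (SM) => //; apply: Ss; rewrite mem_head.
have -> : z = (z - iota a * w) - (0 - iota a * w) by ring.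
apply: (SB); first by apply: Sz => v sv; apply: Ss; rewrite inE sv orbT.
by apply: (SB) => //; rewrite -(rmorph0 iota).
Qed.

End Cyclic.
End CyclicVector.

(** * Nested integrals *)

Lemma fun_choice (A B : Type) (P : A -> B -> Prop) :
  (forall a, exists b, P a b) -> exists f : A -> B, forall a, P a (f a).
Proof.
move=> PE; exists (fun a => sval (constructive_indefinite_description _ (PE a))) => a.
exact: svalP (constructive_indefinite_description _ (PE a)).
Qed.

Section NestedBasis.
Variables (F E : diffFieldType) (iota : {rmorphism F -> E}).
Hypothesis iota_der : diff_morphism iota.
Local Notation C := (constants F).
Local Notation cst := (cst iota).
Local Notation app := (dop_app iota).
Hypothesis nnc : no_new_constants iota.

Lemma indep_Cspan_bound m k (u : 'I_m -> E) (t : 'I_k -> E) :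
  lin_indep iota u -> (forall i, Cspan iota t (u i)) -> (m <= k)%N.
Proof.
move=> indu ut; rewrite leqNgt; apply/negP => lt_km.
pose b i := sval (constructive_indefinite_description _ (ut i)).
have uE i : u i = \sum_j cst (b i j) * t j.
  exact: svalP (constructive_indefinite_description _ (ut i)).
pose B := \matrix_(i, j) b i j.
have /rowV0Pn[e /sub_kermxP eB] : kermx B != 0.
  by rewrite -mxrank_eq0 mxrank_ker subn_eq0 -ltnNge (leq_ltn_trans _ lt_km) ?rank_leq_col.
case/eqP; apply/rowP => i; rewrite mxE; move: i; apply: indu.
under eq_bigr do rewrite uE mulr_sumr.
rewrite exchange_big big1 //= => j _.
transitivity (cst ((e *m B) 0 j) * t j); last by rewrite eB mxE rmorph0 mul0r.
rewrite mxE rmorph_sum mulr_suml; apply: eq_bigr => i _.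
by rewrite mxE rmorphM mulrA.
Qed.

Lemma Lop_neq0 (f : seq F) : nonzero_entries f -> Lop f != 0.
Proof. by move=> f0; rewrite -size_poly_gt0 size_Lop. Qed.

Lemma order_Lop (f : seq F) : nonzero_entries f -> dop_order (Lop f) = size f.
Proof. by move=> f0; rewrite /dop_order size_Lop. Qed.

(* [z |-> a z'] maps the solution space of [Lop (rev (a :: g))], with kernel
   the constants, into that of [Lop (rev g)]; counting dimensions it is onto. *)
Lemma nested_solutions (g : seq F) (u : 'I_(size g) -> E) :
  nonzero_entries g -> lin_indep iota u -> (forall i, app (Lop (rev g)) (u i) = 0) ->
  exists z : 'I_(size g) -> E, [/\ lin_indep iota z,
    forall i : 'I_(size g), nested_integral iota (take i g) (z i) &
    forall i, app (Lop (rev g)) (z i) = 0].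
Proof.
elim: g u => [|a g IHg] u /=.
  by move=> _ _ _; exists u; split=> [c _||]; case.
move=> /andP[a0 g0] indu; rewrite rev_cons => su.
have ia0 : iota a != 0 by rewrite fmorph_eq0.
have rg0 : nonzero_entries (rev g) by rewrite /nonzero_entries all_rev.
have og : dop_order (Lop (rev g)) = size g by rewrite order_Lop ?size_rev.
pose X w := exists2 t, app (Lop (rcons (rev g) a)) t = 0 & w = iota a * der t.
have XL w : X w -> app (Lop (rev g)) w = 0.
  by move=> [t st ->]; rewrite -app_rcons.
have [|m [w [Xw indw spanw]]] := @maximal_indep_family _ _ iota X (size g).
  move=> m w Xw indw; rewrite -og.
  apply: (indep_solutions_bound iota_der (Lop_neq0 rg0) nnc indw) => i.
  exact: XL.
have tw0 i : exists t, app (Lop (rcons (rev g) a)) t = 0 /\ w i = iota a * der t.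
  by have [t st wt] := Xw i; exists t.
have [t tw] := fun_choice tw0.
have le_m : (m <= size g)%N.
  rewrite -og; apply: (indep_solutions_bound iota_der (Lop_neq0 rg0) nnc indw) => i.
  exact: XL.
have Du (v : E) : app (Lop (rcons (rev g) a)) v = 0 ->
    exists c (e : 'I_m -> C), v = cst c + \sum_i cst (e i) * t i.
  move=> sv; have [|e De] := spanw (iota a * der v); first by exists v.
  have /(const_cst iota_der nnc)[c Dc] : der (v - \sum_i cst (e i) * t i) = 0.
    rewrite derB (raddf_sum der) /=; apply: (mulfI ia0); rewrite mulr0 mulrBr De mulr_sumr.
    apply/eqP; rewrite subr_eq0; apply/eqP/eq_bigr => i _.
    by rewrite (tw i).2 der_cstM // mulrCA.
  by exists c, e; rewrite -Dc subrK.
have ge_m : (size g <= m)%N.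
  (* Every solution is a constant plus a combination of the [t], so [(size g).+1] independent ones
     lie in a span of [m.+1] elements. *)
  rewrite -ltnS; apply: (@indep_Cspan_bound _ _ u (extend t 1) indu) => i.
  have [c [e ->]] := Du _ (su i); exists (fun j => if unlift ord0 j is Some k then e k else c).
  rewrite big_ord_recl extend0 unlift_none mulr1; congr (_ + _).
  by apply: eq_bigr => j _; rewrite extend_lift liftK.
have Dm : m = size g by apply/eqP; rewrite eqn_leq le_m.
subst m.
have [z [indz nz sz]] := IHg w g0 indw (fun i => XL _ (Xw i)).
have w_basis : solution_basis iota (Lop (rev g)) w.
  apply: solution_basis_of_indep => //; [exact: Lop_neq0 | by move=> i; apply: XL].
have sE0 j : exists s, app (Lop (rcons (rev g) a)) s = 0 /\ iota a * der s = z j.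
  have [_ _ /(_ _ (sz j))[e De]] := w_basis.
  exists (\sum_i cst (e i) * t i); split.
    by rewrite dop_app_lin // big1 // => i _; rewrite (tw i).1 mulr0.
  rewrite (raddf_sum der) mulr_sumr De; apply: eq_bigr => i _ /=.
  by rewrite der_cstM // (tw i).2 mulrCA.
have [s sE] := fun_choice sE0.
exists (extend s 1); split=> [c|i|i].
- rewrite big_ord_recl extend0 mulr1; under eq_bigr do rewrite extend_lift.
  move=> c0; have cl j : c (lift ord0 j) = 0.
    move: j; apply: indz; have := congr1 der c0.
    rewrite derD der_cst // add0r der0 (raddf_sum der) /= => dc0.
    transitivity (iota a * \sum_j der (cst (c (lift ord0 j)) * s j)).
      rewrite mulr_sumr; apply: eq_bigr => j _.
      by rewrite der_cstM // -(sE j).2 mulrCA.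
    by rewrite dc0 mulr0.
  move: c0; rewrite big1 ?addr0 => [/eqP|j _]; last by rewrite cl rmorph0 mul0r.
  rewrite fmorph_eq0 => /eqP c0 i.
  by case: (unliftP ord0 i) => [j|] ->.
- case: (unliftP ord0 i) => [j|] ->; last by rewrite extend0.
  rewrite extend_lift /=; exists (z j); split; first exact: nz.
  by rewrite -(sE j).2 mulKf.
case: (unliftP ord0 i) => [j|] ->; rewrite ?extend0 ?extend_lift ?(sE j).1 //.
by rewrite app_rcons // der1 mulr0 dop_app0r.
Qed.

Lemma nested_solutions_size n (g : seq F) (u : 'I_n -> E) :
  size g = n -> nonzero_entries g -> lin_indep iota u ->
  (forall i, app (Lop (rev g)) (u i) = 0) ->
  exists z : 'I_n -> E, [/\ lin_indep iota z,
    forall i : 'I_n, nested_integral iota (take i g) (z i) &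
    forall i, app (Lop (rev g)) (z i) = 0].
Proof. by move=> sg; case: n / sg u; apply: nested_solutions. Qed.

(** Multiplication by [f'] carries solutions of [L] to solutions of [Lop f]. The list is reversed
    because the last entry of [f] acts first, hence gives the outermost integral. *)
Lemma nested_basis n (L : {diffop F}) (y : 'I_n -> E) (f : n.-tuple F) (f' : F) :
  dop_order L = n -> L != 0 -> solution_basis iota L y ->
  nonzero_entries f -> f' != 0 -> L = Lop f * dopC f' ->
  exists v : 'I_n -> E, solution_basis iota L v /\
    forall i : 'I_n, exists z : E,
      nested_integral iota (take i (rev f)) z /\ v i = (iota f')^-1 * z.
Proof.
move=> oL L0 [y_sol y_indep _] f0 f'0 DL.
have if'0 : iota f' != 0 by rewrite fmorph_eq0.
have indfy : lin_indep iota (fun i => iota f' * y i).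
  move=> c c0; apply: y_indep; apply: (mulfI if'0); rewrite mulr0 -[RHS]c0 mulr_sumr.
  by apply: eq_bigr => i _; rewrite mulrCA.
have sfy i : app (Lop f) (iota f' * y i) = 0.
  by rewrite -dop_appC -dop_appM // -DL y_sol.
have [|||z [indz nz]] := @nested_solutions_size n (rev f) _ _ _ indfy; rewrite ?revK //.
- by rewrite size_rev size_tuple.
- by rewrite /nonzero_entries all_rev.
move=> sz; exists (fun i => (iota f')^-1 * z i); split; last by move=> i; exists (z i).
apply: solution_basis_of_indep => // [c c0|i].
  apply: indz; apply: (mulfI (invr_neq0 if'0)); rewrite mulr0 -[RHS]c0 mulr_sumr.
  by apply: eq_bigr => i _; rewrite mulrCA.
by rewrite DL dop_appM // dop_appC mulVKf.
Qed.

Lemma picard_vessiot_of_basis m (M : {diffop F}) (v : 'I_m -> E) :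
  M != 0 -> dop_order M = m -> solution_basis iota M v ->
  diff_generated_by iota (fun z => exists i, z = v i) -> picard_vessiot iota M.
Proof. by move=> M0 oM vM genv; subst m; split=> //; exists v. Qed.

Lemma picard_vessiot_Lop n (L : {diffop F}) (y : 'I_n -> E) (f : n.-tuple F) (f' : F) :
  solution_basis iota L y -> diff_generated_by iota (fun z => exists i, z = y i) ->
  nonzero_entries f -> f' != 0 -> L = Lop f * dopC f' ->
  exists (l : nat) (g : l.-tuple F),
    [/\ (0 < l)%N, nonzero_entries g & picard_vessiot iota (Lop g)].
Proof.
move=> [y_sol y_indep _] geny f0 f'0 DL; case: (posnP n) => [n0|n_gt0].
  (* For [n = 0] the field [E] is the image of [F]; as the list must be nonempty, the operator is
     the derivation, with solution 1. *)
  exists 1%N, [tuple 1]; have nz : nonzero_entries [:: 1 : F] by rewrite /= oner_neq0.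
  split=> //; apply: (@picard_vessiot_of_basis 1 _ (fun _ => 1)).
  - exact: Lop_neq0.
  - by rewrite order_Lop.
  - apply: solution_basis_of_indep => //; [exact: Lop_neq0 | by rewrite order_Lop | |].
      move=> c; rewrite big_ord1 mulr1 => /eqP; rewrite fmorph_eq0 => /eqP c0 i.
      by rewrite ord1.
    by move=> i; rewrite app_cons // app_nil // der1 mulr0.
  move=> S Sclosed _; apply: geny => // _ [i ->].
  by have := ltn_ord i; rewrite {2}n0.
have if'0 : iota f' != 0 by rewrite fmorph_eq0.
exists n, f; split=> //.
apply: (@picard_vessiot_of_basis n _ (fun i => iota f' * y i)).
- exact: Lop_neq0.
- by rewrite order_Lop ?size_tuple.
- apply: solution_basis_of_indep => //; [exact: Lop_neq0 | by rewrite order_Lop ?size_tuple | |].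
    move=> c c0; apply: y_indep; apply: (mulfI if'0); rewrite mulr0 -[RHS]c0 mulr_sumr.
    by apply: eq_bigr => i _; rewrite mulrCA.
  by move=> i; rewrite -dop_appC -dop_appM // -DL.
move=> S Sclosed Sv; apply: geny => // _ [i ->].
have [Si _ SM _ _] := Sclosed.
rewrite -(mulKf if'0 (y i)); apply: (SM); last by apply: Sv; exists i.
by rewrite -fmorphV; apply: Si.
Qed.

End NestedBasis.

(** * Unipotent action on the solutions *)

Section UnipotentEquivalences.
Variables (F E : diffFieldType) (iota : {rmorphism F -> E}).
Hypothesis iota_der : diff_morphism iota.
Local Notation C := (constants F).
Local Notation cst := (cst iota).
Local Notation app := (dop_app iota).
Hypothesis nnc : no_new_constants iota.
Hypotheses (closedC : GRing.closed_field_axiom C) (charF : [pchar F] =i pred0).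
Variables (n : nat) (L : {diffop F}) (y : 'I_n -> E).
Hypotheses (L_monic : monic_op L) (L_order : dop_order L = n).
Hypothesis y_basis : solution_basis iota L y.
Hypothesis y_gen : diff_generated_by iota (fun z => exists i, z = y i).

Let L_neq0 : L != 0. Proof. exact: monic_neq0. Qed.

Definition acts_unipotently :=
  forall s : {rmorphism E -> E}, is_dgal iota s -> forall i, unip s (y i).

Lemma fixed_base z : (forall s : {rmorphism E -> E}, is_dgal iota s -> s z = z) ->
  exists a, z = iota a.
Proof. exact: (dgal_fixed_base iota_der nnc L_neq0 L_order y_basis y_gen). Qed.

Lemma acts_unipotentlyP : acts_unipotently <->
  (forall A, dgal_mx iota y A -> unipotent_mx A).
Proof.
have [y_sol y_indep y_span] := y_basis; split=> [uy A [s sG sA]|uA s sG].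
  suff [k Ak] : unipotent_mx A^T.
    exists k; apply: trmx_inj; rewrite -trmx_exp trmx0 -Ak.
    by rewrite raddfB /= trmx1.
  apply/(unip_matrix sG y_indep (B := A^T)) => [j|j]; last exact: uy.
  by rewrite sA; apply: eq_bigr => i _; rewrite mxE.
have [A sA] := dgal_matrix y_basis sG.
apply/(unip_matrix sG y_indep (B := A^T)) => [j|].
  by rewrite sA; apply: eq_bigr => i _; rewrite mxE.
have [k Ak] := uA A (ex_intro2 _ _ s sG sA); exists k.
by rewrite -(trmx1 C n) -raddfB trmx_exp Ak trmx0.
Qed.

Lemma unipotent_groupP : acts_unipotently <-> unipotent_group (dgal_mx iota y).
Proof.
split=> [/acts_unipotentlyP uA|[_ /acts_unipotentlyP//]]; split=> //.
exact: (dgal_linear_algebraic_group iota_der nnc L_neq0 L_order y_basis y_gen).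
Qed.

Lemma acts_unipotently_of_primitive eta : gen_iterated_integral iota eta ->
  diff_generated_by iota (fun z => z = eta) -> acts_unipotently.
Proof.
move=> [f [_ f0 feta]] geneta s sG j.
have [y_sol y_indep y_span] := y_basis.
apply: (unip_stable_span sG _ closedC geneta _ y_indep) => [_ ->|i].
  exact: Lop_unip feta sG.
by apply: y_span; rewrite (dgal_dop sG) y_sol rmorph0.
Qed.

Lemma acts_unipotently_of_factor (f : n.-tuple F) f' :
  nonzero_entries f -> f' != 0 -> L = Lop f * dopC f' -> acts_unipotently.
Proof.
move=> f0 f'0 DL s sG i; have [y_sol _ _] := y_basis.
have if'0 : iota f' != 0 by rewrite fmorph_eq0.
rewrite -(mulKf if'0 (y i)); apply: unipM.
  by apply: unip_fixed; rewrite fmorphV (dgal_base sG).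
apply: (Lop_unip iota_der nnc f0 _ sG).
by rewrite -dop_appC -dop_appM // -DL.
Qed.

Lemma gen_iterated_of_acts z : acts_unipotently ->
  PV_ring iota z <-> gen_iterated_integral iota z.
Proof.
move=> uy; split; last exact: gen_iterated_PV.
apply: (gen_iterated_of_unipotent iota_der nnc closedC charF fixed_base y_gen).
by move=> s sG _ [i ->]; apply: uy.
Qed.

Lemma factor_of_acts : acts_unipotently -> exists (f : n.-tuple F) (f' : F),
  [/\ nonzero_entries f, f' != 0 & L = Lop f * dopC f'].
Proof.
exact: (factor_of_unipotent iota_der nnc closedC charF fixed_base L_monic L_order y_basis).
Qed.

End UnipotentEquivalences.

(** * Transport of unipotence *)

Section UnipotentTransport.
Variable K : fieldType.
Hypotheses (closedK : GRing.closed_field_axiom K) (charK : [pchar K] =i pred0).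

Lemma poly_nat_roots (p : {poly K}) : (forall k, p.[k.+1%:R] = 0) -> p = 0.
Proof.
move=> p0; apply/eqP; apply: contraT => pN0.
have := max_poly_roots (p := p) (rs := [seq k.+1%:R | k <- iota 0 (size p)]) pN0.
rewrite size_map size_iota ltnn; apply.
  by apply/allP => _ /mapP[k _ ->]; apply/rootP/p0.
rewrite map_inj_uniq ?iota_uniq // => i j /eqP.
wlog le_ij : i j / (i <= j)%N.
  by move=> IH; have [/IH//|/ltnW/IH IH' /eqP e] := leqP i j; apply/esym/IH'/eqP.
rewrite eq_sym -subr_eq0 -natrB ?ltnS // subSS.
by move/pcharf0P: charK => ->; rewrite subn_eq0 => le_ji; apply/eqP; rewrite eqn_leq le_ij.
Qed.

(** The polynomials [g(X + 1)] and [a g(X)] agree at infinitely many points; their leading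
    coefficients give [a = 1]. *)
Lemma exp_polynomial (a : K) (g : {poly K}) :
  a != 0 -> (forall k, g.[k.+1%:R] = a ^+ k.+1) -> a = 1.
Proof.
move=> a0 gE.
have g0 : g != 0.
  by apply: contraNneq a0 => g0; have := gE 0%N; rewrite g0 horner0 expr1 => <-.
have e : g \Po ('X + 1%:P) = a *: g.
  apply/eqP; rewrite -subr_eq0; apply/eqP/poly_nat_roots => k.
  rewrite hornerD hornerN hornerZ horner_comp hornerD hornerX hornerC natr1 !gE.
  by rewrite -exprS subrr.
have := congr1 lead_coef e; rewrite lead_coef_comp ?size_XaddC // lead_coefXaddC.
rewrite expr1n mulr1 lead_coefZ -{1}[lead_coef g]mul1r.
by move/(mulIf (_ : lead_coef g != 0)); rewrite lead_coef_eq0 => /(_ g0).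
Qed.

Definition bin_poly j : {poly K} := (j`!%:R)^-1 *: \prod_(i < j) ('X - (i%:R)%:P).

Lemma horner_bin_poly j k : (bin_poly j).[k%:R] = 'C(k, j)%:R.
Proof.
have fact0 : j`!%:R != 0 :> K by move/pcharf0P: charK => ->; rewrite -lt0n fact_gt0.
rewrite /bin_poly hornerZ; apply: (mulfI fact0); rewrite mulVKf // -natrM mulnC bin_ffact.
rewrite horner_prod; elim: j {fact0} => [|j IHj]; first by rewrite big_ord0 ffactn0.
rewrite big_ord_recr /= IHj !hornerE ffactnSr natrM.
have [le_jk|lt_kj] := leqP j k; first by rewrite natrB.
by rewrite ffact_small // !mul0r.
Qed.

Lemma det_unipotent m (B : 'M[K]_m) : unipotent_mx B -> \det B = 1.
Proof.
move=> uB; have := char_poly_det B; rewrite (char_poly_unipotent closedK uB).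
rewrite -horner_coef0 horner_exp !hornerE => e.
by apply: (mulfI (expf_neq0 m (_ : -1 != 0))); rewrite ?oppr_eq0 ?oner_neq0 // -e mulr1.
Qed.

Lemma unipotent_powers m (B : 'M[K]_m) (p : {mpoly K[m * m]}) : unipotent_mx B ->
  exists P : {poly K}, forall k, mx_eval p (B ^+ k) = P.[k%:R].
Proof.
move=> [d Bd]; pose N := B - 1%:M.
pose X := \sum_(j < d) bin_poly j *: map_mx polyC (N ^+ j).
exists (mxsubst polyC X p) => k.
rewrite -[RHS]/(horner_eval k%:R _) (@mxsubst_comp _ _ _ _ _ _ idfun); last first.
  by move=> r; rewrite /= /horner_eval hornerC.
rewrite /mx_eval /meval -/(mxsubst idfun _ p); congr mxsubst.
have -> : B ^+ k = \sum_(j < d) 'C(k, j)%:R *: N ^+ j.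
  have -> : B = N + 1 by rewrite subrK.
  (* The binomial expansion ends at [k], while the wanted sum ends at the nilpotency index [d]; both
     are padded with zeros to a common length. *)
  pose D := maxn d k.+1.
  have N0 j : (d <= j)%N -> N ^+ j = 0.
    by move=> le_dj; rewrite -(subnK le_dj) exprD Bd mulr0.
  rewrite exprD1n (big_ord_widen D (fun j => N ^+ j *+ 'C(k, j))) ?leq_maxr //.
  rewrite (big_ord_widen D (fun j => 'C(k, j)%:R *: N ^+ j)) ?leq_maxl //.
  rewrite big_mkcond [RHS]big_mkcond; apply: eq_bigr => j _.
  rewrite scaler_nat; case: (ltnP j k.+1) => [_|lt_kj]; case: (ltnP j d) => [_|le_dj] //.
    by rewrite N0 // mul0rn.
  by rewrite bin_small.
apply/matrixP => i j; rewrite summxE [RHS]mxE summxE [RHS]horner_sum.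
by apply: eq_bigr => l _; rewrite !mxE hornerM hornerC horner_bin_poly.
Qed.

(** Powers of [B] have determinant 1, so the denominators of [psi] disappear along them and the
    entries of powers of [A] are polynomial in the exponent. For an eigenvalue [a] of [A], the
    powers of [a] are then polynomial too. *)
Lemma alg_group_iso_unipotent n m (G : 'M[K]_n -> Prop) (H : 'M[K]_m -> Prop) :
  linear_algebraic_group G -> alg_group_iso G H -> unipotent_group H ->
  forall A, G A -> unipotent_mx A.
Proof.
move=> [[I GE] G1 GM GV] [phi [psi [phiG psiH phiM _ psi_reg]]] [_ uH] A GA.
have uA : A \in unitmx by case: (GE A) => /(_ GA)[].
pose B := phi A; have HB : H B by case: (phiG A GA).
have GX k : G (A ^+ k) by elim: k => [|k IHk] //; rewrite exprS; apply: GM.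
have phiX k : phi (A ^+ k.+1) = B ^+ k.+1.
  elim: k => [|k IHk]; first by rewrite !expr1.
  by rewrite exprS phiM // IHk [RHS]exprS.
have HX k : H (B ^+ k.+1) by rewrite -phiX; case: (phiG _ (GX k.+1)).
have psiX k : psi (B ^+ k.+1) = A ^+ k.+1 by rewrite -phiX; case: (phiG _ (GX k.+1)).
have [Q QE] : exists Q : 'I_n -> 'I_n -> {poly K}, forall i j k,
    (A ^+ k.+1) i j = (Q i j).[k.+1%:R].
  have ex i j : exists P : {poly K}, forall k, (A ^+ k.+1) i j = P.[k.+1%:R].
    have [p [e pE]] := psi_reg i j; have [P PE] := unipotent_powers p (uH B HB).
    exists P => k; rewrite -PE -psiX pE //.
    have -> : \det (B ^+ k.+1) = 1.
      elim: k => [|k IHk]; first by rewrite expr1 det_unipotent //; apply: uH.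
      by rewrite exprS -mulmxE det_mulmx IHk det_unipotent ?mulr1 //; apply: uH.
    by rewrite expr1n divr1.
  have [Q QE] := fun_choice (fun i => fun_choice (ex i)).
  by exists Q => i j k; apply: QE.
apply: unipotent_single_eigenvalue => // a v v0 vA.
have [j vj] : exists j, v 0 j != 0.
  apply: NNPP => Nj; case/eqP: v0; apply/rowP => j; rewrite mxE.
  by apply: NNPP => /eqP vj; apply: Nj; exists j.
have a0 : a != 0.
  apply: contraNneq v0 => a0; rewrite -(mulmxK uA v) vA a0 scale0r mul0mx.
  by rewrite eqxx.
pose g := (v 0 j)^-1 *: \sum_i v 0 i *: Q i j.
apply: (exp_polynomial (g := g)) => // k; rewrite hornerZ horner_sum.
have /rowP/(_ j) := mulmx_iter_eigen k.+1 vA; rewrite mxE [RHS]mxE => e.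
apply: (mulfI vj); rewrite mulVKf // [RHS]mulrC -e; apply: eq_bigr => i _.
by rewrite hornerZ QE.
Qed.

Lemma alg_group_iso_commutative n m (G : 'M[K]_n -> Prop) (H : 'M[K]_m -> Prop) :
  linear_algebraic_group G -> alg_group_iso G H -> commutative_group H ->
  commutative_group G.
Proof.
move=> [_ _ GM _] [phi [psi [phiG _ phiM _ _]]] comH A B GA GB.
have [_ <-] := phiG _ (GM A B GA GB); have [_ <-] := phiG _ (GM B A GB GA).
rewrite !phiM // comH //; first by case: (phiG A GA).
by case: (phiG B GB).
Qed.

End UnipotentTransport.

Section Commuting.
Variables (F E : diffFieldType) (iota : {rmorphism F -> E}).
Variables (T : Type) (act : T -> {rmorphism E -> E}).
Local Notation D := (iter_diff act).
Hypothesis com : forall t u z, act t (act u z) = act u (act t z).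

Lemma fil_iter_diff k l s z : size s = k -> fil act (k + l) z -> fil act l (D s z).
Proof.
by move=> sk fz s' sl; rewrite -iter_diff_cat fz // size_cat sk sl.
Qed.

(* By the Leibniz rule, in a difference of order [k] of [w_i z_i] one factor
   [t - 1] falls on [w_i], in [k] possible ways, and the others on [z_i]. *)
Lemma iter_diff_symbol r (w : 'I_r -> E) (a : T -> 'I_r -> E) k z (zi : 'I_r -> E) s :
  (forall t i, act t (w i) - w i = a t i) -> (forall t u i, act u (a t i) = a t i) ->
  (forall i, fil act k (zi i)) ->
  (forall t s, (size s).+1 = k -> D s (act t z - z - \sum_i a t i * zi i) = 0) ->
  size s = k -> D s (\sum_i w i * zi i) = k%:R * D s z.
Proof.
move=> wa fa; elim: k z zi s => [|k IHk] z zi [|t s] //=.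
  move=> fz _ _; rewrite mul0r big1 // => i _.
  by have /fil0-> := fz i; rewrite mulr0.
move=> fz ez [sk].
have actw i : act t (w i) = w i + a t i by rewrite -(wa t i) addrC subrK.
have -> : act t (\sum_i w i * zi i) - \sum_i w i * zi i =
    \sum_i w i * (act t (zi i) - zi i) + \sum_i a t i * zi i +
    \sum_i a t i * (act t (zi i) - zi i).
  rewrite rmorph_sum -sumrB -!big_split; apply: eq_bigr => i _ /=.
  by rewrite rmorphM actw; ring.
have e0 : D s (\sum_i a t i * (act t (zi i) - zi i)) = 0.
  rewrite iter_diff_sum big1 // => i _; rewrite iter_diffM //.
  by rewrite ((filS act k (zi i)).1 (fz i) t s sk) mulr0.
rewrite (iter_diffD act s (_ + _)) e0 addr0 iter_diffD (IHk (act t z - z)) //; first last.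
- move=> u s' s'k; have /(_ (congr1 S s'k)) e := ez u (t :: s').
  rewrite -[RHS]e /=; congr (D s' _); rewrite !rmorphB rmorph_sum com /=.
  have -> : \sum_i act t (a u i * zi i) = \sum_i a u i * act t (zi i).
    by apply: eq_bigr => i _; rewrite rmorphM fa.
  have -> : \sum_i a u i * (act t (zi i) - zi i) =
      \sum_i a u i * act t (zi i) - \sum_i a u i * zi i.
    by rewrite -sumrB; apply: eq_bigr => i _; rewrite mulrBr.
  by ring.
- by move=> i; have /filS := fz i.
have -> : D s (\sum_i a t i * zi i) = D s (act t z - z).
  have := ez t s (congr1 S sk); set S := \sum_i a t i * zi i => e.
  by rewrite -[act t z - z](subrK S) [RHS]iter_diffD e add0r.
by rewrite -[in RHS]natr1 mulrDl mul1r.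
Qed.

End Commuting.

(** * Commuting unipotent actions *)

Section CommutativeUnipotent.
Variables (F E : diffFieldType) (iota : {rmorphism F -> E}).
Hypotheses (iota_der : diff_morphism iota) (nnc : no_new_constants iota).
Local Notation C := (constants F).
Local Notation cst := (cst iota).

Section OrbitFinite.
Variables (T : Type) (act : T -> {rmorphism E -> E}).
Hypothesis act_iota : forall t a, act t (iota a) = iota a.

(** The intersection of all [C]-subspaces containing [l]; stability under sums, products and the
    action is then proved without coefficients. *)
Definition gen_Cspan (l : seq E) (z : E) := forall S : E -> Prop,
  S 0 -> (forall x y, S x -> S y -> S (x + y)) -> (forall c x, S x -> S (cst c * x)) ->
  (forall u, u \in l -> S u) -> S z.

Lemma gen_Cspan_sub l m z : (forall u, u \in l -> gen_Cspan m u) ->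
  gen_Cspan l z -> gen_Cspan m z.
Proof. by move=> lm lz S S0 SD SZ Sm; apply: lz => // u /lm; apply. Qed.

Lemma gen_Cspan_mem l u : u \in l -> gen_Cspan l u.
Proof. by move=> lu S _ _ _; apply. Qed.

Lemma gen_CspanD l x y : gen_Cspan l x -> gen_Cspan l y -> gen_Cspan l (x + y).
Proof. by move=> lx ly S S0 SD SZ Sl; apply: (SD); [apply: lx | apply: ly]. Qed.

Lemma gen_CspanN l x : gen_Cspan l x -> gen_Cspan l (- x).
Proof.
move=> lx S S0 SD SZ Sl; have -> : - x = cst (- 1) * x by rewrite rmorphN1 mulN1r.
by apply: (SZ); apply: lx.
Qed.

Lemma gen_CspanM l m x y : gen_Cspan l x -> gen_Cspan m y ->
  gen_Cspan [seq u * v | u <- l, v <- m] (x * y).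
Proof.
move=> lx my S S0 SD SZ Slm; move: y my; apply: (lx (fun a => forall y, gen_Cspan m y -> S (a * y))).
- by move=> y _; rewrite mul0r.
- by move=> a b Sa Sb y my; rewrite mulrDl; apply: (SD); [apply: Sa | apply: Sb].
- by move=> c a Sa y my; rewrite -mulrA; apply: (SZ); apply: Sa.
move=> u lu y my; apply: (my (fun b => S (u * b))); first by rewrite mulr0.
- by move=> a b Sa Sb; rewrite mulrDr; apply: SD.
- by move=> c a Sa; rewrite mulrCA; apply: SZ.
by move=> v mv; apply: Slm; apply/allpairsP; exists (u, v).
Qed.

Lemma gen_Cspan_act l t z : (forall u, u \in l -> gen_Cspan l (act t u)) ->
  gen_Cspan l z -> gen_Cspan l (act t z).
Proof.
move=> lt lz; apply: (lz (fun x => gen_Cspan l (act t x))) => //.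
- by rewrite rmorph0.
- by move=> x y lx ly; rewrite rmorphD; apply: gen_CspanD.
by move=> c x lx; rewrite rmorphM act_iota => S S0 SD SZ Sl; apply: (SZ); apply: lx.
Qed.

Lemma gen_Cspan_bound l m (u : 'I_m -> E) :
  lin_indep iota u -> (forall i, gen_Cspan l (u i)) -> (m <= size l)%N.
Proof.
move=> indu lu; apply: (indep_Cspan_bound (t := tnth (in_tuple l)) indu) => i.
apply: (lu i (Cspan iota (tnth (in_tuple l)))) => [|x y|c x|v].
- by exists (fun=> 0); rewrite big1 // => j _; rewrite rmorph0 mul0r.
- by move=> [b ->] [c ->]; exists (fun j => b j + c j); rewrite -big_split;
    apply: eq_bigr => j _; rewrite rmorphD mulrDl.
- exact: Cspan_scale.
by move=> /seq_tnthP[j ->]; apply: Cspan_mem.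
Qed.

(** It bounds the number of [C]-independent differences [act t z - z], so that finite bases of them
    exist. *)
Definition orbit_finite z := exists2 l, forall t u, u \in l -> gen_Cspan l (act t u) &
  gen_Cspan l z.

Lemma orbit_finiteD x y : orbit_finite x -> orbit_finite y -> orbit_finite (x + y).
Proof.
move=> [l ls lx] [m ms my].
have ll : forall u, u \in l -> gen_Cspan (l ++ m) u.
  by move=> u lu; apply: gen_Cspan_mem; rewrite mem_cat lu.
have mm : forall u, u \in m -> gen_Cspan (l ++ m) u.
  by move=> u mu; apply: gen_Cspan_mem; rewrite mem_cat mu orbT.
exists (l ++ m) => [t u|]; last by apply: gen_CspanD; [apply: gen_Cspan_sub lx | apply: gen_Cspan_sub my].
rewrite mem_cat => /orP[/ls|/ms] => [/(_ t)|/(_ t)]; exact: gen_Cspan_sub.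
Qed.

Lemma orbit_finiteM x y : orbit_finite x -> orbit_finite y -> orbit_finite (x * y).
Proof.
move=> [l ls lx] [m ms my]; exists [seq u * v | u <- l, v <- m]; last exact: gen_CspanM.
move=> t _ /allpairsP[[u v] [/= lu mv ->]]; rewrite rmorphM.
by apply: gen_CspanM; [apply: ls | apply: ms].
Qed.

Lemma orbit_finite_iota a : orbit_finite (iota a).
Proof.
exists [:: iota a] => [t u|]; last by apply: gen_Cspan_mem; rewrite inE.
by rewrite inE => /eqP->; rewrite act_iota; apply: gen_Cspan_mem; rewrite inE.
Qed.

Lemma orbit_finiteN x : orbit_finite x -> orbit_finite (- x).
Proof.
by move=> lx; rewrite -mulN1r -(rmorphN1 iota); apply/orbit_finiteM/lx/orbit_finite_iota.
Qed.

Lemma orbit_finite_sum (I : Type) (r : seq I) (f : I -> E) :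
  (forall i, orbit_finite (f i)) -> orbit_finite (\sum_(i <- r) f i).
Proof.
move=> ff; elim/big_ind: _ => // [|x y]; last exact: orbit_finiteD.
by rewrite -(rmorph0 iota); apply: orbit_finite_iota.
Qed.

Lemma gen_Cspan_diff l : (forall t u, u \in l -> gen_Cspan l (act t u)) ->
  forall s z, gen_Cspan l z -> gen_Cspan l (iter_diff act s z).
Proof.
move=> ls; elim=> //= t s IHs z lz; apply: IHs; apply: gen_CspanD.
  by apply: gen_Cspan_act lz => u; apply: ls.
exact: gen_CspanN.
Qed.

Lemma orbit_finite_diff s z : orbit_finite z -> orbit_finite (iter_diff act s z).
Proof. by move=> [l ls lz]; exists l => //; apply: gen_Cspan_diff. Qed.

End OrbitFinite.

Inductive primitive_polynomial : E -> Prop :=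
| PrimBase a : primitive_polynomial (iota a)
| Prim p a of der p = iota a : primitive_polynomial p
| PrimD x y of primitive_polynomial x & primitive_polynomial y : primitive_polynomial (x + y)
| PrimM x y of primitive_polynomial x & primitive_polynomial y : primitive_polynomial (x * y).

Lemma prim_sum (I : Type) (r : seq I) (f : I -> E) :
  (forall i, primitive_polynomial (f i)) -> primitive_polynomial (\sum_(i <- r) f i).
Proof.
move=> ff; elim/big_ind: _ => // [|x y]; last exact: PrimD.
by rewrite -(rmorph0 iota); apply: PrimBase.
Qed.

Variables (T : Type) (act : T -> {rmorphism E -> E}).
Hypothesis actG : forall t, is_dgal iota (act t).
Hypothesis fixG : forall z, (forall t, act t z = z) -> exists a, z = iota a.
Hypothesis charF : [pchar F] =i pred0.

Let act_iota t a : act t (iota a) = iota a. Proof. by case: (actG t). Qed.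

Lemma iter_der_iota k a : iter k der (iota a) = iota (iter k der a).
Proof. by elim: k => //= k ->; rewrite iota_der. Qed.

(** The differences of [w] are in [F]; let the [phi i] be a [C]-basis of them. By the Wronskian,
    some [F]-combinations [z i] of derivatives of [w] are dual to it: their differences are the
    constant coordinates of those of [w]. So each [der (z i)] is in [F], and [w] minus the sum of
    the [phi i * z i] is fixed. *)
Lemma fil2_primitive w : fil act 2 w -> orbit_finite act w -> primitive_polynomial w.
Proof.
move=> f2 [l ls lw]; pose X f := exists t, f = act t w - w.
have [|m [f [Xf indf spanf]]] := @maximal_indep_family _ _ iota X (size l).
  move=> m v Xv indv; apply: (gen_Cspan_bound indv) => i.
  have [t ->] := Xv i; exact: (gen_Cspan_diff act_iota ls [:: t] lw).
have fixf t : exists a, act t w - w = iota a.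
  by apply: fixG; apply: (fil1 act _).1; apply: (filS act 1 w).1.
have exphi i : exists a, f i = iota a by have [t ->] := Xf i; apply: fixf.
have [phi phiE] := fun_choice exphi.
pose P (v : 'rV[F]_m) := exists k, v = \row_i iter k der (phi i).
have [|m' [M [B [PM BM]]]] := @separating_left_inverse F m P.
  move=> g Pg; apply/colP => i; rewrite mxE; apply/eqP; rewrite -(fmorph_eq0 iota).
  apply/eqP; move: i; apply: (wronskian_kernel0 iota_der nnc indf) => k.
  have /matrixP/(_ 0 0) := Pg _ (ex_intro _ k erefl); rewrite !mxE => /(congr1 iota).
  rewrite rmorph0 rmorph_sum => e; rewrite -[RHS]e; apply: eq_bigr => i _ /=.
  by rewrite mxE rmorphM phiE iter_der_iota mulrC.
have [k kM] := fun_choice PM.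
pose z i := \sum_j iota (B i j) * iter (k j) der w.
have dz t i c : act t w - w = \sum_j cst (c j) * f j -> act t (z i) - z i = cst (c i).
  move=> tw; transitivity (\sum_j iota (B i j) * iter (k j) der (act t w - w)).
    rewrite rmorph_sum -sumrB; apply: eq_bigr => j _ /=.
    rewrite rmorphM act_iota (dgal_iter (actG t)) -mulrBr; congr (_ * _).
    by rewrite iter_derD; congr (_ + _); elim: (k j) => //= q <-; rewrite derN.
  rewrite tw; under eq_bigr do rewrite (iter_der_lin iota_der) mulr_sumr.
  rewrite exchange_big /=; transitivity (\sum_j cst (c j) * iota ((B *m M) i j)).
    apply: eq_bigr => j _; rewrite mxE rmorph_sum mulr_sumr; apply: eq_bigr => q _ /=.
    rewrite rmorphM phiE iter_der_iota mulrCA; congr (_ * (_ * iota _)).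
    by have /rowP/(_ j) := kM q; rewrite !mxE.
  rewrite BM (bigD1 i) //= mxE eqxx rmorph1 mulr1 big1 ?addr0 // => j /negPf ij.
  by rewrite mxE eq_sym ij rmorph0 mulr0.
have [c cE] := fun_choice (fun t => spanf _ (ex_intro _ t erefl)).
have [a wa] : exists a, w - \sum_i iota (phi i) * z i = iota a.
  apply: fixG => t; apply/eqP; rewrite -subr_eq0 rmorphB.
  set S := \sum_i _; have -> : act t w - act t S - (w - S) = act t w - w - (act t S - S) by ring.
  rewrite subr_eq0 cE rmorph_sum -sumrB; apply/eqP/eq_bigr => i _ /=.
  by rewrite rmorphM act_iota -mulrBr (dz t i (c t)) // phiE mulrC.
rewrite -(subrK (\sum_i iota (phi i) * z i) w) wa; apply: PrimD; first exact: PrimBase.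
apply: prim_sum => i; apply: PrimM; first exact: PrimBase.
have [b zb] : exists b, der (z i) = iota b; last exact: Prim zb.
apply: fixG => t; apply/eqP; rewrite -subr_eq0 (dgal_der (actG t)) -derB.
by rewrite (dz t i (c t)) // (der_cst iota_der).
Qed.

(** Independence over [F] modulo [fil act k] implies independence over [C], so the bound applies and
    a longest family spans. *)
Lemma indep_mod_fil_maximal k N (X : E -> Prop) :
  (forall m (u : 'I_m -> E), (forall i, X (u i)) -> lin_indep iota u -> (m <= N)%N) ->
  exists m (u : 'I_m -> E), [/\ forall i, X (u i),
    forall a : 'I_m -> F, fil act k (\sum_i iota (a i) * u i) -> forall i, a i = 0 &
    forall v, X v -> exists a : 'I_m -> F, fil act k (v - \sum_i iota (a i) * u i)].
Proof.
move=> bound.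
pose A m := exists u : 'I_m -> E, (forall i, X (u i)) /\
  forall a : 'I_m -> F, fil act k (\sum_i iota (a i) * u i) -> forall i, a i = 0.
have boundA m : A m -> (m <= N)%N.
  move=> [u [Xu indu]]; apply: (bound _ u) => // c c0 i; apply: val_inj => /=.
  apply: (indu (fun i => const_val (c i))).
  by rewrite [X in fil _ _ X]c0; apply: fil_zero.
have [|m Am maxm] := @ex_minimizer nat (fun m => N - m)%N A.
  by exists 0%N, (fun=> 0); split=> [[]|a _ []].
have [u [Xu indu]] := Am; exists m, u; split=> // v Xv; apply: NNPP => Nv.
suff Am1 : A m.+1 by have := maxm _ Am1; have := boundA _ Am1; lia.
exists (extend u v); split=> [i|a].
  by case: (unliftP ord0 i) => [j|] ->; rewrite ?extend_lift ?extend0.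
rewrite big_ord_recl extend0; under eq_bigr do rewrite extend_lift.
have [a0 | a0] := eqVneq (a ord0) 0.
  rewrite a0 rmorph0 mul0r add0r => /indu al i.
  by case: (unliftP ord0 i) => [j|] ->; rewrite ?al ?a0.
move=> fa; case: Nv; exists (fun i => - ((a ord0)^-1 * a (lift ord0 i))).
have -> : v - \sum_i iota (- ((a ord0)^-1 * a (lift ord0 i))) * u i =
    iota (a ord0)^-1 * (iota (a ord0) * v + \sum_i iota (a (lift ord0 i)) * u i).
  rewrite mulrDr mulrA -rmorphM mulVf // rmorph1 mul1r mulr_sumr -sumrN.
  congr (_ + _); apply: eq_bigr => i _.
  by rewrite rmorphN mulNr opprK rmorphM mulrA.
exact: filZ.
Qed.

Hypothesis com : forall t u z, act t (act u z) = act u (act t z).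

(* The [z_i] are an F-basis of the [(t - 1) z] modulo lower order and the [w_i]
   form a dual family in [fil 2], so that [k+1] times [z] agrees with
   [\sum w_i z_i] modulo lower order. *)
Lemma fil_primitive k z : fil act k.+1 z -> orbit_finite act z -> primitive_polynomial z.
Proof.
elim: k z => [|k IHk] z fz lz.
  by have [|a ->] := fixG (z := z); [apply: (fil1 act _).1 | apply: PrimBase].
have [l ls lz'] := lz.
pose X v := exists t, v = act t z - z.
have [|r [zi [Xzi indzi spanzi]]] := @indep_mod_fil_maximal k (size l) X.
  move=> m v Xv indv; apply: (gen_Cspan_bound indv) => i.
  have [t ->] := Xv i; exact: (gen_Cspan_diff act_iota ls [:: t] lz').
have fzi i : fil act k.+1 (zi i) by have [t ->] := Xzi i; apply: (filS act _ z).1.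
have lzi i : orbit_finite act (zi i).
  by have [t ->] := Xzi i; apply: (orbit_finite_diff act_iota [:: t] lz).
have expsi s i : exists a, size s = k -> iter_diff act s (zi i) = iota a.
  (* Only lists of length [k] matter; for them the difference of [zi i] is fixed, hence in [F].
     Other lengths get the default 0. *)
  case: (eqVneq (size s) k) => [sk|/eqP sk]; last by exists 0.
  have [|a aE] := fixG (z := iter_diff act s (zi i)); last by exists a.
  by apply: (fil1 act _).1; apply: (fil_iter_diff sk); rewrite addn1.
have [psi psiE] := fun_choice (fun s => fun_choice (expsi s)).
pose P (v : 'rV[F]_r) := exists2 s, size s = k & v = \row_i psi s i.
have [|m [M [B [PM BM]]]] := @separating_left_inverse F r P.
  move=> g Pg; apply/colP => i; rewrite mxE; move: i; apply: indzi => s sk.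
  rewrite iter_diff_sum.
  have /matrixP/(_ 0 0) := Pg _ (ex_intro2 _ _ s sk erefl); rewrite !mxE => /(congr1 iota).
  rewrite rmorph0 rmorph_sum => e; rewrite -[RHS]e; apply: eq_bigr => i _ /=.
  by rewrite mxE rmorphM iter_diffM // psiE // mulrC.
have exs i : exists s, size s = k /\ row i M = \row_j psi s j.
  by have [s sk e] := PM i; exists s.
have [s0 sE] := fun_choice exs.
have [a aE] := fun_choice (fun t => spanzi _ (ex_intro _ t erefl)).
(* Differences of order [k] of [z] are combined through [B] so that the difference of [w i] along
   [t] is the coordinate [a t i]. *)
pose w i := \sum_j iota (B i j) * iter_diff act (s0 j) z.
have dw t i : act t (w i) - w i = iota (a t i).
  transitivity (\sum_j iota (B i j) * iter_diff act (s0 j) (act t z - z)).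
    rewrite rmorph_sum -sumrB; apply: eq_bigr => j _ /=.
    by rewrite rmorphM act_iota -mulrBr iter_diff_commute.
  transitivity (\sum_j iota (B i j) * \sum_q iota (a t q) * iota (M j q)).
    apply: eq_bigr => j _; congr (_ * _); have [sk Msj] := sE j.
    rewrite -(subrK (\sum_q iota (a t q) * zi q) (act t z - z)) iter_diffD.
    rewrite aE // add0r iter_diff_sum; apply: eq_bigr => q _; rewrite iter_diffM // psiE //.
    by congr (_ * iota _); have /rowP/(_ q) := Msj; rewrite !mxE.
  under eq_bigr do rewrite mulr_sumr.
  rewrite exchange_big /=; transitivity (\sum_q iota (a t q) * iota ((B *m M) i q)).
    apply: eq_bigr => q _; rewrite mxE rmorph_sum mulr_sumr; apply: eq_bigr => j _ /=.
    by rewrite rmorphM mulrCA.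
  rewrite BM (bigD1 i) //= mxE eqxx rmorph1 mulr1 big1 ?addr0 // => j /negPf ij.
  by rewrite mxE eq_sym ij rmorph0 mulr0.
have lw i : orbit_finite act (w i).
  apply: orbit_finite_sum => // j; apply: orbit_finiteM => //.
    exact: orbit_finite_iota.
  exact: orbit_finite_diff.
have pw i : primitive_polynomial (w i).
  apply: fil2_primitive; last exact: lw.
  by apply/filS => t; rewrite dw; apply/fil1.
have k0 : k.+1%:R != 0 :> F by move/pcharf0P: charF => ->.
pose S := \sum_i w i * zi i.
have pS : primitive_polynomial S.
  by apply: prim_sum => i; apply: PrimM; [apply: pw | apply: IHk].
have lS : orbit_finite act S.
  by apply: orbit_finite_sum => // i; apply: orbit_finiteM.
(* A difference of order [k.+1] of [S] is [k.+1] times that of [z], so subtracting [S / k.+1] lowers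
   the filtration by one. *)
rewrite -(subrK (iota k.+1%:R^-1 * S) z); apply: PrimD; last by apply: PrimM; [apply: PrimBase|].
apply: IHk; last first.
  apply: orbit_finiteD => //; apply: orbit_finiteN => //; apply: orbit_finiteM => //.
  exact: orbit_finite_iota.
move=> s sk; rewrite iter_diffD -mulrN -[- S]mulN1r iter_diffM // iter_diffM; last first.
  by move=> t; rewrite rmorphN1.
rewrite (@iter_diff_symbol _ _ _ com _ w (fun t i => iota (a t i)) k.+1 z) //; last first.
  by move=> t s' [sk']; apply: aE.
by rewrite mulN1r mulrN -(rmorph_nat iota) mulrA -rmorphM mulVf // rmorph1 mul1r subrr.
Qed.

End CommutativeUnipotent.

(** * Iterated integrals *)

Section IteratedIntegrals.
Variables (F E : diffFieldType) (iota : {rmorphism F -> E}).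
Hypotheses (iota_der : diff_morphism iota) (nnc : no_new_constants iota).
Local Notation C := (constants F).
Local Notation cst := (cst iota).
Local Notation app := (dop_app iota).
Variable x : F.
Hypotheses (x_der : der x = 1) (charF : [pchar F] =i pred0).

Lemma app_nseq1 k z : app (Lop (nseq k 1)) z = iter k der z.
Proof. by elim: k => [|k IHk]; rewrite ?app_nil //= app_cons // IHk rmorph1 mul1r. Qed.

Lemma iterated_integralP eta : iterated_integral iota eta <->
  exists l a, iter l der eta = iota a.
Proof.
split=> [[f [f_gt0 f0 f1]] | [l [a ea]]].
  have tail (r : seq F) : (forall i, (i < size r)%N -> r`_i = 1) -> r = nseq (size r) 1.
    by move=> r1; apply: (eq_from_nth (x0 := 0)); rewrite ?size_nseq // => i lt_i;
      rewrite r1 // nth_nseq lt_i.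
  case: f f_gt0 f0 f1 => [//|b [|g r]] _ /=.
    rewrite andbT app_cons // app_nil => b0 _ /eqP; rewrite mulf_eq0 fmorph_eq0 (negPf b0).
    by move=> /eqP e; exists 1%N, 0; rewrite rmorph0.
  move=> /and3P[b0 g0 _] f1; rewrite (tail r) => [|i lt_i]; last exact: (f1 i.+2).
  rewrite !app_cons // app_nseq1 => /eqP; rewrite mulf_eq0 fmorph_eq0 (negPf b0) /=.
  move=> /eqP/(const_cst iota_der nnc)[c Dc].
  have ig0 : iota g != 0 by rewrite fmorph_eq0.
  exists (size r).+1, (g^-1 * const_val c); rewrite /= rmorphM fmorphV.
  by apply: (mulfI ig0); rewrite mulVKf.
(* The second entry must be nonzero and make [g * der a] constant: it is 1 for this choice, or 0
   when [der a = 0]. *)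
pose g := if der a == 0 then 1 else (der a)^-1.
have g0 : g != 0 by rewrite /g; case: (eqVneq (der a) 0) => [_|]; rewrite ?oner_neq0 // invr_eq0.
exists [:: 1, g & nseq l 1]; split=> //.
- by rewrite /= oner_neq0 g0; apply/allP => b /nseqP[-> _]; apply: oner_neq0.
- by case=> [|[|i]] //= lt_i _; rewrite nth_nseq; case: ifP => //; rewrite size_nseq in lt_i; lia.
rewrite !app_cons // app_nseq1 ea -iota_der -rmorphM -iota_der /g.
by case: (eqVneq (der a) 0) => [->|a0]; rewrite ?mulr0 ?mulVf // ?der0 ?der1 rmorph0 mulr0.
Qed.

Definition diff_closed (S : E -> Prop) : Prop :=
  [/\ forall a, S (iota a), forall x y, S x -> S y -> S (x - y),
      forall x y, S x -> S y -> S (x * y), forall x, S x -> S x^-1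
    & forall x, S x -> S (der x)].

Lemma diff_closedD (S : E -> Prop) y z : diff_closed S -> S y -> S z -> S (y + z).
Proof.
move=> [Si SB _ _ _] Sy Sz; rewrite -[z]opprK; apply: (SB) => //.
by rewrite -sub0r -(rmorph0 iota); apply: SB.
Qed.

Lemma diff_closed_sum (S : E -> Prop) (I : Type) (r : seq I) (f : I -> E) :
  diff_closed S -> (forall i, S (f i)) -> S (\sum_(i <- r) f i).
Proof.
move=> cS Sf; elim/big_ind: _ => // [|y z]; last exact: diff_closedD.
by case: cS => Si _ _ _ _; rewrite -(rmorph0 iota).
Qed.

Lemma iter_der_scale_primitive k g p a : der p = iota a ->
  exists b, iter k der (iota g * p) = iota (iter k der g) * p + iota b.
Proof.
move=> dp; elim: k => [|k [b IHk]]; first by exists 0; rewrite rmorph0 addr0.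
exists (iter k der g * a + der b); rewrite /= IHk derD derM dp -!iota_der.
by rewrite rmorphD rmorphM addrA.
Qed.

(* The witness [eta + x ^ l p] has [l]-th derivative [l! p] modulo [F]. *)
Lemma iterated_primitives (ps : seq E) : (forall p, p \in ps -> exists a, der p = iota a) ->
  exists eta l a, iter l der eta = iota a /\
    forall S, diff_closed S -> S eta -> forall p, p \in ps -> S p.
Proof.
elim: ps => [|p ps IHps] dps; first by exists 0, 0%N, 0; rewrite rmorph0.
have [|eta [l [a [etal Seta]]]] := IHps.
  by move=> q qps; apply: dps; rewrite inE qps orbT.
have [|d dp] := dps p; first exact: mem_head.
have [b xp] := iter_der_scale_primitive l (x ^+ l) dp.
rewrite (iter_der_exp x_der) subnn expr0 ffactnn in xp.
have e : iter l der (eta + iota (x ^+ l) * p) = iota l`!%:R * p + iota (a + b).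
  by rewrite iter_derD etal xp rmorphD; ring.
have l0 : l`!%:R != 0 :> F by move/pcharf0P: charF => ->; rewrite -lt0n fact_gt0.
exists (eta + iota (x ^+ l) * p), l.+1, (l`!%:R * d + der (a + b)); split.
  rewrite /= e derD derM dp -!iota_der rmorphD rmorphM; congr (_ + _).
  by rewrite [der _](_ : _ = 0) ?rmorph0 ?mul0r ?add0r // -[_%:R]mulr1 mulr_natl raddfMn /= der1 mul0rn.
move=> S cS S1; have [Si SB SM _ SD] := cS.
have Sp : S p.
  have Sl k z : S z -> S (iter k der z) by move=> Sz; elim: k => //= k; apply: SD.
  have -> : p = iota l`!%:R^-1 * (iter l der (eta + iota (x ^+ l) * p) - iota (a + b)).
    by rewrite e addrK mulrA -rmorphM mulVf // rmorph1 mul1r.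
  by apply: (SM) => //; apply: (SB) => //; apply: Sl.
have Se : S eta by rewrite -(addrK (iota (x ^+ l) * p) eta); apply: (SB) => //; apply: SM.
by move=> q; rewrite inE => /orP[/eqP->|/(Seta S cS Se)].
Qed.

Lemma primitive_polynomial_seq z : primitive_polynomial iota z ->
  exists2 ps : seq E, forall p, p \in ps -> exists a, der p = iota a &
    forall S, diff_closed S -> (forall p, p \in ps -> S p) -> S z.
Proof.
have cat_seq (ps qs : seq E) : (forall p, p \in ps -> exists a, der p = iota a) ->
    (forall p, p \in qs -> exists a, der p = iota a) ->
    forall p, p \in ps ++ qs -> exists a, der p = iota a.
  by move=> dp dq p; rewrite mem_cat => /orP[/dp|/dq].
elim=> [a|p a dp|y t _ [ps dps Sps] _ [qs dqs Sqs]|y t _ [ps dps Sps] _ [qs dqs Sqs]].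
- by exists [::] => // S [Si _ _ _ _].
- exists [:: p] => [q|S _]; first by rewrite inE => /eqP->; exists a.
  by apply; rewrite mem_head.
- exists (ps ++ qs) => [|S cS Spq]; first exact: cat_seq.
  by apply: diff_closedD => //; [apply: Sps => // p pp | apply: Sqs => // p pp];
    apply: Spq; rewrite mem_cat pp ?orbT.
exists (ps ++ qs) => [|S cS Spq]; first exact: cat_seq.
have [_ _ SM _ _] := cS.
by apply: SM; [apply: Sps => // p pp | apply: Sqs => // p pp];
  apply: Spq; rewrite mem_cat pp ?orbT.
Qed.

Lemma iterated_generator n (y : 'I_n -> E) :
  diff_generated_by iota (fun z => exists i, z = y i) ->
  (forall i, primitive_polynomial iota (y i)) ->
  exists eta, iterated_integral iota eta /\ diff_generated_by iota (fun z => z = eta).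
Proof.
move=> geny py.
have [ps dps Sps] : exists2 ps : seq E, forall p, p \in ps -> exists a, der p = iota a &
    forall S, diff_closed S -> (forall p, p \in ps -> S p) ->
      forall i, i \in enum 'I_n -> S (y i).
  elim: (enum 'I_n) => [|j r [ps dps Sps]]; first by exists [::].
  have [qs dqs Sqs] := primitive_polynomial_seq (py j).
  exists (ps ++ qs) => [p|S cS Spq i].
    by rewrite mem_cat => /orP[/dps|/dqs].
  rewrite inE => /orP[/eqP->|ri].
    by apply: Sqs => // p pq; apply: Spq; rewrite mem_cat pq orbT.
  by apply: Sps ri => // p pq; apply: Spq; rewrite mem_cat pq.
have [eta [l [a [etal Seta]]]] := iterated_primitives dps.
exists eta; split; first by apply/iterated_integralP; exists l, a.
move=> S cS Se; apply: (geny S cS) => _ [i ->].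
apply: (Sps S cS); last by rewrite mem_enum.
by apply: (Seta S cS); apply: Se.
Qed.

Lemma iter_der_eq0 l z : iter l der z = 0 ->
  exists c : nat -> C, z = \sum_(i < l) cst (c i) * iota (x ^+ i).
Proof.
elim: l z => [|l IHl] z /=; first by move=> ->; exists (fun=> 0); rewrite big_ord0.
rewrite -iterS iterSr => /IHl[c dz].
pose z1 := \sum_(i < l) cst (c i * i.+1%:R^-1) * iota (x ^+ i.+1).
have natC0 i : i.+1%:R != 0 :> C by move/pcharf0P: (pchar_constants charF) => ->.
have dz1 : der z1 = der z.
  rewrite dz (raddf_sum der); apply: eq_bigr => i _ /=.
  have dx : der (x ^+ i.+1) = i.+1%:R * x ^+ i.
    by have := iter_der_exp x_der 1 i.+1; rewrite /= subn1 ffactn1 -mulr_natl.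
  have e : cst i.+1%:R^-1 * iota i.+1%:R = 1.
    by rewrite rmorph_nat -(rmorph_nat cst) -rmorphM mulVf ?rmorph1.
  by rewrite der_cstM // -iota_der dx !rmorphM mulrA -(mulrA (cst (c i))) e mulr1.
have /(const_cst iota_der nnc)[c0 Dc0] : der (z - z1) = 0 by rewrite derB dz1 subrr.
exists (fun i => if i is j.+1 then c j * j.+1%:R^-1 else c0).
by rewrite big_ord_recl expr0 rmorph1 mulr1 -Dc0 subrK.
Qed.

End IteratedIntegrals.

(** * Commutative Galois groups *)

Section CommutativeGroup.
Variables (F E : diffFieldType) (iota : {rmorphism F -> E}).
Hypotheses (iota_der : diff_morphism iota) (nnc : no_new_constants iota).
Local Notation C := (constants F).
Local Notation cst := (cst iota).
Variable x : F.
Hypotheses (x_der : der x = 1) (charF : [pchar F] =i pred0).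
Hypothesis closedC : GRing.closed_field_axiom C.
Variables (n : nat) (L : {diffop F}) (y : 'I_n -> E).
Hypotheses (L_monic : monic_op L) (L_order : dop_order L = n).
Hypothesis y_basis : solution_basis iota L y.
Hypothesis y_gen : diff_generated_by iota (fun z => exists i, z = y i).

Lemma dgal_commute (A : E -> Prop) (s t : {rmorphism E -> E}) :
  is_dgal iota s -> is_dgal iota t -> diff_generated_by iota A ->
  (forall a, A a -> s (t a) = t (s a)) -> forall z, s (t z) = t (s z).
Proof.
move=> sG tG genA; apply: genA; split=> [a|u v su sv|u v su sv|u su|u su].
- by rewrite !(dgal_base sG, dgal_base tG).
- by rewrite !rmorphB su sv.
- by rewrite !rmorphM su sv.
- by rewrite !fmorphV su.
by rewrite !(dgal_der sG, dgal_der tG) su.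
Qed.

Lemma commutative_dgalP : commutative_group (dgal_mx iota y) <->
  forall s t : {rmorphism E -> E}, is_dgal iota s -> is_dgal iota t ->
    forall z, s (t z) = t (s z).
Proof.
have [_ y_indep _] := y_basis; split=> [comG s t sG tG|comG A B [s sG sA] [t tG tB]].
  have [A sA] := dgal_matrix y_basis sG; have [B tB] := dgal_matrix y_basis tG.
  apply: (dgal_commute sG tG y_gen) => _ [j ->].
  rewrite (dgal_comp_matrix sG sA tB) (dgal_comp_matrix tG tB sA).
  by rewrite comG //; [exists s | exists t].
apply/matrixP => i j; move: i; apply: (lin_indep_coef y_indep).
by rewrite -(dgal_comp_matrix sG sA tB) -(dgal_comp_matrix tG tB sA) comG.
Qed.

Lemma commute_of_iterated eta : iterated_integral iota eta ->
  diff_generated_by iota (fun z => z = eta) ->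
  forall s t : {rmorphism E -> E}, is_dgal iota s -> is_dgal iota t ->
    forall z, s (t z) = t (s z).
Proof.
move=> /(iterated_integralP iota_der nnc)[l [a etal]] geneta s t sG tG.
have shift (u : {rmorphism E -> E}) : is_dgal iota u -> exists b, u eta = eta + iota b.
  move=> uG; have [|c Dc] := @iter_der_eq0 F E iota iota_der nnc x x_der charF l (u eta - eta).
    rewrite iter_derD -(dgal_iter uG) etal (dgal_base uG).
    have -> : iter l der (- eta) = - iter l der eta by elim: (l) => //= k ->; rewrite derN.
    by rewrite etal subrr.
  exists (\sum_(i < l) const_val (c i) * x ^+ i); rewrite -(subrK eta (u eta)) Dc addrC.
  by rewrite rmorph_sum; congr (_ + _); apply: eq_bigr => i _ /=; rewrite rmorphM.
have [b sb] := shift s sG; have [d td] := shift t tG.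
apply: (dgal_commute sG tG geneta) => _ ->.
by rewrite sb td !rmorphD sb td (dgal_base sG) (dgal_base tG) addrAC.
Qed.

Lemma orbit_finite_solution (j : 'I_n) :
  orbit_finite iota (@dgal_act F E iota) (y j).
Proof.
exists [seq y i | i <- enum 'I_n] => [t _ /mapP[i _ ->]|]; last first.
  by apply: gen_Cspan_mem; apply: map_f; rewrite mem_enum.
have [A tA] := dgal_matrix y_basis (svalP t).
rewrite [dgal_act t _]tA => S S0 SD SZ Sl; elim/big_ind: _ => [||k _] //.
by apply: (SZ); apply: Sl; apply: map_f; rewrite mem_enum.
Qed.

Lemma iterated_generator_of_commutative :
  acts_unipotently iota y -> commutative_group (dgal_mx iota y) ->
  exists eta, iterated_integral iota eta /\ diff_generated_by iota (fun z => z = eta).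
Proof.
move=> uy /commutative_dgalP com.
have [f [f' [f0 f'0 DL]]] := factor_of_acts iota_der nnc closedC charF L_monic L_order
  y_basis y_gen uy.
have if'0 : iota f' != 0 by rewrite fmorph_eq0.
have [y_sol _ _] := y_basis.
apply: (iterated_generator iota_der nnc x_der charF y_gen) => j.
(* It is [iota f' * y j] that [Lop f] kills, which places it in the filtration of the whole group
   and not only of each automorphism. *)
rewrite -(mulKf if'0 (y j)) -fmorphV; apply: PrimM; first exact: PrimBase.
apply: (@fil_primitive _ _ _ iota_der nnc _ (@dgal_act F E iota) _ _ charF _ n).
- by move=> t; apply: svalP.
- move=> z fz; apply: (fixed_base iota_der nnc closedC charF L_monic L_order y_basis y_gen).
  by move=> s sG; apply: (fz (exist _ s sG)).
- by move=> t u z; apply: com; apply: svalP.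
- apply: (@fil_mono _ _ _ n) => //; rewrite -{1}(size_tuple f).
  by apply: (Lop_fil iota_der nnc f0); rewrite -dop_appC -dop_appM // -DL.
apply: orbit_finiteM; last exact: orbit_finite_solution.
apply: orbit_finite_iota => t a; exact: (dgal_base (svalP t)).
Qed.

Lemma iterated_gen_iterated eta : iterated_integral iota eta -> gen_iterated_integral iota eta.
Proof. by move=> [f [f_gt0 f0 _ fe]]; exists f. Qed.

Lemma iterated_generator_iff :
  (exists eta : E, iterated_integral iota eta /\ diff_generated_by iota (fun z => z = eta)) <->
  (exists (m : nat) (H : 'M[C]_m -> Prop),
      [/\ unipotent_group H, commutative_group H & alg_group_iso (dgal_mx iota y) H]).
Proof.
have L0 : L != 0 by apply: monic_neq0.
have lagG := dgal_linear_algebraic_group iota_der nnc L0 L_order y_basis y_gen.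
split=> [[eta [eta_it geneta]]|[m [H [uH cH isoH]]]].
  exists n, (dgal_mx iota y); split.
  - apply/(unipotent_groupP iota_der nnc L_monic L_order y_basis y_gen).
    apply: (acts_unipotently_of_primitive iota_der nnc closedC y_basis) geneta.
    exact: iterated_gen_iterated.
  - exact/commutative_dgalP/(commute_of_iterated eta_it).
  exists id, id; split=> // i j; exists 'X_(mxvec_index i j), 0%N => A _;
    by rewrite mx_evalX expr0 divr1.
apply: iterated_generator_of_commutative.
  apply/(acts_unipotentlyP y_basis) => A.
  exact: (alg_group_iso_unipotent closedC (pchar_constants charF) lagG isoH uH).
exact: (alg_group_iso_commutative lagG isoH cH).
Qed.

End CommutativeGroup.
Theorem theorem1p1
  (F E : diffFieldType)
  (charF : [pchar F] =i pred0)
  (closedC : GRing.closed_field_axiom (constants F))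
  (iota : {rmorphism F -> E}) (iota_der : diff_morphism iota)
  (n : nat) (L : {diffop F}) (L_monic : monic_op L) (L_order : dop_order L = n)
  (L_PV : picard_vessiot iota L)
  (y : 'I_n -> E) (y_basis : solution_basis iota L y)
  (x : F) (x_der : der x = 1) :
  [/\ [<->
        unipotent_group (dgal_mx iota y);
        (forall z : E, PV_ring iota z <-> gen_iterated_integral iota z);
        (exists eta : E, gen_iterated_integral iota eta /\
                   diff_generated_by iota (fun z => z = eta));
        (exists (f : n.-tuple F) (f' : F),
                   [/\ nonzero_entries f, f' != 0 & L = Lop f * dopC f'])],
      (exists eta : E, gen_iterated_integral iota eta /\
         diff_generated_by iota (fun z => z = eta)) ->
      exists (l : nat) (g : l.-tuple F),
        [/\ (0 < l)%N, nonzero_entries g & picard_vessiot iota (Lop g)]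
    &
      forall (f : n.-tuple F) (f' : F),
        nonzero_entries f -> f' != 0 -> L = Lop f * dopC f' ->
        exists v : 'I_n -> E,
          solution_basis iota L v /\
          forall i : 'I_n, exists z : E,
            nested_integral iota (take i (rev f)) z /\
            v i = (iota f')^-1 * z]
  /\
  ((exists eta : E, iterated_integral iota eta /\
      diff_generated_by iota (fun z => z = eta))
   <->
   (exists (m : nat) (H : 'M[constants F]_m -> Prop),
      [/\ unipotent_group H, commutative_group H
        & alg_group_iso (dgal_mx iota y) H])).
Proof.
have L0 : L != 0 := monic_neq0 L_monic.
have [_ nnc [v [[v_sol _ _] v_gen]]] := L_PV.
have [y_sol y_indep y_span] := y_basis.
(* The Picard-Vessiot hypothesis provides its own basis [v]; each [v i] is a constant combination of
   the given [y], so the [y] generate [E] as well. *)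
have y_gen : diff_generated_by iota (fun z => exists i, z = y i).
  move=> S cS Sy; apply: (v_gen S cS) => _ [i ->].
  have [c ->] := y_span _ (v_sol i).
  apply: (@diff_closed_sum F E iota S _ _ _ cS) => j; have [Si _ SM _ _] := cS.
  by apply: SM; [apply: Si | apply: Sy; exists j].
have uP := unipotent_groupP iota_der nnc L_monic L_order y_basis y_gen.
have gen_factor eta : gen_iterated_integral iota eta ->
    diff_generated_by iota (fun z => z = eta) ->
    exists (f : n.-tuple F) (f' : F), [/\ nonzero_entries f, f' != 0 & L = Lop f * dopC f'].
  move=> eta_it geneta.
  apply: (factor_of_acts iota_der nnc closedC charF L_monic L_order y_basis y_gen).
  exact: (acts_unipotently_of_primitive iota_der nnc closedC y_basis eta_it geneta).
split; last exact: (iterated_generator_iff iota_der nnc x_der charF closedC L_monic L_order y_basis y_gen).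
split; last by move=> f f'; apply: (nested_basis iota_der nnc L_order L0 y_basis).
- tfae.
  + move=> /uP uy z.
    exact: (gen_iterated_of_acts iota_der nnc closedC charF L_monic L_order y_basis y_gen).
  + move=> PVI; have [|eta PVeta geneta] := gen_iterated_primitive_element iota_der x_der charF y_gen.
      by move=> i; apply/PVI; exists L.
    by exists eta; split=> //; apply/PVI.
  + by move=> [eta [eta_it geneta]]; apply: (gen_factor eta).
  move=> [f [f' [f0 f'0 DL]]]; apply/uP.
  exact: (acts_unipotently_of_factor iota_der nnc y_basis f0 f'0 DL).
move=> [eta [eta_it geneta]]; have [f [f' [f0 f'0 DL]]] := gen_factor eta eta_it geneta.
exact: (picard_vessiot_Lop iota_der nnc y_basis y_gen f0 f'0 DL).
Qed.
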